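(* Let $T>0$, let $m\ge 1$, let $\alpha_0>\alpha_1>\cdots>\alpha_m\ge 0$ be real numbers, let $n_i$ be the nonnegative integer with $n_i-1<\alpha_i\le n_i$ ($i=0,\dots,m$), and let $\gamma=n_0-\alpha_0\in[0,1)$. Assume that $n_0=n_1$ and that $a_i\in C^1_\gamma[0,T]$ and $D_{0+}^{n_0-\alpha_0}a_i\in C[0,T]$ for $i=1,\dots,m$. Assume that $H_0\ne\emptyset$, where $H_j=\{i\in\{1,\dots,m\}:0\le\alpha_i\le j\}$ (so that every $H_j$ is nonempty), and put $h_j=\min H_j$. Let $b_0,\dots,b_{n_0-1}\in\mathbb R$. Then the initial value problem $${}^cD_{0+}^{\alpha_0}y(t)=-\sum_{i=1}^m a_i(t)\,{}^cD_{0+}^{\alpha_i}y(t),\quad 0<t<T;\qquad D^ky(t)|_{t=+0}=b_k,\quad k=0,1,\dots,n_0-1,$$ has a unique solution $y\in C_\gamma^{n_0}[0,T]$, and it is represented as $y(t)=\sum_{j=0}^{n_0-1}b_jy_j(t)$, where $y_j\in C_\gamma^{n_0}[0,T]$, $j=0,1,\dots,n_0-1$, is the canonical fundamental system of solutions of the equation ${}^cD_{0+}^{\alpha_0}y(t)=-\sum_{i=1}^m a_i(t)\,{}^cD_{0+}^{\alpha_i}y(t)$, $0<t<T$, given by $$y_j(t)=\Phi_{j+1}(t)+\sum_{k=0}^\infty(-1)^{k+1}I_{0+}^{\alpha_0}\Big[\sum_{i=1}^m a_i(t)I_{0+}^{\alpha_0-\alpha_i}\Big]^k\sum_{i=h_j}^m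 a_i(t)\Phi_{j+1-\alpha_i}(t).$$
   Context: All functions are real valued. For $0\le\gamma<1$, $C_\gamma[0,T]$ is the space of functions $f$ on $(0,T]$ such that $t\mapsto t^\gamma f(t)$ belongs to $C[0,T]$ (i.e. extends continuously to $[0,T]$); $C_0[0,T]=C[0,T]$. For $n\in\mathbb N$, $C^n_\gamma[0,T]$ is the space of functions $f$ that are $n-1$ times continuously differentiable on $[0,T]$ and have an $n$-th derivative $f^{(n)}\in C_\gamma[0,T]$; $C^0_\gamma=C_\gamma$. Riemann–Liouville integral: $I_{0+}^\alpha f(t)=\frac1{\Gamma(\alpha)}\int_0^t(t-\tau)^{\alpha-1}f(\tau)\,d\tau$ for $\alpha>0$, and $I^0_{0+}f=f$. Riemann–Liouville derivative: for $n-1<\alpha\le n$, $D_{0+}^\alpha f(t)=\frac{d^n}{dt^n}I_{0+}^{n-\alpha}f(t)$ for $t>0$ (with $D^0_{0+}f=f$). Caputo derivative: for $n-1<\alpha\le n$, ${}^cD_{0+}^\alpha f(t)=D_{0+}^\alpha\big[f(t)-\sum_{k=0}^{n-1}\frac{f^{(k)}(0)}{k!}t^k\big]$; in particular ${}^cD^0_{0+}f=f$. $D^k=d^k/dt^k$. $\Phi_{\beta}(t)=t^{\beta-1}/\Gamma(\beta)$ for $\beta>0$; thus $\Phi_{j+1}(t)=t^j/j!$, and $\Phi_{j+1-\alpha_i}=D_{0+}^{\alpha_i}\Phi_{j+1}$ when $\alpha_i\le j$. The bracket $\big[\sum_i a_i(t)I_{0+}^{\alpha_0-\alpha_i}\big]^k$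 is the $k$-th power (composition) of the operator $g\mapsto\sum_{i=1}^m a_i\cdot I_{0+}^{\alpha_0-\alpha_i}g$, the $0$-th power being the identity. The infinite series is the limit of its partial sums, for each $t\in[0,T]$. A canonical fundamental system of solutions of the equation is a system of solutions $y_0,\dots,y_{n_0-1}$ with $D^ky_j(t)|_{t=+0}=1$ if $k=j$ and $=0$ if $k\ne j$, for $k,j=0,1,\dots,n_0-1$. *)

(* Defs.v *)
From HB Require Import structures.
From mathcomp Require Export all_boot all_order all_algebra.
From mathcomp Require Export all_classical all_reals all_analysis.

Set Implicit Arguments.
Unset Strict Implicit.
Unset Printing Implicit Defensive.

Export Order.TTheory GRing.Theory Num.Theory.
Export numFieldNormedType.Exports.

#[export] Set Implicit Arguments.
#[export] Unset Strict Implicit.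
#[export] Unset Printing Implicit Defensive.

Local Open Scope classical_set_scope.
Local Open Scope ring_scope.

(* Functions on [0, T] or (0, T] are total functions R -> R whose values
   outside the interval are irrelevant: every notion below only looks at the
   values on the interval, and "equality of functions" means equality there. *)

Section Derivatives.
Context {R : realType}.
Implicit Types (D : set R) (f : R -> R).

(* Derivatives relative to an interval D, hence one-sided at those endpoints
   of D that belong to D.  As [lim] is total, [deriv_on] is only meaningful
   together with [derivable_on]. *)
Definition derivable_on D f (x : R) : Prop :=
  cvg ((f z - f x) / (z - x) @[z --> within D x^']).

Definition deriv_on D f (x : R) : R :=
  lim ((f z - f x) / (z - x) @[z --> within D x^']).

Definition derivn_on D (n : nat) f : R -> R := iter n (deriv_on D) f.

Definition times_derivable_on D (n : nat) f : Prop :=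
  forall k, (k < n)%N -> forall x, D x -> derivable_on D (derivn_on D k f) x.

End Derivatives.

Section Spaces.
Context {R : realType}.
Implicit Types (gamma T : R) (f : R -> R).

(* The value of f at 0 plays no role.  For functions given on (0, T],
   [C_gamma 0 T] is C[0, T]. *)
Definition C_gamma gamma T f : Prop :=
  exists g : R -> R, {within `[0, T], continuous g} /\
    forall t, 0 < t <= T -> t `^ gamma * f t = g t.

Definition Cn_gamma (n : nat) gamma T f : Prop :=
  if n is p.+1 then
    [/\ times_derivable_on `[0, T] p f,
        forall k, (k <= p)%N -> {within `[0, T], continuous (derivn_on `[0, T] k f)},
        forall t, 0 < t <= T -> derivable_on `[0, T] (derivn_on `[0, T] p f) t
      & C_gamma gamma T (derivn_on `[0, T] p.+1 f)]
  else C_gamma gamma T f.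

End Spaces.

Section FractionalCalculus.
Context {R : realType}.
Implicit Types (alpha beta T : R) (f : R -> R).

Local Notation mu := (@lebesgue_measure R).

Definition Gamma (x : R) : R :=
  \int[mu]_(t in `]0, +oo[) (t `^ (x - 1) * expR (- t)).

Definition Phi beta (t : R) : R := t `^ (beta - 1) / Gamma beta.

Definition RL_int alpha f (t : R) : R :=
  if alpha == 0 then f t
  else (Gamma alpha)^-1 * \int[mu]_(s in `[0, t]) ((t - s) `^ (alpha - 1) * f s).

(* For alpha >= 0, the n such that n - 1 < alpha <= n. *)
Definition frac_order alpha : nat := `|Num.ceil alpha|%N.

Definition RL_derivable T alpha f : Prop :=
  let n := frac_order alpha in
  times_derivable_on `]0, T] n (RL_int (n%:R - alpha) f).

Definition RL_deriv T alpha f : R -> R :=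
  let n := frac_order alpha in
  derivn_on `]0, T] n (RL_int (n%:R - alpha) f).

Definition Caputo_remainder T alpha f (t : R) : R :=
  f t - \sum_(0 <= k < frac_order alpha) derivn_on `[0, T] k f 0 / k`!%:R * t ^+ k.

Definition Caputo_derivable T alpha f : Prop :=
  times_derivable_on `[0, T] (frac_order alpha).-1 f /\
  RL_derivable T alpha (Caputo_remainder T alpha f).

Definition Caputo_deriv T alpha f : R -> R :=
  RL_deriv T alpha (Caputo_remainder T alpha f).

End FractionalCalculus.

(* In the following, the orders alpha_0, ..., alpha_m, the coefficients
   a_1, ..., a_m and the initial values b_0, ..., b_(n0 - 1) are given by
   sequences of which only the terms with these indices are used. *)
Section Problem.
Context {R : realType}.
Variables (T : R) (m : nat) (alpha : nat -> R) (a : nat -> R -> R).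

Definition H (j : nat) : set nat :=
  [set i | (1 <= i <= m)%N /\ 0 <= alpha i <= j%:R].

Definition is_min (A : set nat) (i : nat) : Prop :=
  A i /\ forall k, A k -> (i <= k)%N.

Definition solves_equation (y : R -> R) : Prop :=
  (forall i, (i <= m)%N -> Caputo_derivable T (alpha i) y) /\
  forall t, 0 < t < T ->
    Caputo_deriv T (alpha 0%N) y t =
    - \sum_(1 <= i < m.+1) a i t * Caputo_deriv T (alpha i) y t.

Definition has_initial_values (n0 : nat) (b : nat -> R) (y : R -> R) : Prop :=
  forall k, (k < n0)%N -> derivn_on `[0, T] k y t @[t --> 0^'+] --> b k.

Definition canonical_fundamental_system (n0 : nat) (y : nat -> R -> R) : Prop :=
  forall j, (j < n0)%N ->
    solves_equation (y j) /\
    has_initial_values n0 (fun k => (k == j)%:R) (y j).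

Definition series_op (g : R -> R) (t : R) : R :=
  \sum_(1 <= i < m.+1) a i t * RL_int (alpha 0%N - alpha i) g t.

(* The k-th term of the series for y_j; hj stands for h_j. *)
Definition series_term (j hj k : nat) (t : R) : R :=
  (-1) ^+ k.+1 *
  RL_int (alpha 0%N)
    (iter k series_op
       (fun s => \sum_(hj <= i < m.+1) a i s * Phi (j%:R + 1 - alpha i) s)) t.

Definition series_solution (j hj : nat) (t : R) : R :=
  Phi (j%:R + 1) t + limn (series (fun k => series_term j hj k t)).

End Problem.

(* Main.v *)
(* Put x = D^alpha_0 of y minus its Taylor polynomial.  The initial value problem becomes
   x = -(f + A x), with A = sum_i a_i I^(alpha_0 - alpha_i) and f the contribution of the
   Taylor polynomial.  In the norm sup t^c e^(-l t) |x(t)| with l large, A is a contraction,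
   which gives uniqueness and the convergence of the Neumann series for x; applying
   I^alpha_0 termwise yields the series for y_j.  For y to be in C^n0_gamma, x must have a
   derivative of order gamma.  When gamma > 0, continuity of D^gamma a_i forces a_i(0) = 0,
   hence a_i = I^1 a_i', and the product rule shows that A (I^1 z) = I^1 (B z) for an
   operator B of the same type acting on functions with a t^(-gamma) singularity.  The
   Neumann series for B then provides x = I^1 z. *)

(* A Neumann series that converges in a sup norm says nothing about derivatives of its sum.
   Membership in C^n0_gamma therefore comes from comparing two series partial sum by partial sum:
   the iterates for A are the antiderivatives of the iterates for B. When [gamma = 0] no derivative
   of x is wanted, and a limit of x at 0+ suffices. All estimates take place in the classes
   [sing U c] of functions continuous on ]0, U[ and O(s^(-c)) there. Products add exponents and
   integration of order d subtracts d, so handling singularities reduces to arithmetic of exponents.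
   For existence U is 2 T: the coefficients are extended beyond T, T becomes an interior point, and
   the two-sided rules of differentiation hold at T too. Uniqueness is argued on ]0, T[, where the
   equation of a competing solution is known. Fractional integrals are treated as convolutions on
   the whole line with kernels extended by 0. The semigroup law needs no Beta integral: homogeneity
   gives the convolution of two kernels up to a constant, and integration against e^(-t) determines
   the constant. *)
Require Import Defs.
From mathcomp Require Import ring lra measurable_realfun.

Local Open Scope classical_set_scope.
Local Open Scope ring_scope.

(** * Affine changes of variable in Lebesgue integrals *)

Section AffineChangeOfVariable.
Context {R : realType}.
Local Notation mu := (@lebesgue_measure R).
Local Open Scope ereal_scope.

(** The image of Lebesgue measure under the translation agrees with it on half-open intervals, hence
    everywhere. The scaling rule below is obtained in the same way. *)
Lemma ge0_integral_shift (c : R) (f : R -> \bar R) :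
  measurable_fun setT f -> (forall x, 0 <= f x) ->
  \int[mu]_x f (x + c)%R = \int[mu]_x f x.
Proof.
move=> mf f0.
pose phi := (fun x => x + c)%R : measurableTypeR R -> measurableTypeR R.
have mphi : measurable_fun setT phi by exact: measurable_funD.
have muE A : measurable A -> pushforward mu phi A = mu A.
  move=> mA; apply/esym.
  apply: (@lebesgue_measure_unique _ (pushforward mu phi)) mA => _ [[a b]] _ <-.
  transitivity (mu (phi @^-1` `]a, b])) => //=.
  have -> : phi @^-1` `]a, b] = `](a - c)%R, (b - c)%R]%classic.
    apply/seteqP; split => x /=; rewrite !in_itv/= /phi => /andP[h1 h2];
      by apply/andP; split; lra.
  rewrite !lebesgue_measure_itv/= !lte_fin ltrD2r.
  by case: ifPn => // _; rewrite -!EFinB; congr EFin; ring.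
transitivity (\int[pushforward mu phi]_x f x).
  by rewrite ge0_integral_pushforward// preimage_setT.
by apply: eq_measure_integral => //= A mA _; exact: muE.
Qed.

Lemma ge0_integral_scale (c : R) (f : R -> \bar R) : (0 < c)%R ->
  measurable_fun setT f -> (forall x, 0 <= f x) ->
  \int[mu]_x f (c * x)%R = c^-1%:E * \int[mu]_x f x.
Proof.
move=> c0 mf f0.
pose phi := (fun x => c * x)%R : measurableTypeR R -> measurableTypeR R.
have mphi : measurable_fun setT phi by exact: measurable_funM.
have c0' : (0 <= c)%R by rewrite ltW.
(* Preimages under the dilation have their lengths divided by [c]; this factor restores Lebesgue
   measure. *)
pose nu := mscale (NngNum c0') (pushforward mu phi).
have muE A : measurable A -> nu mphi A = mu A.
  move=> mA; apply/esym.
  apply: (@lebesgue_measure_unique _ (nu mphi)) mA => _ [[a b]] _ <-.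
  transitivity (c%:E * mu (phi @^-1` `]a, b])) => //=.
  have -> : phi @^-1` `]a, b] = `](a / c)%R, (b / c)%R]%classic.
    apply/seteqP; split => x /=; rewrite !in_itv/= /phi => /andP[h1 h2];
      apply/andP; split; move: h1 h2;
      by rewrite ?ltr_pdivrMr ?ler_pdivlMr ?ltr_pdivlMr ?ler_pdivrMr// mulrC.
  rewrite !lebesgue_measure_itv/= !lte_fin ltr_pM2r ?invr_gt0//.
  case: ifPn => // _; last by rewrite mule0.
  by rewrite -!EFinB -EFinM; congr EFin; field; rewrite gt_eqF.
rewrite -[in RHS](@eq_measure_integral _ _ _ _ mu (nu mphi)); last first.
  by move=> A mA _; exact: muE.
rewrite ge0_integral_mscale//= muleA -EFinM mulVf ?gt_eqF// mul1e.
by rewrite ge0_integral_pushforward// preimage_setT.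
Qed.

End AffineChangeOfVariable.

(** * The Gamma function and the convolution semigroup of the Riemann-Liouville kernels *)

Section GammaKernel.
Context {R : realType}.
Local Notation mu := (@lebesgue_measure R).

Lemma powR_gt0D (x r s : R) : 0 < x -> x `^ (r + s) = x `^ r * x `^ s.
Proof. by move=> x0; rewrite powRD// (gt_eqF x0) implybT. Qed.

(** Extended by 0 to u <= 0, so that an integral over ]0, t[ becomes a convolution over the whole
    line, where translation, dilation and Tonelli apply without care for domains. *)
Definition power_ker (d : R) (u : R) : R := if 0 < u then u `^ (d - 1) else 0.

Lemma power_ker_ge0 d u : 0 <= power_ker d u.
Proof. by rewrite /power_ker; case: ifP => // _; exact: powR_ge0. Qed.

Lemma measurable_power_ker d : measurable_fun setT (power_ker d).
Proof.
rewrite /power_ker.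
apply: measurable_fun_ifT.
- exact: measurable_fun_ltr.
- exact: measurable_powR.
- exact: measurable_cst.
Qed.

(** Monotone convergence along compact intervals that avoid the singularity; on each of them the
    antiderivative x^d / d gives a value of at most 1 / d. *)
Lemma integral_power_near0 (d : R) : 0 < d ->
  (\int[mu]_(x in `]0%R, 1%R]) (x `^ (d - 1))%:E <= d^-1%:E)%E.
Proof.
move=> d0.
(* [n.+2] rather than [n.+1] keeps the interval nondegenerate, as [continuous_FTC2] demands. *)
pose F (n : nat) := `[n.+2%:R^-1 : R, 1%R]%classic : set R.
have FU : \bigcup_n F n = `]0%R, 1%R]%classic.
  apply/seteqP; split => x /=.
    move=> [n _]; rewrite /F/= !in_itv/= => /andP[h ->]; rewrite andbT.
    by rewrite (lt_le_trans _ h)// invr_gt0.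
  rewrite in_itv/= => /andP[x0 x1].
  exists (Num.truncn x^-1) => //; rewrite /F/= in_itv/= x1 andbT.
  rewrite invf_ple ?posrE// (le_trans (ltW (truncnS_gt _)))//.
  by rewrite ler_nat.
have ndF : {homo F : n m / (n <= m)%N >-> (n <= m)%O}.
  move=> m n mn; apply/subsetPset => x; rewrite /F/= !in_itv/= => /andP[h ->].
  by rewrite andbT (le_trans _ h)// lef_pV2 ?posrE// ler_nat.
have mp i : measurable_fun (F i) (fun x : R => (x `^ (d - 1))%:E).
  by apply/measurable_EFinP; apply: measurable_funTS; exact: measurable_powR.
have H : (\int[mu]_(x in F i) (x `^ (d - 1))%:E)%E @[i --> \oo] -->
    (\int[mu]_(x in `]0%R, 1%R]) (x `^ (d - 1))%:E)%E.
  rewrite -FU; apply: ge0_nondecreasing_set_cvg_integral => //.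
    by move=> i; exact: measurable_itv.
  by move=> *; rewrite lee_fin powR_ge0.
rewrite -(cvg_lim _ H)//.
apply: lime_le; first by apply/cvg_ex; eexists; exact: H.
apply: nearW => n /=.
have n0 : (0 : R) < n.+2%:R^-1 by rewrite invr_gt0.
have n1 : (n.+2%:R^-1 : R) < 1 by rewrite invf_lt1// ltr1n.
have cp e (x : R) : 0 < x -> {for x, continuous (@powR R ^~ e)}.
  by move=> x0; apply/differentiable_continuous/derivable1_diffP/derivable_powR;
     rewrite in_itv/= x0.
rewrite (@continuous_FTC2 _ _ (fun x => x `^ d / d))//.
- rewrite -EFinB lee_fin powR1 mul1r lerBlDr lerDl.
  by rewrite divr_ge0 ?powR_ge0// ltW.
- apply: continuous_in_subspaceT => x; rewrite inE/= in_itv/= => /andP[h _].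
  by apply: cp; rewrite (lt_le_trans _ h).
- split.
  + move=> x; rewrite in_itv/= => /andP[h _]; apply: derivableM => //.
    by apply: derivable_powR; rewrite in_itv/= (lt_trans _ h).
  + by apply: cvgM; [apply: cvg_at_right_filter; exact: cp|exact: cvg_cst].
  + by apply: cvgM; [apply: cvg_at_left_filter; exact: cp|exact: cvg_cst].
- move=> x; rewrite in_itv/= => /andP[h _].
  have x0 : 0 < x by rewrite (lt_trans _ h).
  rewrite derive1E deriveMr; last by apply: derivable_powR; rewrite in_itv/= x0.
  rewrite -derive1E powR_derive1 ?in_itv/= ?x0//.
  by rewrite mulrA mulVf ?mul1r// gt_eqF.
Qed.

Definition gamma_fun (d : R) (u : R) : R := power_ker d u * expR (- u).

Lemma gamma_fun_ge0 d u : 0 <= gamma_fun d u.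
Proof. by rewrite mulr_ge0 ?power_ker_ge0 ?expR_ge0. Qed.

Lemma measurable_expRN : measurable_fun setT (fun u : R => expR (- u)).
Proof. by apply: measurableT_comp => //; exact: measurable_expR. Qed.

Lemma measurable_gamma_fun d : measurable_fun setT (gamma_fun d).
Proof.
apply: measurable_funM; [exact: measurable_power_ker|exact: measurable_expRN].
Qed.

(** One half of the decay e^(-u) is spent on the power, through e^(u/2) >= (u/2)^(n+1) / (n+1)! with
    n + 1 > d; the other half is kept for integrability. *)
Lemma gamma_fun_tail (d : R) : exists C : R, 0 <= C /\
  forall u, 1 <= u -> gamma_fun d u <= C * expR (- (2^-1 * u)).
Proof.
pose n := Num.truncn d; exists (n.+1`!%:R * 2 ^+ n.+1); split.
  by rewrite mulr_ge0// exprn_ge0.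
move=> u u1; have u0 : 0 < u by lra.
rewrite /gamma_fun /power_ker u0.
have -> : - u = - (2^-1 * u) - (2^-1 * u) by lra.
rewrite expRD mulrA ler_wpM2r ?expR_ge0// expRN ler_pdivrMr ?expR_gt0//.
have h : u `^ (d - 1) <= u ^+ n.+1.
  rewrite -powR_mulrn ?(ltW u0)// ler_powR// lerBlDr.
  by rewrite (le_trans (ltW (truncnS_gt d)))// lerDl.
rewrite (le_trans h)//.
have := @expR_ge1Dxn R (2^-1 * u) n; rewrite mulr_ge0 ?(ltW u0)// => /(_ isT) hh.
have {hh} : (2^-1 * u) ^+ n.+1 / n.+1`!%:R <= expR (2^-1 * u) by lra.
rewrite ler_pdivrMr ?ltr0n ?fact_gt0// exprMn exprVn => hh.
have -> : u ^+ n.+1 = 2 ^+ n.+1 * ((2 ^+ n.+1)^-1 * u ^+ n.+1).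
  by rewrite mulrA divff ?mul1r// expf_neq0.
rewrite (mulrC n.+1`!%:R) -(mulrA (2 ^+ n.+1) n.+1`!%:R) ler_wpM2l ?exprn_ge0//.
by rewrite [leRHS]mulrC.
Qed.

Definition Gammae (d : R) : \bar R := (\int[mu]_u (gamma_fun d u)%:E)%E.

Lemma integral_expN : (\int[mu]_(u in `[0%R, +oo[) (expR (- u))%:E = 1)%E.
Proof.
have := @integral_exponential_pdf R 1 ltr01.
rewrite -[in X in X -> _](setUv `[0%R, +oo[%classic) ge0_integral_setU//=; last 4 first.
- exact: measurableC.
- by rewrite setUv; apply/measurable_EFinP; exact: measurable_exponential_pdf.
- by move=> x _; rewrite lee_fin exponential_pdf_ge0.
- exact/disj_setPCl.
rewrite [X in (_ + X)%E]integral0_eq ?adde0; last first.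
  by move=> x x0; rewrite /exponential_pdf patchE ifF// memNset.
move=> <-; apply: eq_integral => x; rewrite inE/= in_itv/= andbT => x0.
by rewrite exponential_pdfE// mul1r mulN1r.
Qed.

Lemma Gammae_fin (d : R) : 0 < d -> Gammae d \is a fin_num.
Proof.
move=> d0; rewrite /Gammae.
have m0 : measurable_fun setT (fun u => (gamma_fun d u)%:E).
  by apply/measurable_EFinP; exact: measurable_gamma_fun.
rewrite ge0_fin_numE; last first.
  by apply: integral_ge0 => u _; rewrite lee_fin gamma_fun_ge0.
have [C [C0 hC]] := gamma_fun_tail d.
rewrite -(setUv `]0%R, 1%R]%classic) ge0_integral_setU//=; last 4 first.
- exact: measurableC.
- by rewrite setUv.
- by move=> x _; rewrite lee_fin gamma_fun_ge0.
- exact/disj_setPCl.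
apply: lte_add_pinfty.
  apply: le_lt_trans (ltry d^-1); apply: le_trans (integral_power_near0 d0).
  apply: ge0_le_integral => //.
  - by move=> x _; rewrite lee_fin gamma_fun_ge0.
  - exact: measurable_funTS.
  - by apply/measurable_EFinP; apply: measurable_funTS; exact: measurable_powR.
  - move=> x /=; rewrite in_itv/= => /andP[x0 x1].
    rewrite lee_fin /gamma_fun /power_ker x0 ler_piMr ?powR_ge0//.
    by rewrite -expR0 ler_expR oppr_le0 ltW.
have hr : 0 < 2^-1 :> R by rewrite invr_gt0.
have mE : measurable_fun setT (fun x => (exponential_pdf 2^-1 x)%:E : \bar R).
  by apply/measurable_EFinP; exact: measurable_exponential_pdf.
(* The exponential density of rate 1/2 is half of e^(-u/2), whence the factor 2. *)
apply: (@le_lt_trans _ _ ((2 * C)%:E * \int[mu]_x (exponential_pdf 2^-1 x)%:E)%E); last first.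
  by rewrite integral_exponential_pdf// mule1 ltry.
rewrite -ge0_integralZl//; last 2 first.
- by move=> x _; rewrite lee_fin exponential_pdf_ge0// ltW.
- by rewrite lee_fin mulr_ge0.
apply: (@le_trans _ _ (\int[mu]_(x in ~` `]0%R, 1%R]) ((2 * C)%:E * (exponential_pdf 2^-1 x)%:E))%E).
  apply: ge0_le_integral => //.
  - exact: measurableC.
  - by move=> x _; rewrite lee_fin gamma_fun_ge0.
  - exact: measurable_funTS.
  - by apply: measurable_funTS; exact: measurable_funeM.
  - move=> x /=; rewrite in_itv/= => /negP; rewrite negb_and -leNgt -ltNge => /orP[x0|x1].
      rewrite /gamma_fun /power_ker ltNge x0/= mul0r -EFinM lee_fin.
      by rewrite !mulr_ge0// exponential_pdf_ge0// ltW.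
    rewrite -EFinM lee_fin exponential_pdfE; last by lra.
    rewrite (le_trans (hC _ (ltW x1)))// mulNr (mulrC 2) -mulrA (mulrA 2).
    by rewrite divff// mul1r.
apply: ge0_subset_integral => //; first exact: measurableC.
- exact: measurable_funeM.
- by move=> x _; rewrite -EFinM lee_fin !mulr_ge0// exponential_pdf_ge0// ltW.
Qed.

Lemma Gammae_gt0 (d : R) : (0 < Gammae d)%E.
Proof.
have mg : measurable_fun setT (fun u => (gamma_fun d u)%:E).
  by apply/measurable_EFinP; exact: measurable_gamma_fun.
(* On [1, 2] the power t^(d-1) lies above the smaller of its two endpoint values, whatever the sign
   of d - 1, and e^(-t) lies above e^(-2). *)
pose c := Num.min (2 `^ (d - 1)) 1 * expR (-2).
have c0 : 0 < c by rewrite mulr_gt0 ?expR_gt0// lt_min powR_gt0//=.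
apply: (@lt_le_trans _ _ (\int[mu]_(x in `[1%R, 2%R]) (c%:E))%E).
  rewrite integral_cst//= lebesgue_measure_itv/= lte_fin ltr1n -EFinB -EFinM lte_fin.
  by rewrite mulr_gt0//; lra.
apply: (@le_trans _ _ (\int[mu]_(x in `[1%R, 2%R]) (gamma_fun d x)%:E)%E); last first.
  by apply: ge0_subset_integral => // x _; rewrite lee_fin gamma_fun_ge0.
apply: ge0_le_integral => //.
- by move=> x _; rewrite lee_fin ltW.
- exact: measurable_funTS.
- move=> x /=; rewrite in_itv/= => /andP[x1 x2].
  have x0 : 0 < x by lra.
  rewrite lee_fin /gamma_fun /power_ker x0 ler_pM ?expR_ge0//.
  - rewrite ge_min; apply/orP; have [d1|d1] := leP 0 (d - 1).
      by right; have := ler_powR x1 d1; rewrite powRr0.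
    left; rewrite -(opprK (d - 1)) !(powRN _ (- _)) lef_pV2 ?posrE ?powR_gt0//.
    by apply: ge0_ler_powR => //; rewrite ?nnegrE; lra.
  - by rewrite ler_expR; lra.
Qed.

Lemma GammaE (d : R) : Gamma d = fine (Gammae d).
Proof.
rewrite /Gamma /Rintegral /Gammae; congr fine.
rewrite [LHS]integral_mkcond; apply: eq_integral => x _.
rewrite patchE /gamma_fun /power_ker; case: ifPn => [|h].
  by rewrite inE/= in_itv/= andbT => ->.
rewrite ifF ?mul0r//; apply/negP => x0; move/negP: h; apply.
by rewrite inE/= in_itv/= x0.
Qed.

Lemma EFin_Gamma (d : R) : 0 < d -> (Gamma d)%:E = Gammae d.
Proof. by move=> d0; rewrite GammaE fineK// Gammae_fin. Qed.

Lemma Gamma_gt0 (d : R) : 0 < d -> 0 < Gamma d.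
Proof. by move=> d0; rewrite -lte_fin EFin_Gamma// Gammae_gt0. Qed.

Lemma Gamma1 : Gamma (1 : R) = 1.
Proof.
apply: EFin_inj; rewrite EFin_Gamma// -[RHS]integral_expN.
rewrite -integral_itv_obnd_cbnd; last first.
  by apply/measurable_EFinP; apply: measurable_funTS; exact: measurable_expRN.
rewrite /Gammae [RHS]integral_mkcond; apply: eq_integral => x _.
rewrite patchE /gamma_fun /power_ker subrr powRr0; case: ifPn => [x0|x0].
  by rewrite mem_set/= ?in_itv/= ?x0// mul1r.
by rewrite mul0r memNset//= in_itv/= (negbTE x0).
Qed.

(** [Phi d] extended by 0. With this normalisation its integral against e^(-u) is 1, which later
    fixes the constant in the convolution of two kernels. *)
Definition rl_ker (d : R) (u : R) : R := (Gamma d)^-1 * power_ker d u.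

Lemma rl_ker_ge0 d u : 0 < d -> 0 <= rl_ker d u.
Proof.
by move=> d0; rewrite mulr_ge0 ?power_ker_ge0// invr_ge0 ltW// Gamma_gt0.
Qed.

Lemma rl_ker_le0 d u : u <= 0 -> rl_ker d u = 0.
Proof. by move=> u0; rewrite /rl_ker /power_ker ltNge u0 mulr0. Qed.

Lemma rl_kerE d u : 0 < u -> rl_ker d u = (Gamma d)^-1 * u `^ (d - 1).
Proof. by move=> u0; rewrite /rl_ker /power_ker u0. Qed.

Lemma measurable_rl_ker d : measurable_fun setT (rl_ker d).
Proof. by apply: measurable_funM => //; exact: measurable_power_ker. Qed.

Lemma measurable_rl_ker_comp d0 (X : measurableType d0) d (f : X -> R) :
  measurable_fun setT f -> measurable_fun setT (fun x => rl_ker d (f x)).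
Proof. by move=> mf; exact: (measurableT_comp (measurable_rl_ker d) mf). Qed.

Lemma rl_ker_scale d t u : 0 < t -> rl_ker d (t * u) = t `^ (d - 1) * rl_ker d u.
Proof.
move=> t0; have [u0|u0] := leP u 0.
  by rewrite !rl_ker_le0 ?mulr0// pmulr_rle0.
by rewrite !rl_kerE ?mulr_gt0// powRM ?(ltW t0) ?(ltW u0)// mulrCA.
Qed.

Lemma integral_rl_ker_exp d : 0 < d ->
  (\int[mu]_u (rl_ker d u * expR (- u))%:E = 1)%E.
Proof.
move=> d0; transitivity ((Gamma d)^-1%:E * Gammae d)%E.
  rewrite /Gammae -ge0_integralZl//.
  - by apply: eq_integral => u _; rewrite -EFinM mulrA.
  - by apply/measurable_EFinP; exact: measurable_gamma_fun.
  - by move=> u _; rewrite lee_fin gamma_fun_ge0.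
  - by rewrite lee_fin invr_ge0 ltW// Gamma_gt0.
by rewrite -EFin_Gamma// -EFinM mulVf// gt_eqF// Gamma_gt0.
Qed.

Lemma integral_rl_ker_exp_shift (d s : R) : 0 < d ->
  (\int[mu]_t (rl_ker d (t - s) * expR (- t))%:E = (expR (- s))%:E)%E.
Proof.
move=> d0.
rewrite -(@ge0_integral_shift _ s); last 2 first.
- apply/measurable_EFinP; apply: measurable_funM; last exact: measurable_expRN.
  by apply: measurable_rl_ker_comp; exact: measurable_funB.
- by move=> x; rewrite lee_fin mulr_ge0 ?rl_ker_ge0 ?expR_ge0.
transitivity ((expR (- s))%:E * \int[mu]_u (rl_ker d u * expR (- u))%:E)%E.
  rewrite -ge0_integralZl//.
  - apply: eq_integral => u _; rewrite -EFinM addrK opprD expRD; congr EFin; ring.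
  - apply/measurable_EFinP; apply: measurable_funM; last exact: measurable_expRN.
    exact: measurable_rl_ker.
  - by move=> x _; rewrite lee_fin mulr_ge0 ?rl_ker_ge0 ?expR_ge0.
by rewrite integral_rl_ker_exp// mule1.
Qed.

(** Homogeneity: the substitution s -> t s reduces the convolution at t to the one at 1. The
    integral that remains is a Beta integral, at this stage neither computed nor known to be
    finite. *)
Lemma ge0_rl_ker_convE (a b t : R) : 0 < a -> 0 < b -> 0 < t ->
  (\int[mu]_s (rl_ker a (t - s) * rl_ker b s)%:E =
   (t `^ (a + b - 1))%:E * \int[mu]_s (rl_ker a (1 - s) * rl_ker b s)%:E)%E.
Proof.
move=> a0 b0 t0.
pose F (r s : R) : \bar R := (rl_ker a (r - s) * rl_ker b s)%:E.
have mF r : measurable_fun setT (F r).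
  apply/measurable_EFinP; apply: measurable_funM; last exact: measurable_rl_ker.
  by apply: measurable_rl_ker_comp; exact: measurable_funB.
have F0 r x : (0 <= F r x)%E by rewrite lee_fin !(rl_ker_ge0, mulr_ge0).
have FE s : (t%:E * F t (t * s)%R = (t `^ (a + b - 1))%:E * F 1%R s)%E.
  rewrite /F -!EFinM; congr EFin.
  rewrite -{2}(mulr1 t) -mulrBr !rl_ker_scale//.
  have -> : a + b - 1 = 1 + (a - 1) + (b - 1) by ring.
  by rewrite !powR_gt0D// powRr1 ?(ltW t0)// mulrACA !mulrA.
rewrite -/(F t) -/(F 1).
transitivity (t%:E * \int[mu]_s F t (t * s)%R)%E.
  rewrite (ge0_integral_scale t0 (mF t) (F0 t)) muleA -EFinM mulfV ?gt_eqF//.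
  by rewrite mul1e.
have mFt : measurable_fun setT (fun s : R => F t (t * s)).
  by apply: (measurableT_comp (mF t)); exact: measurable_funM.
have t0E : (0 <= t%:E)%E by rewrite lee_fin ltW.
have p0E : (0 <= (t `^ (a + b - 1))%:E)%E by rewrite lee_fin powR_ge0.
transitivity (\int[mu]_s (t%:E * F t (t * s)%R))%E.
  by rewrite (ge0_integralZl mu measurableT mFt (fun s _ => F0 t (t * s)) t0E).
transitivity (\int[mu]_s ((t `^ (a + b - 1))%:E * F 1%R s))%E.
  by apply: eq_integral => s _; rewrite FE.
by rewrite (ge0_integralZl mu measurableT (mF 1) (fun s _ => F0 1 s) p0E).
Qed.

(** By homogeneity only the constant [C] is unknown. When the convolution is integrated against
    e^(-t), Tonelli yields 1, while the homogeneous form yields [C * Gammae (a + b)]. *)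
Lemma ge0_rl_ker_conv (a b t : R) : 0 < a -> 0 < b ->
  (\int[mu]_s (rl_ker a (t - s) * rl_ker b s)%:E = (rl_ker (a + b) t)%:E)%E.
Proof.
move=> a0 b0; have ab0 : 0 < a + b by rewrite addr_gt0.
have [t0|t0] := leP t 0.
  rewrite [in RHS]rl_ker_le0// integral0_eq// => s _.
  have [s0|s0] := leP s 0; first by rewrite [X in _ * X]rl_ker_le0// mulr0.
  by rewrite rl_ker_le0 ?mul0r//; lra.
rewrite ge0_rl_ker_convE//.
set C := (\int[mu]_s (rl_ker a (1 - s) * rl_ker b s)%:E)%E.
have k0 r x : (0%E <= (rl_ker a (r - x) * rl_ker b x)%:E :> \bar R)%E.
  by rewrite lee_fin mulr_ge0 ?rl_ker_ge0.
have C0 : (0 <= C)%E by apply: integral_ge0 => s _; exact: k0.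
(* This equation also excludes that [C] is infinite. *)
suff : (C * Gammae (a + b) = 1)%E.
  rewrite -EFin_Gamma//; case: C C0 => [c| |]//= c0; last first.
    by rewrite mulyr gtr0_sg ?Gamma_gt0// mul1e.
  rewrite -EFinM => -[cE]; rewrite rl_kerE// mulrC -EFinM; congr EFin.
  by congr (_ * _); rewrite -(mul1r (_^-1)) -cE mulfK// gt_eqF// Gamma_gt0.
pose F (z : R * R) := (rl_ker a (z.1 - z.2) * rl_ker b z.2 * expR (- z.1))%:E : \bar R.
have F0 z : (0 <= F z)%E by rewrite /F lee_fin !(expR_ge0, rl_ker_ge0, mulr_ge0).
have mF : measurable_fun setT F.
  apply/measurable_EFinP; apply: measurable_funM; last first.
    by apply: (measurableT_comp measurable_expRN); exact: measurable_fst.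
  apply: measurable_funM; apply: measurable_rl_ker_comp; last exact: measurable_snd.
  by apply: measurable_funB; [exact: measurable_fst|exact: measurable_snd].
have := @fubini_tonelli _ _ _ _ _ mu mu F mF F0; rewrite /F /=.
under [in RHS]eq_integral => s _.
  rewrite (_ : (\int[mu]_x _)%E = (rl_ker b s * expR (- s))%:E); last first.
    under eq_integral do rewrite mulrAC mulrC EFinM.
    rewrite ge0_integralZl//.
    - by rewrite integral_rl_ker_exp_shift// -EFinM.
    - apply/measurable_EFinP; apply: measurable_funM; last exact: measurable_expRN.
      by apply: measurable_rl_ker_comp; exact: measurable_funB.
    - by move=> x _; rewrite lee_fin mulr_ge0 ?rl_ker_ge0 ?expR_ge0.
    - by rewrite lee_fin rl_ker_ge0.
  over.
rewrite integral_rl_ker_exp// => <-.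
rewrite /Gammae -ge0_integralZl//; last 2 first.
- by apply/measurable_EFinP; exact: measurable_gamma_fun.
- by move=> u _; rewrite lee_fin gamma_fun_ge0.
apply: eq_integral => u _.
have [u0|u0] := leP u 0.
  rewrite /gamma_fun /power_ker ltNge u0 mul0r mule0 integral0_eq// => s _.
  have [s0|s0] := leP s 0; first by rewrite [rl_ker b s]rl_ker_le0// mulr0 mul0r.
  by rewrite rl_ker_le0 ?mul0r//; lra.
rewrite /gamma_fun /power_ker u0.
under eq_integral do rewrite mulrC EFinM.
rewrite ge0_integralZl//.
- by rewrite ge0_rl_ker_convE// EFinM muleA (muleC C) muleC.
- apply/measurable_EFinP; apply: measurable_funM; last exact: measurable_rl_ker.
  by apply: measurable_rl_ker_comp; exact: measurable_funB.
Qed.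

(** Tonelli brings the two kernels together, and a translation by [r] turns their integral into the
    convolution just computed. *)
Lemma ge0_rl_ker_semigroup (a b : R) (g : R -> R) (t : R) : 0 < a -> 0 < b ->
  measurable_fun setT g -> (forall x, 0 <= g x) ->
  (\int[mu]_s ((rl_ker a (t - s))%:E * \int[mu]_r (rl_ker b (s - r) * g r)%:E) =
   \int[mu]_r (rl_ker (a + b) (t - r) * g r)%:E)%E.
Proof.
move=> a0 b0 mg g0.
pose F (z : R * R) := (rl_ker a (t - z.1) * (rl_ker b (z.1 - z.2) * g z.2))%:E : \bar R.
have F0 z : (0 <= F z)%E by rewrite /F lee_fin !(rl_ker_ge0, mulr_ge0).
have mF : measurable_fun setT F.
  apply/measurable_EFinP; apply: measurable_funM.
    by apply: measurable_rl_ker_comp; exact: measurable_funB.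
  apply: measurable_funM; last by apply: (measurableT_comp mg); exact: measurable_snd.
  apply: measurable_rl_ker_comp; apply: measurable_funB.
    exact: measurable_fst.
  exact: measurable_snd.
have mk (s : R) : measurable_fun setT (fun r : R => (rl_ker b (s - r) * g r)%:E : \bar R).
  apply/measurable_EFinP; apply: measurable_funM => //.
  by apply: measurable_rl_ker_comp; exact: measurable_funB.
transitivity (\int[mu]_x \int[mu]_y F (x, y))%E.
  apply: eq_integral => s _; rewrite -ge0_integralZl//.
  - exact: mk.
  - by move=> r _; rewrite lee_fin mulr_ge0 ?rl_ker_ge0.
  - by rewrite lee_fin rl_ker_ge0.
rewrite fubini_tonelli//; apply: eq_integral => r _; rewrite /F/=.
rewrite -(@ge0_integral_shift _ r); last 2 first.
- apply/measurable_EFinP; apply: measurable_funM.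
    by apply: measurable_rl_ker_comp; exact: measurable_funB.
  by apply: measurable_funM => //; apply: measurable_rl_ker_comp; exact: measurable_funB.
- by move=> x; rewrite lee_fin !(rl_ker_ge0, mulr_ge0).
rewrite mulrC EFinM -ge0_rl_ker_conv// -ge0_integralZl//.
- apply: eq_integral => s _; rewrite -EFinM addrK.
  by rewrite (_ : t - (s + r) = t - r - s); [congr EFin; ring|ring].
- apply/measurable_EFinP; apply: measurable_funM; last exact: measurable_rl_ker.
  by apply: measurable_rl_ker_comp; exact: measurable_funB.
- by move=> x _; rewrite lee_fin !(rl_ker_ge0, mulr_ge0).
- by rewrite lee_fin.
Qed.

End GammaKernel.

(** * Riemann-Liouville integrals of functions with a power singularity at 0 *)

Section SingularFunctions.
Context {R : realType} (U : R).
Local Notation mu := (@lebesgue_measure R).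
Implicit Types (f g h : R -> R) (a b c d t s : R).

(** Nothing is said at 0, at [U] or outside. A positive [c] allows a blow-up at 0, integrable if c <
    1; a negative [c] records a rate of vanishing at 0. *)
Definition sing (c : R) g :=
  (forall x, 0 < x < U -> {for x, continuous g}) /\
  exists2 N, 0 <= N & forall s, 0 < s < U -> `|g s| <= N * s `^ (- c).

Definition trunc g s : R := if 0 < s < U then g s else 0.

Lemma truncE g s : 0 < s < U -> trunc g s = g s.
Proof. by rewrite /trunc => ->. Qed.

Lemma trunc_le0 g s : s <= 0 -> trunc g s = 0.
Proof. by rewrite /trunc ltNge => ->. Qed.

Lemma measurable_trunc c g : sing c g -> measurable_fun setT (trunc g).
Proof.
move=> [cg _]; rewrite (_ : trunc g = g \_ `]0, U[%classic).
  apply/(measurable_restrict g) => //; rewrite setTI.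
  apply: open_continuous_measurable_fun => //.
  by move=> x; rewrite inE/= in_itv/= => /cg.
by apply/funext => s; rewrite patchE /trunc mem_setE in_itv/=.
Qed.

Lemma measurable_sing c g : sing c g -> measurable_fun `]0, U[ g.
Proof.
move=> [cg _].
apply: open_continuous_measurable_fun => //.
by move=> x; rewrite inE/= in_itv/= => /cg.
Qed.

Lemma measurable_convol c d g t : sing c g ->
  measurable_fun setT (fun s : R => rl_ker d (t - s) * trunc g s).
Proof.
move=> sg; apply: measurable_funM; last exact: measurable_trunc sg.
by apply: measurable_rl_ker_comp; exact: measurable_funB.
Qed.

Lemma rl_ker_integrable (a b t : R) : 0 < a -> 0 < b ->
  mu.-integrable setT (fun s => (rl_ker a (t - s) * rl_ker b s)%:E).
Proof.
move=> a0 b0; apply/integrableP; split.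
  apply/measurable_EFinP; apply: measurable_funM; last exact: measurable_rl_ker.
  by apply: measurable_rl_ker_comp; exact: measurable_funB.
under eq_integral => s _.
  rewrite abse_EFin ger0_norm; last by rewrite !(rl_ker_ge0, mulr_ge0).
  over.
by rewrite ge0_rl_ker_conv// ltry.
Qed.

(** The dominating function is written as a multiple of a kernel, so that integrability against
    [rl_ker d] follows from the convolution of kernels. *)
Lemma trunc_le c N g s : c < 1 -> (forall s, 0 < s < U -> `|g s| <= N * s `^ (- c)) ->
  0 <= N -> `|trunc g s| <= N * Gamma (1 - c) * rl_ker (1 - c) s.
Proof.
move=> c1 gN N0; have G0 : 0 < Gamma (1 - c) by rewrite Gamma_gt0 ?subr_gt0.
rewrite /trunc; case: ifPn => [|_]; last first.
  by rewrite normr0 mulr_ge0 ?rl_ker_ge0 ?subr_gt0// mulr_ge0// ltW.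
move=> /[dup] /andP[s0 _] /gN h.
rewrite rl_kerE// mulrA mulfK ?gt_eqF//.
by rewrite (_ : 1 - c - 1 = - c)//; ring.
Qed.

Lemma convol_integrable d c g t : 0 < d -> c < 1 -> sing c g ->
  mu.-integrable setT (fun s => (rl_ker d (t - s) * trunc g s)%:E).
Proof.
move=> d0 c1 sg; have [_ [N N0 gN]] := sg.
apply: (@le_integrable _ _ _ mu _ measurableT _
  (fun s : R => (N * Gamma (1 - c))%:E * (rl_ker d (t - s) * rl_ker (1 - c) s)%:E)%E).
- by apply/measurable_EFinP; exact: measurable_convol sg.
- move=> s _; rewrite -EFinM !abse_EFin lee_fin [leLHS]normrM ger0_norm ?rl_ker_ge0//.
  have c0 : 0 < 1 - c by rewrite subr_gt0.
  have G0 := Gamma_gt0 c0.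
  rewrite [leRHS]ger0_norm; last first.
    apply: mulr_ge0; first by rewrite mulr_ge0// ltW.
    by apply: mulr_ge0; exact: rl_ker_ge0.
  rewrite (mulrCA (N * _)) ler_wpM2l ?rl_ker_ge0//.
  exact: trunc_le.
- by apply: integrableZl => //; apply: rl_ker_integrable => //; rewrite subr_gt0.
Qed.

Lemma RL_int_convol d c g t : 0 < d -> c < 1 -> 0 <= t < U -> sing c g ->
  RL_int d g t = \int[mu]_s (rl_ker d (t - s) * trunc g s).
Proof.
move=> d0 c1 /andP[t0 tU] sg.
rewrite /RL_int gt_eqF//.
have mF (D : set R) : measurable D -> D `<=` `]0, U[%classic ->
    measurable_fun D (fun s => ((t - s) `^ (d - 1) * g s)%:E : \bar R).
  move=> mD DU; apply/measurable_EFinP; apply: measurable_funM; last first.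
    by apply: (measurable_funS _ DU) => //; exact: measurable_sing sg.
  apply: measurable_funTS.
  apply: (@measurableT_comp _ _ _ _ _ _ (fun x : R => x `^ (d - 1)) _ (fun s : R => t - s)).
    exact: measurable_powR.
  exact: measurable_funB.
(* The endpoints are dropped because [g 0] is uncontrolled, and because at s = t the power need not
   equal the value 0 of the kernel: it is 1 if d = 1. *)
have -> : \int[mu]_(s in `[0, t]) ((t - s) `^ (d - 1) * g s) =
    \int[mu]_(s in `]0, t[) ((t - s) `^ (d - 1) * g s).
  rewrite /Rintegral -integral_itv_obnd_cbnd ?integral_itv_bndo_bndc//.
    apply: mF => // x /=; rewrite !in_itv/= => /andP[-> h].
    by rewrite (lt_trans h).
  apply: mF => // x /=; rewrite !in_itv/= => /andP[-> h].
  by rewrite (le_lt_trans h).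
have ik : mu.-integrable `]0, t[ (fun s => ((t - s) `^ (d - 1) * g s)%:E).
  apply: (@eq_integrable _ _ _ mu `]0, t[%classic (measurable_itv _)
    (fun s => (Gamma d)%:E * (rl_ker d (t - s) * trunc g s)%:E)%E).
    move=> s; rewrite inE/= in_itv/= => /andP[s0 st].
    rewrite truncE ?s0 ?(lt_trans st)// rl_kerE ?subr_gt0// -EFinM !mulrA.
    by rewrite mulfV ?mul1r// gt_eqF// Gamma_gt0.
  apply: integrableZl => //; apply: (@integrableS _ _ _ mu setT) => //.
  exact: convol_integrable sg.
rewrite -RintegralZl// Rintegral_mkcond; apply: eq_Rintegral => s _.
rewrite [in LHS]patchE; case: ifPn => [|h].
  rewrite inE/= in_itv/= => /andP[s0 st].
  rewrite truncE ?s0 ?(lt_trans st)//.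
  by rewrite rl_kerE ?subr_gt0// mulrA.
have [s0|s0] := leP s 0; first by rewrite trunc_le0// mulr0.
rewrite rl_ker_le0 ?mul0r// subr_le0 leNgt; apply: contraNN h => st.
by rewrite mem_set//= in_itv/= s0.
Qed.

Lemma RL_int0E g t : RL_int 0 g t = g t.
Proof. by rewrite /RL_int eqxx. Qed.

Lemma eq_RL_int d f g t : 0 <= t -> (forall s, 0 <= s <= t -> f s = g s) ->
  RL_int d f t = RL_int d g t.
Proof.
move=> t0 fg; rewrite /RL_int; case: ifP => _.
  by rewrite fg// t0 lexx.
congr (_ * _); apply: eq_Rintegral => s; rewrite inE/= in_itv/= => st.
by rewrite fg.
Qed.

Lemma RL_int_zero d t : RL_int d (fun=> 0) t = 0.
Proof.
rewrite /RL_int /Rintegral; case: ifP => // _.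
by rewrite integral0_eq ?mulr0// => s _; rewrite mulr0.
Qed.

Lemma RL_int_at0 d g : 0 < d -> RL_int d g 0 = 0.
Proof. by move=> d0; rewrite /RL_int gt_eqF// set_itv1 Rintegral_set1 mulr0. Qed.

Lemma le_RL_int d c c' g h t : 0 < d -> c < 1 -> c' < 1 -> 0 <= t < U ->
  sing c g -> sing c' h -> (forall s, 0 < s < t -> g s <= h s) ->
  RL_int d g t <= RL_int d h t.
Proof.
move=> d0 c1 c'1 tU sg sh gh.
rewrite (RL_int_convol d0 c1 tU sg) (RL_int_convol d0 c'1 tU sh).
apply: le_Rintegral => //; [exact: convol_integrable sg|exact: convol_integrable sh|].
move=> s _; have [st|st] := leP t s.
  by rewrite rl_ker_le0 ?mul0r// subr_le0.
rewrite ler_wpM2l ?rl_ker_ge0// /trunc; case: ifPn => // /andP[s0 _].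
by apply: gh; rewrite s0.
Qed.

(** In contrast to [eq_RL_int], equality is asked on the open interval only, at the price of d > 0:
    the values at the endpoints may be arbitrary. *)
Lemma eq_RL_int_sing d c c' g h t : 0 < d -> c < 1 -> c' < 1 -> 0 <= t < U ->
  sing c g -> sing c' h -> (forall s, 0 < s < t -> g s = h s) ->
  RL_int d g t = RL_int d h t.
Proof.
move=> d0 c1 c'1 tU sg sh gh; apply/eqP; rewrite eq_le.
by rewrite (le_RL_int d0 c1 c'1 tU sg sh) ?(le_RL_int d0 c'1 c1 tU sh sg)//
   => s /gh ->.
Qed.

Lemma sing0 c : sing c (fun=> 0).
Proof.
split; first by move=> x _; exact: cvg_cst.
by exists 0 => // s _; rewrite normr0 mul0r.
Qed.

Lemma singD c g h : sing c g -> sing c h -> sing c (fun s => g s + h s).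
Proof.
move=> [cg [N N0 gN]] [ch [M M0 hM]]; split.
  by move=> x xU; apply: cvgD; [exact: cg|exact: ch].
exists (N + M); first by rewrite addr_ge0.
by move=> s sU; rewrite (le_trans (ler_normD _ _))// mulrDl lerD ?gN ?hM.
Qed.

Lemma singZ c k g : sing c g -> sing c (fun s => k * g s).
Proof.
move=> [cg [N N0 gN]]; split.
  by move=> x xU; apply: cvgM; [exact: cvg_cst|exact: cg].
exists (`|k| * N); first by rewrite mulr_ge0.
by move=> s sU; rewrite normrM -mulrA ler_wpM2l// gN.
Qed.

Lemma singN c g : sing c g -> sing c (fun s => - g s).
Proof.
move=> sg; rewrite (_ : (fun s => _) = (fun s => -1 * g s)); first exact: singZ.
by apply/funext => s; rewrite mulN1r.
Qed.

Lemma singB c g h : sing c g -> sing c h -> sing c (fun s => g s - h s).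
Proof. by move=> sg /singN; exact: singD. Qed.

Lemma sing_norm c g : sing c g -> sing c (fun s => `|g s|).
Proof.
move=> [cg [N N0 gN]]; split.
  by move=> x xU; apply: cvg_norm; exact: cg.
by exists N => // s sU; rewrite normr_id gN.
Qed.

Lemma sing_sum c (I : Type) (r : seq I) (P : pred I) (F : I -> R -> R) :
  (forall i, P i -> sing c (F i)) -> sing c (fun s => \sum_(i <- r | P i) F i s).
Proof.
move=> sF; elim: r => [|i r IH].
  by under eq_fun do rewrite big_nil; exact: sing0.
case: (boolP (P i)) => Pi; last first.
  by under eq_fun do rewrite big_cons (negbTE Pi).
under eq_fun do rewrite big_cons Pi.
by apply: singD => //; exact: sF.
Qed.

Lemma singM c c' g h : sing c g -> sing c' h -> sing (c + c') (fun s => g s * h s).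
Proof.
move=> [cg [N N0 gN]] [ch [M M0 hM]]; split.
  by move=> x xU; apply: cvgM; [exact: cg|exact: ch].
exists (N * M); first by rewrite mulr_ge0.
move=> s /[dup] sU /andP[s0 _]; rewrite normrM opprD powR_gt0D// mulrACA.
by rewrite ler_pM// ?gN ?hM.
Qed.

Lemma continuous_powR_gt0 e (x : R) : 0 < x -> {for x, continuous (@powR R ^~ e)}.
Proof.
by move=> x0; apply/differentiable_continuous/derivable1_diffP/derivable_powR;
   rewrite in_itv/= x0.
Qed.

Lemma sing_pow c : sing c (fun s => s `^ (- c)).
Proof.
split; first by move=> x /andP[x0 _]; exact: continuous_powR_gt0.
by exists 1 => // s _; rewrite mul1r ger0_norm ?powR_ge0.
Qed.

Lemma sing_cst k : sing 0 (fun=> k).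
Proof.
split; first by move=> x _; exact: cvg_cst.
by exists `|k| => // s _; rewrite oppr0 powRr0 mulr1.
Qed.

Lemma sing_le c c' g : c <= c' -> sing c g -> sing c' g.
Proof.
move=> cc [cg [N N0 gN]]; split=> //.
exists (N * U `^ (c' - c)); first by rewrite mulr_ge0// powR_ge0.
move=> s /[dup] sU /andP[s0 sU']; rewrite (le_trans (gN _ sU))// -mulrA.
rewrite ler_wpM2l// [X in s `^ X](_ : - c = (c' - c) + - c'); last by ring.
rewrite powR_gt0D// ler_wpM2r ?powR_ge0//.
by apply: ge0_ler_powR; rewrite ?nnegrE ?subr_ge0//; lra.
Qed.

Lemma RL_intD d c g h t : 0 <= d -> c < 1 -> 0 <= t < U ->
  sing c g -> sing c h ->
  RL_int d (fun s => g s + h s) t = RL_int d g t + RL_int d h t.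
Proof.
rewrite le_eqVlt => /predU1P[<-|d0] c1 tU sg sh; first by rewrite !RL_int0E.
rewrite (RL_int_convol d0 c1 tU sg) (RL_int_convol d0 c1 tU sh).
rewrite (RL_int_convol d0 c1 tU (singD sg sh)) -RintegralD//.
- apply: eq_Rintegral => s _; rewrite -mulrDr; congr (_ * _).
  by rewrite /trunc; case: ifP => // _; rewrite addr0.
- exact: convol_integrable sg.
- exact: convol_integrable sh.
Qed.

Lemma RL_intZ d c k g t : 0 <= d -> c < 1 -> 0 <= t < U -> sing c g ->
  RL_int d (fun s => k * g s) t = k * RL_int d g t.
Proof.
rewrite le_eqVlt => /predU1P[<-|d0] c1 tU sg; first by rewrite !RL_int0E.
rewrite (RL_int_convol d0 c1 tU sg).
rewrite (RL_int_convol d0 c1 tU (singZ k sg)) -RintegralZl//.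
- apply: eq_Rintegral => s _; rewrite mulrCA; congr (_ * _).
  by rewrite /trunc; case: ifP => // _; rewrite mulr0.
- exact: convol_integrable sg.
Qed.

Lemma RL_intN d c g t : 0 <= d -> c < 1 -> 0 <= t < U -> sing c g ->
  RL_int d (fun s => - g s) t = - RL_int d g t.
Proof.
move=> d0 c1 tU sg; rewrite -mulN1r -(RL_intZ _ d0 c1 tU sg); congr (RL_int d _ t).
by apply/funext => s; rewrite mulN1r.
Qed.

Lemma RL_intB d c g h t : 0 <= d -> c < 1 -> 0 <= t < U -> sing c g -> sing c h ->
  RL_int d (fun s => g s - h s) t = RL_int d g t - RL_int d h t.
Proof.
move=> d0 c1 tU sg sh.
by rewrite (RL_intD d0 c1 tU sg (singN sh)) (RL_intN d0 c1 tU sh).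
Qed.

Lemma RL_int_sum d c (I : Type) (r : seq I) (P : pred I) (F : I -> R -> R) t :
  0 <= d -> c < 1 -> 0 <= t < U -> (forall i, P i -> sing c (F i)) ->
  RL_int d (fun s => \sum_(i <- r | P i) F i s) t = \sum_(i <- r | P i) RL_int d (F i) t.
Proof.
move=> d0 c1 tU sF; elim: r => [|i r IH].
  rewrite big_nil; under eq_fun do rewrite big_nil.
  exact: RL_int_zero.
rewrite big_cons; under eq_fun do rewrite big_cons.
case: ifPn => // Pi; rewrite (RL_intD d0 c1 tU)// ?IH//; first exact: sF.
by apply: sing_sum => j; exact: sF.
Qed.

Lemma normr_RL_int_le d c c' g h t : 0 < d -> c < 1 -> c' < 1 -> 0 <= t < U ->
  sing c g -> sing c' h -> (forall s, 0 < s < t -> `|g s| <= h s) ->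
  `|RL_int d g t| <= RL_int d h t.
Proof.
move=> d0 c1 c'1 tU sg sh gh; rewrite ler_norml; apply/andP; split.
  rewrite -(RL_intN (ltW d0) c'1 tU sh) (le_RL_int d0 c'1 c1 tU (singN sh) sg)//.
  by move=> s /gh; rewrite ler_norml => /andP[].
by apply: (le_RL_int d0 c1 c'1 tU sg sh) => s /gh; rewrite ler_norml => /andP[].
Qed.

(** On ]0, t[ the power s^(-c) is Gamma(1 - c) times the kernel of order 1 - c, so this is again the
    convolution of two kernels. *)
Lemma RL_int_pow d c t : 0 < d -> c < 1 -> 0 < t < U ->
  RL_int d (fun s => s `^ (- c)) t =
  Gamma (1 - c) / Gamma (d + (1 - c)) * t `^ (d - c).
Proof.
move=> d0 c1 /andP[t0 tU].
have c0 : 0 < 1 - c by rewrite subr_gt0.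
have G0 := Gamma_gt0 c0.
rewrite (RL_int_convol d0 c1 _ (sing_pow c)) ?(ltW t0)//.
transitivity (fine ((Gamma (1 - c))%:E * \int[mu]_s (rl_ker d (t - s) * rl_ker (1 - c) s)%:E)%E).
  rewrite -ge0_integralZl//.
  - congr fine; apply: eq_integral => s _; rewrite -EFinM mulrCA; congr EFin.
    have [s0|s0] := leP s 0; first by rewrite trunc_le0// [rl_ker (1 - c) s]rl_ker_le0// !mulr0.
    have [st|st] := leP t s; first by rewrite rl_ker_le0 ?mul0r// subr_le0.
    congr (_ * _); rewrite truncE ?s0 ?(lt_trans st)//.
    rewrite rl_kerE// mulrA mulfV ?gt_eqF// mul1r; congr (_ `^ _); ring.
  - apply/measurable_EFinP; apply: measurable_funM; last exact: measurable_rl_ker.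
    by apply: measurable_rl_ker_comp; exact: measurable_funB.
  - by move=> s _; rewrite lee_fin !(rl_ker_ge0, mulr_ge0).
  - by rewrite lee_fin ltW.
rewrite ge0_rl_ker_conv//= rl_kerE// mulrA; congr (_ * _ `^ _); ring.
Qed.

End SingularFunctions.

(* Unfolding these during unification is prohibitively slow. *)
#[local] Opaque RL_int Gamma.

(** * Continuity, semigroup law, differentiation and exponential bounds for [RL_int] *)

Section RLCalculus.
Context {R : realType} (U : R).
Local Notation mu := (@lebesgue_measure R).
Local Notation sing := (sing U).
Local Notation trunc := (trunc U).
Implicit Types (g h : R -> R) (a b c d t s k x : R).

(** Reduces linear statements to nonnegative functions, for which Tonelli and the dilation rule are
    available. *)
Lemma sing_posneg c g : sing c g -> exists gp gm, [/\ sing c gp, sing c gm,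
  forall s, 0 <= gp s, forall s, 0 <= gm s & g = fun s => gp s - gm s].
Proof.
move=> sg; exists (fun s => 2^-1 * (`|g s| + g s)), (fun s => 2^-1 * (`|g s| - g s)).
have sn := sing_norm sg; split.
- by apply: singZ; exact: singD.
- by apply: singZ; exact: singB.
- by move=> s; rewrite mulr_ge0// -lerBlDr sub0r lerNl; have := ler_norm (- g s); rewrite normrN; lra.
- by move=> s; rewrite mulr_ge0// subr_ge0 ler_norm.
- by apply/funext => s; lra.
Qed.

Lemma RL_int_bound d c g N t : 0 < d -> c < 1 -> sing c g -> 0 <= N ->
  0 < t < U -> (forall s, 0 < s < t -> `|g s| <= N * s `^ (- c)) ->
  `|RL_int d g t| <= N * (Gamma (1 - c) / Gamma (d + (1 - c))) * t `^ (d - c).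
Proof.
move=> d0 c1 sg N0 /[dup] tU /andP[t0 tU'] gN.
have tU2 : 0 <= t < U by rewrite ltW.
apply: (le_trans (normr_RL_int_le d0 c1 c1 tU2 sg (singZ N (sing_pow U c)) gN)).
by rewrite (RL_intZ _ (ltW d0) c1 tU2 (sing_pow U c)) (RL_int_pow d0 c1 tU) mulrA.
Qed.

Lemma trunc_continuous c g x : sing c g -> 0 < x < U -> {for x, continuous (trunc g)}.
Proof.
move=> [cg _] /[dup] xU /andP[x0 xU'].
have H : {near x, g =1 trunc g}.
  near=> z; rewrite truncE//; apply/andP; split.
    by near: z; exact: lt_nbhsr.
  by near: z; exact: lt_nbhsl.
rewrite /prop_for /continuous_at truncE//.
by apply: cvg_trans (near_eq_cvg H) _; exact: cg.
Unshelve. all: by end_near. Qed.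

Lemma le_powR_neg (u v c : R) : 0 <= c -> 0 < u -> u <= v -> v `^ (- c) <= u `^ (- c).
Proof.
move=> c0 u0 uv; have v0 : 0 < v by lra.
rewrite !powRN lef_pV2 ?posrE ?powR_gt0//.
by apply: ge0_ler_powR; rewrite ?nnegrE; lra.
Qed.

(** The bound is uniform in t >= u; it is the domination that [RL_int_continuous_ge0] needs under
    the integral sign. *)
Lemma scaled_le c g N t u w : 0 <= c < 1 -> 0 <= N ->
  (forall s, 0 < s < U -> `|g s| <= N * s `^ (- c)) -> 0 < u -> u <= t ->
  `|trunc g (t * w)| <= N * Gamma (1 - c) * u `^ (- c) * rl_ker (1 - c) w.
Proof.
move=> /andP[c0 c1] N0 gN u0 ut; have t0 : 0 < t by lra.
have c2 : 0 < 1 - c by rewrite subr_gt0.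
apply: (le_trans (trunc_le (t * w) c1 gN N0)).
rewrite rl_ker_scale// mulrA ler_wpM2r ?rl_ker_ge0// ler_wpM2l//.
  by rewrite mulr_ge0// ltW// Gamma_gt0.
by rewrite (_ : 1 - c - 1 = - c); [exact: le_powR_neg|ring].
Qed.

Lemma scaled_integrable d c g t : 0 < d -> 0 <= c < 1 -> sing c g -> 0 < t ->
  mu.-integrable setT (fun w => (rl_ker d (1 - w) * trunc g (t * w))%:E).
Proof.
move=> d0 c01 sg t0; have [_ [N N0 gN]] := sg; have /andP[c0 c1] := c01.
have c2 : 0 < 1 - c by rewrite subr_gt0.
apply: (@le_integrable _ _ _ mu _ measurableT _
  (fun w : R => (N * Gamma (1 - c) * t `^ (- c))%:E * (rl_ker d (1 - w) * rl_ker (1 - c) w)%:E)%E).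
- apply/measurable_EFinP; apply: measurable_funM.
    by apply: measurable_rl_ker_comp; exact: measurable_funB.
  by apply: (measurableT_comp (measurable_trunc sg)); exact: measurable_funM.
- move=> w _; rewrite -EFinM !abse_EFin lee_fin [leLHS]normrM ger0_norm ?rl_ker_ge0//.
  rewrite [leRHS]ger0_norm; last first.
    apply: mulr_ge0; last by apply: mulr_ge0; exact: rl_ker_ge0.
    by rewrite mulr_ge0 ?powR_ge0// mulr_ge0// ltW// Gamma_gt0.
  rewrite mulrCA ler_wpM2l ?rl_ker_ge0//.
  exact: (scaled_le _ c01 N0 gN).
- by apply: integrableZl => //; apply: rl_ker_integrable.
Qed.

(** After the substitution s = t w the singular kernel no longer depends on t, which is what makes
    continuity in t accessible to dominated convergence. *)
Lemma RL_int_scale d c g t : 0 < d -> 0 <= c < 1 -> sing c g -> (forall s, 0 <= g s) ->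
  0 < t < U ->
  RL_int d g t = t `^ d * \int[mu]_w (rl_ker d (1 - w) * trunc g (t * w)).
Proof.
move=> d0 c01 sg g0 /andP[t0 tU]; have /andP[c0 c1] := c01.
have tg0 s : 0 <= trunc g s by rewrite /trunc; case: ifP.
rewrite (@RL_int_convol _ U _ _ _ _ d0 c1 _ sg) ?(ltW t0)//.
pose F (s : R) : \bar R := (rl_ker d (t - s) * trunc g s)%:E.
have mF : measurable_fun setT F.
  by apply/measurable_EFinP; exact: measurable_convol sg.
have F0 s : (0 <= F s)%E by rewrite lee_fin mulr_ge0 ?rl_ker_ge0.
have iH := scaled_integrable d0 c01 sg t0.
have := ge0_integral_scale t0 mF F0.
under eq_integral => w _.
  rewrite /F -{1}(mulr1 t) -mulrBr rl_ker_scale// -mulrA EFinM.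
  over.
rewrite (@integralZl _ _ _ mu _ measurableT _ iH (t `^ (d - 1))) => H.
have {}H : (\int[mu]_x F x = (t * t `^ (d - 1))%:E * \int[mu]_w (rl_ker d (1 - w) * trunc g (t * w))%:E)%E.
  by rewrite EFinM -muleA H muleA -EFinM mulfV ?gt_eqF// mul1e.
rewrite /Rintegral -/(F _) H fineM//=; last exact: integrable_fin_num.
by rewrite mulr_powRB1// ltW.
Qed.

Lemma RL_int_continuous_ge0 d c g x : 0 < d -> 0 <= c < 1 -> sing c g ->
  (forall s, 0 <= g s) -> 0 < x < U -> {for x, continuous (RL_int d g)}.
Proof.
move=> d0 c01 sg g0 /[dup] xU /andP[x0 xU']; have [cg [N N0 gN]] := sg.
have /andP[c0 c1] := c01; have c2 : 0 < 1 - c by rewrite subr_gt0.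
have H : {near x, (fun t => t `^ d * \int[mu]_w (rl_ker d (1 - w) * trunc g (t * w))) =1 RL_int d g}.
  near=> z; rewrite (RL_int_scale d0 c01 sg g0)//; apply/andP; split.
    by near: z; exact: lt_nbhsr.
  by near: z; exact: lt_nbhsl.
rewrite /prop_for /continuous_at (RL_int_scale d0 c01 sg g0)//.
apply: cvg_trans (near_eq_cvg H) _.
apply: cvgM; first exact: continuous_powR_gt0.
(* The parameter is confined to ]x/2, U[, where t^(-c) is at most (x/2)^(-c). *)
have xI : x \in `]x / 2, U[%classic by rewrite inE/= in_itv/=; apply/andP; split; lra.
apply: (@continuity_under_integral _ _ _ mu
  (fun t w => rl_ker d (1 - w) * trunc g (t * w)) setT measurableT (x / 2) U
  _ _ (fun w => N * Gamma (1 - c) * (x / 2) `^ (- c) * (rl_ker d (1 - w) * rl_ker (1 - c) w))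
  _ _ x xI).
- move=> t; rewrite /= in_itv/= => /andP[tx _].
  by apply: (scaled_integrable d0 c01 sg); lra.
- apply: aeW => w _ t; rewrite inE/= in_itv/= => /andP[tx tU].
  have t0 : 0 < t by lra.
  (* For w <= 0 and for w >= 1 the integrand is 0 for all parameters near t; in between, t w stays
     in ]0, U[, where [g] is continuous. *)
  have [w0|w0] := leP w 0.
    have tw0 : t * w <= 0 by rewrite pmulr_rle0.
    rewrite /continuous_at (trunc_le0 U g tw0) mulr0.
    apply: cvg_near_cst; near=> z; rewrite trunc_le0 ?mulr0// pmulr_rle0//.
    by near: z; exact: lt_nbhsr.
  have [w1|w1] := leP 1 w.
    rewrite /continuous_at rl_ker_le0 ?mul0r ?subr_le0//; apply: cvg_near_cst.
    by apply: nearW => z; rewrite mul0r.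
  apply: cvgM; first exact: cvg_cst.
  have twU : 0 < t * w < U.
    by rewrite mulr_gt0//= (lt_trans _ tU)// gtr_pMr.
  have ct := @trunc_continuous c g (t * w) sg twU.
  apply: (@continuous_comp _ _ _ (fun z : R => z * w) (trunc g)); last exact: ct.
  by apply: cvgM; [exact: cvg_id|exact: cvg_cst].
- have := integrableZl measurableT (N * Gamma (1 - c) * (x / 2) `^ (- c))
    (rl_ker_integrable 1 d0 c2).
  by apply: eq_integrable => // w _; rewrite -EFinM.
- move=> t; rewrite /= in_itv/= => /andP[tx tU]; apply: aeW => w _.
  rewrite [leLHS]normrM ger0_norm ?rl_ker_ge0// mulrCA ler_wpM2l ?rl_ker_ge0//.
  by apply: (scaled_le _ c01 N0 gN); lra.
Unshelve. all: by end_near. Qed.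

Lemma RL_int_continuous d c g x : 0 <= d -> c < 1 -> sing c g ->
  0 < x < U -> {for x, continuous (RL_int d g)}.
Proof.
rewrite le_eqVlt => /predU1P[<- c1 [cg _] /cg|d0 c1 sg /[dup] xU /andP[x0 xU']].
  by rewrite (_ : RL_int 0 g = g)//; apply/funext => s; rewrite RL_int0E.
(* The domination requires a nonnegative exponent, since it uses that s^(-c) does not increase with
   s. *)
pose c' := Num.max c 0.
have c'01 : 0 <= c' < 1 by rewrite /c' le_max lexx orbT/= gt_max c1/=.
have {c1}c'1 : c' < 1 by case/andP : c'01.
have {sg} : sing c' g by apply: sing_le sg; rewrite le_max lexx.
move=> /sing_posneg[gp [gm [sp sm p0 m0 ->]]].
have H : {near x, (fun t => RL_int d gp t - RL_int d gm t) =1 RL_int d (fun s => gp s - gm s)}.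
  near=> z; have zU : 0 <= z < U.
    apply/andP; split; first by apply/ltW; near: z; exact: lt_nbhsr.
    by near: z; exact: lt_nbhsl.
  by rewrite (RL_intB (ltW d0) c'1 zU sp sm).
have xU2 : 0 <= x < U by rewrite ltW.
rewrite /prop_for /continuous_at (RL_intB (ltW d0) c'1 xU2 sp sm).
apply: cvg_trans (near_eq_cvg H) _.
by apply: cvgB; [exact: RL_int_continuous_ge0 sp p0 xU|exact: RL_int_continuous_ge0 sm m0 xU].
Unshelve. all: by end_near. Qed.

Lemma sing_RL d c g : 0 <= d -> c < 1 -> sing c g -> sing (c - d) (RL_int d g).
Proof.
rewrite le_eqVlt => /predU1P[<- c1 sg|d0 c1 sg].
  by rewrite subr0 (_ : RL_int 0 g = g)//; apply/funext => s; rewrite RL_int0E.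
split; first by move=> x xU; exact: RL_int_continuous (ltW d0) c1 sg xU.
have [_ [N N0 gN]] := sg.
have c2 : 0 < 1 - c by rewrite subr_gt0.
exists (N * (Gamma (1 - c) / Gamma (d + (1 - c)))).
  by rewrite mulr_ge0// divr_ge0// ltW// Gamma_gt0// addr_gt0.
move=> s sU; rewrite opprB; apply: (RL_int_bound d0 c1 sg N0 sU) => r /andP[r0 rs].
by apply: gN; rewrite r0 (lt_trans rs)//; case/andP: sU.
Qed.

Lemma sing_cvg0 c g : c < 0 -> 0 < U -> sing c g -> g x @[x --> 0^'+] --> 0.
Proof.
move=> c0 U0 [_ [N N0 gN]].
apply: norm_cvg0.
have H : N * (fun s => s `^ (- c)) x @[x --> 0^'+] --> N * 0.
  by apply: cvgM; [exact: cvg_cst|apply: powR_cvg0; rewrite oppr_gt0].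
rewrite mulr0 in H.
apply: squeeze_cvgr _ (cvg_cst 0) H.
near=> z; rewrite normr_ge0/= gN//; apply/andP; split; near: z.
  exact: nbhs_right_gt.
exact: nbhs_right_lt.
Unshelve. all: by end_near. Qed.

Lemma RL_int_semigroup_ge0 a b c g t : 0 < a -> 0 < b -> c < 1 -> sing c g ->
  (forall s, 0 <= g s) -> 0 <= t < U ->
  RL_int a (RL_int b g) t = RL_int (a + b) g t.
Proof.
move=> a0 b0 c1 sg g0 /[dup] tU /andP[t0 tU'].
have ab0 : 0 < a + b by rewrite addr_gt0.
have sb := sing_RL (ltW b0) c1 sg.
have cb1 : c - b < 1 by lra.
rewrite (RL_int_convol a0 cb1 tU sb) (RL_int_convol ab0 c1 tU sg).
have tg0 s : 0 <= trunc g s by rewrite /trunc; case: ifP.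
rewrite /Rintegral -(ge0_rl_ker_semigroup t a0 b0 (measurable_trunc sg) tg0).
congr fine; apply: eq_integral => s _; clear ab0 sb cb1.
have [st|st] := leP t s.
  by rewrite rl_ker_le0 ?subr_le0// mul0r mul0e.
rewrite EFinM; congr (_ * _)%E.
have [s0|s0] := leP s 0.
  rewrite trunc_le0// integral0_eq// => r _.
  have [r0|r0] := leP r 0; first by rewrite trunc_le0 ?mulr0.
  by rewrite rl_ker_le0 ?mul0r//; lra.
have sU : 0 < s < U by rewrite s0 (lt_trans st).
have sU2 : 0 <= s < U by case/andP: sU => /ltW ->.
rewrite truncE// (RL_int_convol b0 c1 sU2 sg) /Rintegral fineK//.
apply: integrable_fin_num => //.
exact: convol_integrable sg.
Qed.

Lemma RL_int_semigroup a b c g t : 0 <= a -> 0 <= b -> c < 1 -> sing c g ->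
  0 <= t < U -> RL_int a (RL_int b g) t = RL_int (a + b) g t.
Proof.
rewrite le_eqVlt => /predU1P[<-|a0]; first by rewrite add0r RL_int0E.
rewrite le_eqVlt => /predU1P[<-|b0] c1 sg tU.
  by rewrite addr0 (_ : RL_int 0 g = g)//; apply/funext => s; rewrite RL_int0E.
have [gp [gm [sp sm p0 m0 gE]]] := sing_posneg sg.
have ab0 : 0 < a + b by rewrite addr_gt0.
have cb1 : c - b < 1 by lra.
have bp := sing_RL (ltW b0) c1 sp; have bm := sing_RL (ltW b0) c1 sm.
rewrite gE (RL_intB (ltW ab0) c1 tU sp sm).
rewrite -(RL_int_semigroup_ge0 a0 b0 c1 sp p0 tU) -(RL_int_semigroup_ge0 a0 b0 c1 sm m0 tU).
rewrite -(RL_intB (ltW a0) cb1 tU bp bm).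
have bb := sing_RL (ltW b0) c1 (singB sp sm).
apply: (eq_RL_int_sing a0 cb1 cb1 tU bb (singB bp bm)) => s /andP[s0 st].
rewrite (RL_intB (ltW b0) c1 _ sp sm)//; case/andP: tU => _ tU.
by rewrite ltW//= (lt_trans st).
Qed.

Lemma trunc_integrable c g u : 0 < u < U -> c < 1 -> sing c g ->
  mu.-integrable `]-oo, u] (EFin \o trunc g).
Proof.
move=> /andP[u0 uU] c1 sg.
(* The point (u + U) / 2 lies beyond u, so the kernel of order 1 centred there equals 1 on ]-oo, u],
   and the integrability of convolutions applies. *)
apply: (@eq_integrable _ _ _ mu _ (measurable_itv _)
  (fun s : R => (rl_ker 1 ((u + U) / 2 - s) * trunc g s)%:E)).
  move=> s; rewrite inE/= in_itv/= => su.
  by rewrite rl_kerE; [rewrite Gamma1 invr1 subrr powRr0 !mul1r|lra].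
apply: (@integrableS _ _ _ mu setT) => //.
exact: convol_integrable sg.
Qed.

Lemma RL_int1_trunc c g t : 0 <= t < U -> c < 1 -> sing c g ->
  RL_int 1 g t = \int[mu]_(s in `]-oo, t]) trunc g s.
Proof.
move=> /[dup] tU /andP[t0 tU'] c1 sg.
rewrite (RL_int_convol ltr01 c1 tU sg) -Rintegral_itv_bndo_bndc; last first.
  have [->|tN0] := eqVneq t 0.
    apply: (@eq_integrable _ _ _ mu _ (measurable_itv _) (cst 0%E)).
      by move=> s; rewrite inE/= in_itv/= => s0; rewrite trunc_le0// ltW.
    exact: integrable0.
  apply: (@integrableS _ _ _ mu `]-oo, t]) => //.
    by apply: subset_itvl; rewrite bnd_simp.
  by apply: trunc_integrable sg; rewrite ?tU' ?andbT// lt_neqAle eq_sym tN0.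
rewrite [RHS]Rintegral_mkcond; apply: eq_Rintegral => s _.
rewrite patchE mem_setE in_itv/=; case: ifPn => [st|].
  by rewrite rl_kerE ?subr_gt0// Gamma1 invr1 subrr powRr0 !mul1r.
by rewrite -leNgt => ts; rewrite rl_ker_le0 ?mul0r// subr_le0.
Qed.

Lemma is_derive_RL_int1 c g x : 0 < x < U -> c < 1 -> sing c g ->
  is_derive x 1 (RL_int 1 g) (g x).
Proof.
move=> /[dup] xU /andP[x0 xU'] c1 sg.
have xu : x < (x + U) / 2 by lra.
have uU : 0 < (x + U) / 2 < U by apply/andP; split; lra.
have [D1 D2] := @continuous_FTC1 _ (trunc g) (BInfty _ true) x ((x + U) / 2) xu
  (trunc_integrable uU c1 sg) (ltNyr _) (trunc_continuous sg xU).
rewrite (truncE g xU) in D2.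
apply: (@near_eq_is_derive _ _ _ (fun x => \int[mu]_(t in `]-oo, x]) trunc g t)).
  near=> z; rewrite (RL_int1_trunc _ c1 sg)//; apply/andP; split.
    by apply/ltW; near: z; exact: lt_nbhsr.
  by near: z; exact: lt_nbhsl.
by split; [exact: D1|rewrite -derive1E].
Unshelve. all: by end_near. Qed.

Lemma is_derive_RL_int d c g x : 0 <= d -> 0 < x < U -> c < 1 -> sing c g ->
  is_derive x 1 (RL_int (d + 1) g) (RL_int d g x).
Proof.
move=> d0 /[dup] xU /andP[x0 xU'] c1 sg.
have cd1 : c - d < 1 by lra.
apply: (@near_eq_is_derive _ _ _ (RL_int 1 (RL_int d g))).
  near=> z; rewrite (RL_int_semigroup _ d0 c1 sg) 1?addrC//; apply/andP; split.
    by apply/ltW; near: z; exact: lt_nbhsr.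
  by near: z; exact: lt_nbhsl.
exact: is_derive_RL_int1 xU cd1 (sing_RL d0 c1 sg).
Unshelve. all: by end_near. Qed.

Lemma RL_int_cst1 d t : 0 <= d -> 0 <= t < U -> RL_int d (fun=> 1) t = Phi (d + 1) t.
Proof.
move=> d0 /[dup] tU /andP[t0 tU']; rewrite /Phi addrK.
move: d0; rewrite le_eqVlt => /predU1P[<-|d0].
  by rewrite RL_int0E powRr0 add0r Gamma1 divr1.
move: t0; rewrite le_eqVlt => /predU1P[<-|t0].
  by rewrite RL_int_at0// powR0 ?mul0r// gt_eqF.
rewrite (_ : (fun=> 1) = (fun s : R => s `^ (- 0))); last first.
  by apply/funext => s; rewrite oppr0 powRr0.
rewrite (RL_int_pow (U := U)) ?ltr01 ?t0//.
by rewrite !subr0 Gamma1 mul1r mulrC.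
Qed.

Lemma expRN_le_powR (u k : R) : 0 < u -> 0 <= k <= 1 -> expR (- u) <= u `^ (- k).
Proof.
move=> u0 /andP[k0 k1]; rewrite expRN powRN lef_pV2 ?posrE ?expR_gt0 ?powR_gt0//.
have [u1|u1] := leP u 1.
  apply: (@le_trans _ _ 1); last by rewrite -expR0 ler_expR ltW.
  have : u `^ k <= 1 `^ k by apply: ge0_ler_powR => //; rewrite nnegrE// ltW.
  by rewrite powR1.
apply: (@le_trans _ _ u); first by rewrite ler1_powR// ltW.
by have := expR_ge1Dx u; lra.
Qed.

(** Since e^(l s) = e^(l t) e^(-l (t - s)) and e^(-v) <= v^(-k), the kernel of order d may be
    exchanged for the one of order d - k, and a factor l^(-k) appears. This factor is what makes the
    operators contract for large l. *)
Lemma RL_int_exp_bound d c g N l k t : 0 < k < d -> k <= 1 -> c < 1 -> 0 < l ->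
  sing c g -> 0 <= N -> 0 < t < U ->
  (forall s, 0 < s < t -> `|g s| <= N * (s `^ (- c) * expR (l * s))) ->
  `|RL_int d g t| <= N * l `^ (- k) *
     (Gamma (d - k) / Gamma d * (Gamma (1 - c) / Gamma (d - k + (1 - c)))) *
     (t `^ (d - k - c) * expR (l * t)).
Proof.
move=> /andP[k0 kd] k1 c1 l0 sg N0 /[dup] tU /andP[t0 tU'] gN.
have tU2 : 0 <= t < U by rewrite ltW.
have d0 : 0 < d by lra.
have dk0 : 0 < d - k by lra.
have sp := sing_pow U c.
have Gd := Gamma_gt0 d0; have Gdk := Gamma_gt0 dk0.
(* The quotient of Gamma values exchanges the normalisation of the kernel of order d for that of the
   kernel of order d - k. *)
set K := N * l `^ (- k) * (Gamma (d - k) / Gamma d) * expR (l * t).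
have K0 : 0 <= K.
  have GG : 0 <= Gamma (d - k) / Gamma d by apply: divr_ge0; exact: ltW.
  exact: mulr_ge0 (mulr_ge0 (mulr_ge0 N0 (powR_ge0 _ _)) GG) (expR_ge0 _).
suff : `|RL_int d g t| <= K * RL_int (d - k) (fun s => s `^ (- c)) t.
  rewrite (RL_int_pow dk0 c1 tU) => /le_trans; apply.
  rewrite /K le_eqVlt; apply/orP; left; apply/eqP.
  set E := expR _; set P := t `^ _; set L := l `^ _; set D := _ / _.
  by set D' := _ / _; clear; ring.
rewrite (RL_int_convol d0 c1 tU2 sg) (RL_int_convol dk0 c1 tU2 sp).
rewrite -RintegralZl//; last exact: convol_integrable sp.
have ig := convol_integrable t d0 c1 sg.
apply: (le_trans (le_normr_Rintegral measurableT ig)).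
apply: le_Rintegral => //.
- have := integrable_abse ig; apply: eq_integrable => // s _ /=.
- have := integrableZl measurableT K (convol_integrable t dk0 c1 sp).
  by apply: eq_integrable => // s _; rewrite EFinM.
move=> s _; have [st|st] := leP t s.
  by rewrite !rl_ker_le0 ?subr_le0// !mul0r normr0 mulr0.
have [s0|s0] := leP s 0; first by rewrite !trunc_le0// !mulr0 normr0.
have ts0 : 0 < t - s by rewrite subr_gt0.
rewrite !truncE ?s0 ?(lt_trans st)// normrM ger0_norm ?rl_ker_ge0//.
rewrite !rl_kerE//.
have gs := gN s; rewrite s0 st in gs; have {}gs := gs isT.
have e1 : expR (l * s) <= l `^ (- k) * (t - s) `^ (- k) * expR (l * t).
  rewrite -powRM; [|exact: ltW|exact: ltW].
  rewrite (_ : l * s = - (l * (t - s)) + l * t); last by ring.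
  by rewrite expRD ler_wpM2r ?expR_ge0// expRN_le_powR ?mulr_gt0// ltW.
have p1 : (t - s) `^ (d - k - 1) = (t - s) `^ (d - 1) * (t - s) `^ (- k).
  by rewrite -powR_gt0D//; congr (_ `^ _); ring.
rewrite p1 /K.
set A := (t - s) `^ (d - 1); set B := (t - s) `^ (- k); set L := l `^ (- k).
have A0 : 0 <= A by exact: powR_ge0.
apply: (@le_trans _ _ ((Gamma d)^-1 * A * (N * (s `^ (- c) * (L * B * expR (l * t)))))).
  rewrite ler_wpM2l//; first by rewrite mulr_ge0// invr_ge0 ltW.
  by rewrite (le_trans gs)// ler_wpM2l// ler_wpM2l ?powR_ge0.
rewrite le_eqVlt; apply/orP; left; apply/eqP.
set G := Gamma (d - k); set X := s `^ _; set E := expR _; set D := (Gamma d)^-1.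
have GV : G * G^-1 = 1 by rewrite mulfV// gt_eqF.
transitivity ((G * G^-1) * (D * A * (N * (X * (L * B * E))))); first by rewrite GV mul1r.
by clear; ring.
Qed.

End RLCalculus.

(** * Derivatives relative to an interval *)

Section RelativeDerivatives.
Context {R : realType}.
Implicit Types (D : set R) (f g : R -> R) (x l T : R).

(** A relation, in contrast to [deriv_on], whose total [lim] has a value even without convergence;
    the rules of calculus thus need no side conditions of derivability. *)
Definition has_deriv_on D f x l :=
  (f z - f x) / (z - x) @[z --> within D x^'] --> l.

Lemma has_deriv_onP D f x l : has_deriv_on D f x l <->
  (forall e, 0 < e -> exists2 d, 0 < d &
    forall z, D z -> z != x -> `|z - x| < d -> `|l - (f z - f x) / (z - x)| < e).
Proof.
split=> [/cvgrPdist_lt H e /H|H].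
  rewrite /within/= /dnbhs /within/= => -[d /= d0 hd]; exists d => // z Dz zx zd.
  by apply: hd => //=; rewrite distrC.
apply/cvgrPdist_lt => e /H[d d0 hd].
rewrite /within/= /dnbhs /within/=; exists d => //= z zd zx Dz.
by apply: hd => //; rewrite distrC.
Qed.

Lemma is_derive_has_deriv_on D f x l : is_derive x 1 f l -> has_deriv_on D f x l.
Proof.
move=> [df dl]; apply/has_deriv_onP => e e0.
move: df; rewrite /derivable => /cvg_ex[/= l' hl'].
have ll' : l' = l by rewrite -dl; apply/esym; exact: cvg_lim hl'.
move: hl'; rewrite ll' => /cvgrPdist_lt/(_ e e0).
rewrite /dnbhs /within/= => -[d /= d0 hd]; exists d => // z _ zx zd.
have := hd (z - x); rewrite /= sub0r normrN subr_eq0 => /(_ zd zx).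
by rewrite [(z - x) *: 1]mulr1 subrK /GRing.scale/= (mulrC (_^-1)).
Qed.

Lemma eq_has_deriv_on D f g x l : D x -> (forall z, D z -> f z = g z) ->
  has_deriv_on D f x l -> has_deriv_on D g x l.
Proof.
move=> Dx fg /has_deriv_onP H; apply/has_deriv_onP => e /H[d d0 hd].
by exists d => // z Dz zx zd; rewrite -!fg//; exact: hd.
Qed.

Lemma has_deriv_onS D D' f x l : D' `<=` D -> has_deriv_on D f x l -> has_deriv_on D' f x l.
Proof.
move=> DD /has_deriv_onP H; apply/has_deriv_onP => e /H[d d0 hd].
by exists d => // z Dz zx zd; apply: hd => //; exact: DD.
Qed.

Lemma has_deriv_on_cst D k x : has_deriv_on D (fun=> k) x 0.
Proof.
apply/has_deriv_onP => e e0; exists 1 => // z _ _ _.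
by rewrite subrr mul0r subr0 normr0.
Qed.

Lemma has_deriv_onD D f g x l l' : has_deriv_on D f x l -> has_deriv_on D g x l' ->
  has_deriv_on D (fun z => f z + g z) x (l + l').
Proof.
move=> hf hg; rewrite /has_deriv_on.
under eq_fun do rewrite opprD addrACA mulrDl.
exact: cvgD.
Qed.

Lemma has_deriv_onZ D k f x l : has_deriv_on D f x l ->
  has_deriv_on D (fun z => k * f z) x (k * l).
Proof.
move=> hf; rewrite /has_deriv_on.
under eq_fun do rewrite -mulrBr -mulrA.
by apply: cvgM => //; exact: cvg_cst.
Qed.

Lemma has_deriv_on_sum D (I : eqType) (r : seq I) (F : I -> R -> R) (L : I -> R) x :
  (forall i, i \in r -> has_deriv_on D (F i) x (L i)) ->
  has_deriv_on D (fun z => \sum_(i <- r) F i z) x (\sum_(i <- r) L i).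
Proof.
elim: r => [|i r IH] H.
  by under eq_fun do rewrite big_nil; rewrite big_nil; exact: has_deriv_on_cst.
under eq_fun do rewrite big_cons; rewrite big_cons; apply: has_deriv_onD.
  by apply: H; rewrite inE eqxx.
by apply: IH => j jr; apply: H; rewrite inE jr orbT.
Qed.

(** This makes the punctured neighbourhood filters within [D] proper, so that derivatives relative
    to [D] are unique. *)
Definition perfect_set D := forall x, D x -> forall e, 0 < e ->
  exists z, [/\ D z, z != x & `|z - x| < e].

Lemma perfect_itvcc T : 0 < T -> perfect_set `[0, T].
Proof.
move=> T0 x; rewrite /= in_itv/= => /andP[x0 xT] e e0.
have [xp|xn] := ltP 0 x.
  exists (x - Num.min (x / 2) (e / 2)).
  have m0 : 0 < Num.min (x / 2) (e / 2) by rewrite lt_min !divr_gt0.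
  have m1 : Num.min (x / 2) (e / 2) <= x / 2 by rewrite ge_min lexx.
  have m2 : Num.min (x / 2) (e / 2) <= e / 2 by rewrite ge_min lexx orbT.
  split; first by rewrite /= in_itv/=; apply/andP; split; lra.
    by rewrite -subr_eq0 addrC addKr oppr_eq0 gt_eqF.
  by rewrite addrC addKr normrN gtr0_norm//; lra.
have {x0 xn xT}-> : x = 0 by lra.
exists (Num.min (T / 2) (e / 2)).
have m0 : 0 < Num.min (T / 2) (e / 2) by rewrite lt_min !divr_gt0.
have m1 : Num.min (T / 2) (e / 2) <= T / 2 by rewrite ge_min lexx.
have m2 : Num.min (T / 2) (e / 2) <= e / 2 by rewrite ge_min lexx orbT.
split; first by rewrite /= in_itv/=; apply/andP; split; lra.
  by rewrite gt_eqF.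
by rewrite subr0 gtr0_norm//; lra.
Qed.

Lemma perfect_itvoc T : 0 < T -> perfect_set `]0, T].
Proof.
move=> T0 x; rewrite /= in_itv/= => /andP[x0 xT] e e0.
exists (x - Num.min (x / 2) (e / 2)).
have m0 : 0 < Num.min (x / 2) (e / 2) by rewrite lt_min !divr_gt0.
have m1 : Num.min (x / 2) (e / 2) <= x / 2 by rewrite ge_min lexx.
have m2 : Num.min (x / 2) (e / 2) <= e / 2 by rewrite ge_min lexx orbT.
split; first by rewrite /= in_itv/=; apply/andP; split; lra.
  by rewrite -subr_eq0 addrC addKr oppr_eq0 gt_eqF.
by rewrite addrC addKr normrN gtr0_norm//; lra.
Qed.

Lemma perfect_proper D x : perfect_set D -> D x -> ProperFilter (within D x^').
Proof.
move=> pD Dx; split; last exact: within_filter.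
rewrite /within/= /dnbhs /within/= => -[d /= d0 hd].
have [z [Dz zx zd]] := pD x Dx d d0.
by apply: (hd z) => //=; rewrite distrC.
Qed.

Lemma has_deriv_on_deriv D f x l : perfect_set D -> D x -> has_deriv_on D f x l ->
  derivable_on D f x /\ deriv_on D f x = l.
Proof.
move=> pD Dx H; have PF := perfect_proper pD Dx; split.
  by apply/cvg_ex; exists l.
by apply: cvg_lim => //; exact: H.
Qed.

Lemma derivable_on_has_deriv D f x : derivable_on D f x -> has_deriv_on D f x (deriv_on D f x).
Proof. by []. Qed.

(** Iterated derivatives are identified by guessing all of them at once. The guesses need to be
    right on [D] only, because a difference quotient relative to [D] at a point of [D] sees no other
    values. *)
Lemma derivn_onP D n f (F : nat -> R -> R) : perfect_set D ->
  (forall z, D z -> f z = F 0%N z) ->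
  (forall k, (k < n)%N -> forall x, D x -> has_deriv_on D (F k) x (F k.+1 x)) ->
  times_derivable_on D n f /\
  forall k, (k <= n)%N -> forall x, D x -> derivn_on D k f x = F k x.
Proof.
move=> pD fF dF.
have H k : (k <= n)%N -> forall x, D x -> derivn_on D k f x = F k x.
  elim: k => [_ x /fF //|k IH kn x Dx].
  rewrite /derivn_on /= -/(derivn_on D k f).
  have H := dF k kn x Dx.
  apply: (proj2 (has_deriv_on_deriv pD Dx _)).
  apply: (eq_has_deriv_on Dx _ H) => z Dz.
  by rewrite IH// ltnW.
split=> // k kn x Dx.
apply: (proj1 (@has_deriv_on_deriv _ _ _ (F k.+1 x) pD Dx _)).
by apply: (eq_has_deriv_on Dx _ (dF k kn x Dx)) => z Dz; rewrite H// ltnW.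
Qed.

Lemma within_continuousP D f : {within D, continuous f} <->
  (forall x, D x -> f z @[z --> within D (nbhs x)] --> f x).
Proof.
split=> H x.
  by move=> Dx; rewrite (nbhs_subspace_in Dx); exact: H.
have [Dx|nDx] := pselect (D x).
  by have := H x Dx; rewrite nbhs_subspace_in.
move=> A nA.
rewrite /nbhs/= -nbhs_subspace_out//= => _ /= ->.
exact: nbhs_singleton nA.
Qed.

End RelativeDerivatives.

(** * The functional equation of Gamma *)

Section GammaSucc.
Context {R : realType}.
Implicit Types (d t : R).

(** No integration by parts: the derivative at 1 of I^(d+1) 1 = t^(d+1) / Gamma(d + 2) is computed
    once from the power and once as I^d 1. *)
Lemma Gamma_succ d : 0 <= d -> Gamma (d + 1 + 1) = (d + 1) * Gamma (d + 1).
Proof.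
move=> d0.
have i01 : 0 < (1 : R) < 2 by apply/andP; split; lra.
have H := @is_derive_RL_int R 2 d 0 (fun=> 1) 1 d0 i01 ltr01 (sing_cst 2 1).
rewrite (@RL_int_cst1 _ 2) // in H; last by lra.
have d11 : 0 < d + 1 + 1 by lra.
have H2 : is_derive (1 : R) 1 (RL_int (d + 1) (fun=> 1)) ((d + 1) * (Gamma (d + 1 + 1))^-1).
  apply: (@near_eq_is_derive _ _ _ (fun t => (Gamma (d + 1 + 1))^-1 * t `^ (d + 1))).
    near=> z; rewrite (@RL_int_cst1 _ 2) ?addr_ge0//.
      by rewrite /Phi addrK mulrC.
    apply/andP; split; first by apply/ltW; near: z; exact: lt_nbhsr.
    by near: z; apply: lt_nbhsl; lra.
  have := @is_derive1_powR R (d + 1) 1 ltr01; rewrite powR1 mulr1 => H1.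
  have H3 := is_deriveZ (Gamma (d + 1 + 1))^-1 H1.
  by apply: (is_derive_eq H3); rewrite [RHS]mulrC.
have := @derive_val _ _ _ _ _ _ _ H; rewrite (@derive_val _ _ _ _ _ _ _ H2).
rewrite /Phi powR1 mul1r => E.
have G1 := Gamma_gt0 d11.
have d1 : 0 < d + 1 by lra.
have G2 := Gamma_gt0 d1.
have : (d + 1) * Gamma (d + 1) = Gamma (d + 1 + 1) * ((d + 1) / Gamma (d + 1 + 1)) * Gamma (d + 1).
  by rewrite mulrCA mulfV ?mulr1// gt_eqF.
by rewrite E -mulrA mulVf ?mulr1// gt_eqF.
Unshelve. all: by end_near. Qed.

Lemma Gamma_nat k : Gamma (k%:R + 1 : R) = k`!%:R.
Proof.
elim: k => [|k IH]; first by rewrite add0r Gamma1 fact0.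
by rewrite -(natr1 k) Gamma_succ// IH factS natrM -natr1.
Qed.

Lemma Phi_nat k t : 0 <= t -> Phi (k%:R + 1) t = t ^+ k / k`!%:R.
Proof. by move=> t0; rewrite /Phi Gamma_nat addrK powR_mulrn. Qed.

End GammaSucc.

(** * Fractional Taylor expansions and their Caputo derivatives *)

Section FractionalTaylor.
Context {R : realType} (T U : R) (T0 : 0 < T) (TU : T < U).
Local Notation sing := (sing U).
Implicit Types (f g h x : R -> R) (a b c d t s l : R).

Lemma RL_int1_cst (k t : R) : 0 <= t < U -> RL_int 1 (fun=> k) t = k * t.
Proof.
move=> tU; rewrite -[LHS](@eq_RL_int _ _ (fun=> k * 1)); first last.
- by move=> s _; rewrite mulr1.
- by case/andP : tU.
rewrite (RL_intZ k ler01 ltr01 tU (sing_cst U 1)) (RL_int_cst1 ler01 tU).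
by rewrite (Phi_nat 1) ?fact1 ?divr1//; case/andP : tU.
Qed.

(** I^1 g(z) / z - l is the mean of g - l over ]0, z[, which is small as soon as g is close to l
    there; the value of g at 0 does not enter. *)
Lemma has_deriv_on_RL_int1_0 g l : sing 0 g -> g z @[z --> 0^'+] --> l ->
  has_deriv_on `[0, T] (RL_int 1 g) 0 l.
Proof.
move=> sg gl; apply/has_deriv_onP => e e0.
have e2 : 0 < e / 2 by rewrite divr_gt0.
have /cvgrPdist_le/(_ _ e2) := gl.
rewrite /at_right /within/= => -[d /= d0 hd]; exists d => // z.
rewrite /= in_itv/= => /andP[z0 zT] zN0; rewrite subr0 => zd.
have zp : 0 < z by rewrite lt_neqAle eq_sym zN0.
have zU : 0 <= z < U by rewrite z0 (le_lt_trans zT).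
have zU' : 0 < z < U by rewrite zp (le_lt_trans zT).
rewrite RL_int_at0// subr0 -normrN opprB.
rewrite (_ : RL_int 1 g z / z - l = RL_int 1 (fun s => g s - l) z / z); last first.
  rewrite (RL_intB ler01 ltr01 zU sg (sing_cst U l)) RL_int1_cst// mulrBl mulfK//.
rewrite normrM normfV (gtr0_norm zp) ltr_pdivrMr//.
have b : `|RL_int 1 (fun s => g s - l) z| <=
    e / 2 * (Gamma (1 - 0) / Gamma (1 + (1 - 0))) * z `^ (1 - 0).
  apply: (RL_int_bound ltr01 ltr01 (singB sg (sing_cst U l)) _ zU'); first exact: ltW.
  move=> s /andP[s0 sz]; rewrite oppr0 powRr0 mulr1 -normrN opprB.
  apply: hd => //=; rewrite sub0r normrN gtr0_norm//.
  by rewrite (lt_trans sz)// (le_lt_trans _ zd)// ler_norm.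
have G2 : Gamma (1 + 1 : R) = 1 by have := @Gamma_nat R 1; rewrite factS fact0.
rewrite (le_lt_trans b)// !subr0 powRr1// Gamma1 G2 divr1 mulr1.
by rewrite ltr_pM2r//; lra.
Qed.

Lemma has_deriv_on_RL_int d c g t (D : set R) : 0 <= d -> c < 1 -> sing c g ->
  0 < t <= T -> has_deriv_on D (RL_int (d + 1) g) t (RL_int d g t).
Proof.
move=> d0 c1 sg /andP[t0 tT]; apply: is_derive_has_deriv_on.
by apply: is_derive_RL_int c1 sg => //; rewrite t0 (le_lt_trans tT).
Qed.

Lemma has_deriv_on_RL_int_0 d g : 0 < d -> sing 0 g ->
  has_deriv_on `[0, T] (RL_int (d + 1) g) 0 (RL_int d g 0).
Proof.
move=> d0 sg; rewrite RL_int_at0//.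
have U0 : 0 < U by exact: lt_trans TU.
have sd := sing_RL (ltW d0) ltr01 sg.
have := has_deriv_on_RL_int1_0 (sing_le _ sd)
   (sing_cvg0 _ U0 sd).
rewrite !sub0r !oppr_le0 oppr_lt0 ltW// => /(_ isT d0).
apply: eq_has_deriv_on; first by rewrite /= in_itv/= lexx ltW.
move=> z; rewrite /= in_itv/= => /andP[z0 zT].
rewrite (RL_int_semigroup ler01 (ltW d0) ltr01 sg) 1?addrC//.
by rewrite z0 (le_lt_trans zT).
Qed.

Lemma has_deriv_on_RL_int_cst d t : 0 <= d -> 0 <= t <= T ->
  has_deriv_on `[0, T] (RL_int (d + 1) (fun=> 1)) t (RL_int d (fun=> 1) t).
Proof.
move=> d0 /andP[]; rewrite le_eqVlt => /predU1P[<- _|t0 tT]; last first.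
  by apply: has_deriv_on_RL_int d0 ltr01 (sing_cst U 1) _; rewrite t0.
move: d0; rewrite le_eqVlt => /predU1P[<-|d0].
  rewrite add0r RL_int0E; apply: has_deriv_on_RL_int1_0; first exact: sing_cst.
  exact: cvg_cst.
exact: has_deriv_on_RL_int_0 d0 (sing_cst U 1).
Qed.

Lemma frac_orderE (al : R) nu : nu%:R - 1 < al <= nu%:R -> frac_order al = nu.
Proof.
move=> h; rewrite /frac_order (@ceil_def _ _ nu%:Z)//.
by rewrite intrD -pmulrn mulrN1z.
Qed.

Variables (n0 : nat) (cc : nat -> R) (al0 : R) (x : R -> R).
Hypotheses (n0al : n0%:R - 1 < al0) (sx : sing 0 x).

(** The derivative of order d of sum_j cc_j t^j / j! + I^al0 x, with the powers below t^r left out.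
    Differentiation raises [d] by 1, [RL_int e] lowers it by [e], and subtracting a Taylor
    polynomial raises [r]. *)
Definition frac_taylor (r : nat) (d t : R) : R :=
  \sum_(r <= j < n0) cc j * RL_int (j%:R - d) (fun=> 1) t + RL_int (al0 - d) x t.

Local Notation W := frac_taylor.

(** At t = 0 the inequality is strict because the order al0 - d - 1 left on [x] must be positive for
    the integral to vanish at 0, where [x] itself is uncontrolled. *)
Lemma frac_taylor_deriv r d t (D : set R) : d + 1 <= r%:R ->
  D `<=` `[0, T] -> D t -> (if t == 0 then d + 1 < al0 else d + 1 <= al0) ->
  has_deriv_on D (W r d) t (W r (d + 1) t).
Proof.
move=> dr DT Dt dal; have := DT _ Dt; rewrite /= in_itv/= => tT.
apply: (has_deriv_onS DT).
apply: has_deriv_onD.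
  rewrite /index_iota; apply: has_deriv_on_sum => j; rewrite mem_iota => /andP[rj _].
  apply: has_deriv_onZ.
  rewrite (_ : j%:R - d = (j%:R - (d + 1)) + 1); last by ring.
  apply: has_deriv_on_RL_int_cst => //; rewrite subr_ge0 (le_trans dr)//.
  by rewrite ler_nat.
rewrite (_ : al0 - d = (al0 - (d + 1)) + 1); last by ring.
move: dal; case: eqP => [->|/eqP t0] dal.
  by apply: has_deriv_on_RL_int_0 => //; rewrite subr_gt0.
apply: has_deriv_on_RL_int ltr01 sx _; first by rewrite subr_ge0.
by case/andP : tT => t0' ->; rewrite lt_neqAle eq_sym t0 t0'.
Qed.

Lemma frac_taylorS r d t : (r < n0)%N ->
  W r d t = cc r * RL_int (r%:R - d) (fun=> 1) t + W r.+1 d t.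
Proof. by move=> rn; rewrite /W big_ltn// addrA. Qed.

Lemma frac_taylor_at0 r : (r < n0)%N -> W r r%:R 0 = cc r.
Proof.
move=> rn; rewrite frac_taylorS// subrr RL_int0E mulr1 /W.
have rn' : r%:R <= n0%:R - 1 :> R by rewrite lerBrDr natr1 ler_nat.
rewrite RL_int_at0; last by rewrite subr_gt0 (le_lt_trans rn').
rewrite addr0 big_nat big1 ?addr0// => j /andP[rj _].
by rewrite RL_int_at0 ?mulr0// subr_gt0 ltr_nat.
Qed.

Lemma sing_frac_taylor_sum r d : d <= r%:R ->
  sing 0 (fun t => \sum_(r <= j < n0) cc j * RL_int (j%:R - d) (fun=> 1) t).
Proof.
move=> dr; under eq_fun do rewrite big_nat.
apply: sing_sum => j /andP[rj _]; apply: singZ.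
have jd : 0 <= j%:R - d by rewrite subr_ge0 (le_trans dr)// ler_nat.
by apply: sing_le (sing_RL jd ltr01 (sing_cst U 1)); rewrite sub0r oppr_le0.
Qed.

Lemma RL_int_frac_taylor r d e t : d <= r%:R -> d <= al0 -> 0 <= e -> 0 <= t < U ->
  RL_int e (W r d) t = W r (d - e) t.
Proof.
move=> dr dal e0 tU.
have al : 0 <= al0 - d by rewrite subr_ge0.
have sx' : sing 0 (RL_int (al0 - d) x).
  by apply: sing_le (sing_RL al ltr01 sx); rewrite sub0r oppr_le0.
rewrite (RL_intD e0 ltr01 tU (sing_frac_taylor_sum dr) sx') /W; congr (_ + _).
  rewrite [RHS]big_nat; under [X in RL_int _ X]eq_fun do rewrite big_nat.
  have jd j : (r <= j < n0)%N -> 0 <= j%:R - d.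
    by move=> /andP[rj _]; rewrite subr_ge0 (le_trans dr)// ler_nat.
  have sj j : (r <= j < n0)%N -> sing 0 (RL_int (j%:R - d) (fun=> 1)).
    move=> /jd h; apply: sing_le (sing_RL h ltr01 (sing_cst U 1)).
    by rewrite sub0r oppr_le0.
  rewrite (RL_int_sum _ e0 ltr01 tU); last by move=> j /sj; exact: singZ.
  apply: eq_bigr => j rj; rewrite (RL_intZ _ e0 ltr01 tU (sj _ rj)).
  rewrite (RL_int_semigroup e0 (jd _ rj) ltr01 (sing_cst U 1) tU).
  by congr (_ * RL_int _ _ _); ring.
rewrite (RL_int_semigroup e0 al ltr01 sx tU).
by congr (RL_int _ _ _); ring.
Qed.

Section Represented.
Variable v : R -> R.
Hypothesis vW : forall t, 0 <= t <= T -> v t = W 0 0 t.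

Lemma derivn_frac_taylor p : (p < n0)%N -> times_derivable_on `[0, T] p v /\
  forall k, (k <= p)%N -> forall t, 0 <= t <= T -> derivn_on `[0, T] k v t = W k k%:R t.
Proof.
move=> pn.
have := @derivn_onP _ `[0, T]%classic p v (fun k => W k k%:R) (perfect_itvcc T0).
move=> [].
- by move=> z; rewrite /= in_itv/= => /vW.
- move=> k kp t Dt; have kn : (k.+1 < n0)%N by exact: leq_ltn_trans pn.
  (* The term j = k is constant. It has to be split off because [frac_taylor_deriv] asks for d + 1
     <= r, hence for r = k + 1. *)
  have -> : W k k%:R = (fun t => cc k * 1 + W k.+1 k%:R t).
    by apply/funext => s; rewrite frac_taylorS ?(ltnW kn)// subrr RL_int0E.
  rewrite -[W k.+1 _ _]add0r; apply: has_deriv_onD; first exact: has_deriv_on_cst.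
  have kal : k%:R + 1 < al0.
    by rewrite natr1 (le_lt_trans _ n0al)// lerBrDr natr1 ler_nat.
  rewrite -natr1; apply: frac_taylor_deriv => //; first by rewrite natr1.
  by case: ifP => // _; exact: ltW.
by move=> H1 H2; split=> // k kp t tT; apply: H2.
Qed.

(** Removing the Taylor polynomial turns [W 0 0] into [W nu 0]; integration of order nu - al leads
    to [W nu (al - nu)], and nu derivatives lead to [W nu al]. *)
Lemma Caputo_frac_taylor nu al : nu%:R - 1 < al <= nu%:R -> (nu <= n0)%N -> al <= al0 ->
  (0 < n0)%N ->
  Caputo_derivable T al v /\
  forall t, 0 < t <= T -> Caputo_deriv T al v t = W nu al t.
Proof.
move=> /[dup] /frac_orderE foE /andP[nual alnu] nun alal0 n00.
have pn : (n0.-1 < n0)%N by rewrite prednK.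
have [tdv dv] := derivn_frac_taylor pn.
have rem t : 0 <= t <= T -> Caputo_remainder T al v t = W nu 0 t.
  move=> tT; rewrite /Caputo_remainder foE vW// /W.
  rewrite (big_cat_nat_idem _ _ nun)//=; last by rewrite addr0.
  rewrite addrAC (addrC (\sum_(0 <= i < nu) _)) -!addrA; congr (_ + _).
  rewrite addrA -[RHS]add0r; congr (_ + _).
  rewrite -sumrB big_nat big1// => k /andP[_ knu].
  have kn : (k < n0)%N by exact: leq_trans nun.
  rewrite dv ?lexx ?ltW//; last by rewrite -ltnS prednK.
  have tU2 : 0 <= t < U by case/andP : tT => -> /le_lt_trans ->.
  rewrite frac_taylor_at0// subr0 (RL_int_cst1 _ tU2)//.
  by rewrite Phi_nat; [rewrite mulrA mulrAC subrr|case/andP: tT].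
have tU t : 0 < t <= T -> 0 <= t < U.
  by move=> /andP[/ltW -> /le_lt_trans ->].
have := @derivn_onP _ `]0, T]%classic nu (RL_int (nu%:R - al) (Caputo_remainder T al v))
  (fun k => W nu (k%:R + (al - nu%:R))) (perfect_itvoc T0).
move=> [].
- move=> z; rewrite /= in_itv/= => /[dup] zT /andP[z0 zT'].
  rewrite (@eq_RL_int _ _ _ (W nu 0)); last 2 first.
  + exact: ltW.
  + by move=> s /andP[s0 sz]; rewrite rem// s0 (le_trans sz).
  have al00 : 0 <= al0.
    by rewrite (le_trans _ (ltW n0al))// subr_ge0 ler1n.
  have al0' : 0 <= nu%:R - al by rewrite subr_ge0.
  rewrite (RL_int_frac_taylor (ler0n _ nu) al00 al0' (tU z zT)).
  by congr (W _ _ _); ring.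
- move=> k knu t Dt.
  have kk : k%:R + (al - nu%:R) + 1 <= al.
    rewrite addrAC natr1 addrCA gerDl subr_le0 ler_nat//.
  rewrite -(natr1 k) addrAC; apply: frac_taylor_deriv => //.
  + by rewrite (le_trans kk).
  + by apply: subset_itvr; rewrite bnd_simp.
  + move: Dt; rewrite /= in_itv/= => /andP[t0 _]; rewrite gt_eqF//.
    by rewrite (le_trans kk).
move=> H1 H2; split.
  split; last by rewrite /RL_derivable foE.
  rewrite foE => k knu t Dt; apply: tdv => //.
  by rewrite (leq_trans knu)// -!subn1 leq_sub2r.
move=> t tT; have Dt : `]0, T]%classic t by rewrite /= in_itv.
rewrite /Caputo_deriv /RL_deriv foE (H2 nu (leqnn nu) t Dt).
by congr (W _ _ _); ring.
Qed.

End Represented.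
End FractionalTaylor.

(** * Newton's formula with a singular derivative, and the function spaces of the statement *)

Section Newton.
Context {R : realType}.
Implicit Types (f g h w x : R -> R) (a b c d t s l T U : R).

Lemma cvg_within_eq (D : set R) (F : set_system R) {FF : Filter F} f g l :
  (forall z, D z -> f z = g z) -> f z @[z --> within D F] --> l ->
  g z @[z --> within D F] --> l.
Proof.
move=> fg; apply: cvg_trans; apply: near_eq_cvg.
by rewrite /prop_near1 /within/=; apply: nearW => z /fg.
Qed.

Lemma within_continuous_itvcc T g : 0 < T ->
  (forall t, 0 < t <= T -> {for t, continuous g}) -> g z @[z --> 0^'+] --> g 0 ->
  {within `[0, T], continuous g}.
Proof.
move=> T0 cg c0; apply/within_continuousP => t; rewrite /= in_itv/= => /andP[].
rewrite le_eqVlt => /predU1P[<- _|t0 tT]; last first.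
  by apply: cvg_within_filter; apply: cg; rewrite t0.
apply/cvgrPdist_lt => e e0; have /cvgrPdist_lt/(_ e e0) := c0.
rewrite /at_right /within/= => -[d /= d0 hd].
rewrite /within/=; exists d => //= z zd; rewrite in_itv/= => /andP[z0 zT].
have [->|zn0] := eqVneq z 0; first by rewrite subrr normr0.
by apply: hd => //=; rewrite lt_neqAle eq_sym zn0.
Qed.

Lemma sing_lt0_within T U c g : 0 < T -> T < U -> c < 0 -> sing U c g -> g 0 = 0 ->
  {within `[0, T], continuous g}.
Proof.
move=> T0 TU c0 sg g0; apply: within_continuous_itvcc => //.
  by move=> t /andP[t0 tT]; apply: (proj1 sg); rewrite t0 (le_lt_trans tT).
by rewrite g0; apply: sing_cvg0 sg => //; exact: lt_trans TU.
Qed.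

Lemma eq_of_is_derive (F G H : R -> R) T : 0 < T ->
  {within `[0, T], continuous F} -> {within `[0, T], continuous G} -> F 0 = G 0 ->
  (forall t, 0 < t < T -> is_derive t 1 F (H t)) ->
  (forall t, 0 < t < T -> is_derive t 1 G (H t)) ->
  forall t, 0 <= t <= T -> F t = G t.
Proof.
move=> T0 cF cG FG0 dF dG t /andP[]; rewrite le_eqVlt => /predU1P[<- //|t0 tT].
have dFG s : s \in `]0, t[ -> is_derive s 1 (F - G) 0.
  rewrite in_itv/= => /andP[s0 st]; rewrite -(subrr (H s)).
  by apply: is_deriveB; [apply: dF|apply: dG]; rewrite s0 (lt_le_trans st).
have cFG : {within `[0, t], continuous (F - G)}.
  apply: (@continuous_subspaceW _ _ _ `[0, T]%classic).
    by apply: subset_itvl; rewrite bnd_simp.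
  by move=> s; apply: cvgB; [exact: cF|exact: cG].
have [s _] := MVT t0 dFG cFG.
by rewrite mul0r !fctE FG0 subrr subr0 => /eqP; rewrite subr_eq0 => /eqP.
Qed.

(** The derivative may blow up at 0, but both sides are continuous on [0, T], agree at 0 and have
    the same derivative inside, so the mean value theorem applies to their difference. *)
Lemma Newton_RL T U c w W : 0 < T -> T < U -> c < 1 -> sing U c W ->
  {within `[0, T], continuous w} -> (forall t, 0 < t < T -> is_derive t 1 w (W t)) ->
  forall t, 0 <= t <= T -> w t = w 0 + RL_int 1 W t.
Proof.
move=> T0 TU c1 sW cw dw.
have sI := sing_RL ler01 c1 sW.
have cI : {within `[0, T], continuous (RL_int 1 W)}.
  by apply: sing_lt0_within sI _ => //; [rewrite subr_lt0|exact: RL_int_at0].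
apply: (eq_of_is_derive (H := W)) => //.
- by move=> s; apply: cvgD; [exact: cvg_cst|exact: cI].
- by rewrite RL_int_at0// addr0.
- move=> t /andP[t0 tT]; rewrite -[W t]add0r; apply: is_deriveD.
  by apply: is_derive_RL_int1 c1 sW; rewrite t0 (lt_trans tT).
Qed.

(** The product rule in integrated form. Both products have singularity c + c' - 1, which the
    assumption on c + c' keeps below 1. *)
Lemma RL_int1M T U c c' p q : 0 < T -> T < U -> c < 1 -> c' < 1 ->
  c + c' < 2 -> sing U c p -> sing U c' q ->
  forall t, 0 <= t <= T -> RL_int 1 p t * RL_int 1 q t =
    RL_int 1 (fun s => p s * RL_int 1 q s + RL_int 1 p s * q s) t.
Proof.
move=> T0 TU c1 c'1 cc2 sp sq t tT.
have sIp := sing_RL ler01 c1 sp; have sIq := sing_RL ler01 c'1 sq.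
have cIp : {within `[0, T], continuous (RL_int 1 p)}.
  by apply: sing_lt0_within sIp _ => //; [rewrite subr_lt0|exact: RL_int_at0].
have cIq : {within `[0, T], continuous (RL_int 1 q)}.
  by apply: sing_lt0_within sIq _ => //; [rewrite subr_lt0|exact: RL_int_at0].
have sW : sing U (c + c' - 1) (fun s => p s * RL_int 1 q s + RL_int 1 p s * q s).
  apply: singD; first by rewrite -addrA; exact: singM.
  by rewrite addrAC; exact: singM.
have cW1 : c + c' - 1 < 1 by lra.
apply: (etrans (Newton_RL (w := fun s => RL_int 1 p s * RL_int 1 q s) T0 TU cW1 sW _ _ tT)).
- by move=> s; apply: cvgM; [exact: cIp|exact: cIq].
- move=> s /andP[s0 sT]; have sU : 0 < s < U by rewrite s0 (lt_trans sT).
  have dp := is_derive_RL_int1 sU c1 sp; have dq := is_derive_RL_int1 sU c'1 sq.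
  by apply: (is_derive_eq (is_deriveM dp dq)); rewrite addrC (mulrC (p s)).
- by rewrite !RL_int_at0// mul0r add0r.
Qed.

Lemma has_deriv_on_is_derive T f t l : 0 < t < T -> has_deriv_on `[0, T] f t l ->
  is_derive t 1 f l.
Proof.
move=> /andP[t0 tT] /has_deriv_onP H.
have C : h^-1 *: ((f \o shift t) (h *: (1 : R)) - f t) @[h --> 0^'] --> l.
  apply/cvgrPdist_lt => e /H[d d0 hd].
  pose d' := Num.min d (Num.min t (T - t)).
  have d'0 : 0 < d' by rewrite !lt_min d0 t0 subr_gt0.
  rewrite /dnbhs /within/=; exists d' => // h /=.
  rewrite sub0r normrN !lt_min => /and3P[hd' ht hT] h0.
  have htt : h + t != t by rewrite -subr_eq0 addrK.
  have Dht : `[0, T]%classic (h + t).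
    rewrite /= in_itv/=; move: ht hT; rewrite !ltr_norml => /andP[? ?] /andP[? ?].
    by apply/andP; split; lra.
  have := hd (h + t) Dht htt; rewrite addrK => /(_ hd').
  by rewrite [h *: 1]mulr1 /GRing.scale/= (mulrC (h^-1)).
by split; [apply/cvg_ex; exists l|apply: cvg_lim].
Qed.

(* Functions on [0, T] are extended to ]0, 2 T[, so that two-sided derivatives exist at T. *)
Definition extend_right T g : R -> R := fun s => if s <= T then g s else g T.

Lemma sing_extend_right T c g N : 0 < T -> 0 <= c ->
  (forall t, 0 < t <= T -> g z @[z --> within `]0, T] (nbhs t)] --> g t) ->
  0 <= N -> (forall t, 0 < t <= T -> `|g t| <= N * t `^ (- c)) ->
  sing (2 * T) c (extend_right T g).
Proof.
move=> T0 c0 cg N0 gN; split.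
  move=> t /andP[t0 _]; have [tT|Tt] := leP t T; last first.
    apply: (@near_cst_continuous _ _ (g T)).
    near=> z; rewrite /extend_right leNgt.
    suff -> : T < z by [].
    by near: z; exact: lt_nbhsr.
  apply/cvgrPdist_lt => e e0.
  have /cvgrPdist_lt/(_ e e0) : g z @[z --> within `]0, T] (nbhs t)] --> g t.
    by apply: cg; rewrite t0.
  rewrite /within/= => -[d /= d0 hd].
  have m0 : 0 < Num.min d t by rewrite lt_min d0.
  exists (Num.min d t) => // z /=; rewrite lt_min => /andP[zd zt].
  have z0 : 0 < z by move: zt; rewrite ltr_norml => /andP[]; lra.
  rewrite /extend_right tT; case: ifPn => [zT|].
    by apply: hd => //=; rewrite in_itv/= z0.
  rewrite -ltNge => Tz; apply: hd; last by rewrite /= in_itv/= T0 lexx.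
  move: zd; rewrite /= distrC [X in _ -> X < _]distrC !ger0_norm ?subr_ge0//; lra.
(* Beyond T the value is g T, bounded by N T^(-c) = N 2^c (2 T)^(-c) <= N 2^c s^(-c). *)
exists (N * 2 `^ c); first by rewrite mulr_ge0// powR_ge0.
have two1 : 1 <= 2 `^ c :> R.
  by have := @ler_powR R 2 (ler1n _ 2) 0 c c0; rewrite powRr0.
move=> s /andP[s0 s2]; rewrite /extend_right; case: ifPn => [sT|].
  apply: (le_trans (gN s _)); first by rewrite s0.
  by rewrite ler_wpM2r ?powR_ge0// ler_peMr.
rewrite -ltNge => Ts; apply: (le_trans (gN T _)); first by rewrite T0 lexx.
rewrite -mulrA ler_wpM2l//.
have h2 : (2 * T) `^ (- c) <= s `^ (- c) by apply: le_powR_neg => //; exact: ltW.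
apply: (@le_trans _ _ (2 `^ c * (2 * T) `^ (- c))); last by rewrite ler_wpM2l ?powR_ge0.
rewrite powRM// ?(ltW T0)// mulrA -powR_gt0D// subrr powRr0 mul1r//.
Unshelve. all: by end_near. Qed.

Lemma extend_rightE T g t : t <= T -> extend_right T g t = g t.
Proof. by rewrite /extend_right => ->. Qed.

Lemma within_bounded T g : 0 <= T -> {within `[0, T], continuous g} ->
  exists2 N, 0 <= N & forall t, 0 <= t <= T -> `|g t| <= N.
Proof.
move=> T0 cg.
have cn : {within `[0, T], continuous (fun t => `|g t|)}.
  by move=> t; apply: cvg_norm; exact: cg.
by have [s _ hs] := EVT_max T0 cn; exists `|g s|.
Qed.

Lemma C_gamma_sing c T f : 0 < T -> 0 <= c -> C_gamma c T f ->
  sing (2 * T) c (extend_right T f).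
Proof.
move=> T0 c0 [g [cg fg]].
have [N N0 gN] := within_bounded (ltW T0) cg.
have fE t : 0 < t <= T -> f t = t `^ (- c) * g t.
  move=> /[dup] tT /andP[t0 _]; rewrite -fg// mulrA -powR_gt0D// addNr powRr0 mul1r//.
apply: (@sing_extend_right _ _ _ N) => //.
  move=> t /[dup] tT /andP[t0 tT'].
  have /within_continuousP/(_ t) cgt := cg.
  have {}cgt : g z @[z --> within `]0, T] (nbhs t)] --> g t.
    apply: cvg_trans (cgt _); last by rewrite /= in_itv/= tT' ltW.
    by apply: cvg_app; apply: within_subset; apply: subset_itvr; rewrite bnd_simp.
  rewrite fE//.
  have cpt : z `^ (- c) @[z --> within `]0, T] (nbhs t)] --> t `^ (- c).
    by apply: cvg_within_filter; exact: continuous_powR_gt0.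
  by apply: cvg_within_eq (cvgM cpt cgt) => z; rewrite /= in_itv/= => /fE.
move=> t /[dup] tT /andP[t0 tT']; rewrite fE// normrM ger0_norm ?powR_ge0// mulrC.
by rewrite ler_wpM2r ?powR_ge0// gN// tT' ltW.
Qed.

Lemma continuous_sing_extend T f : 0 < T -> {within `[0, T], continuous f} ->
  sing (2 * T) 0 (extend_right T f).
Proof.
move=> T0 cf; apply: C_gamma_sing => //; exists f; split=> // t _.
by rewrite powRr0 mul1r.
Qed.

Lemma C1_gamma_primitive c T f : 0 < T -> 0 <= c < 1 -> Cn_gamma 1 c T f ->
  exists2 F, sing (2 * T) c F & forall t, 0 <= t <= T -> f t = f 0 + RL_int 1 F t.
Proof.
move=> T0 /andP[c0 c1] [_ cf df cF].
exists (extend_right T (derivn_on `[0, T] 1 f)); first exact: C_gamma_sing.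
have TU : T < 2 * T by lra.
apply: (Newton_RL T0 TU c1 (C_gamma_sing T0 c0 cF)).
  by have := cf 0%N (leqnn 0).
move=> t /andP[t0 tT].
rewrite extend_rightE ?(ltW tT)//; apply: (@has_deriv_on_is_derive T); first by rewrite t0.
have := df t; rewrite t0 ltW//= => /(_ isT).
exact: derivable_on_has_deriv.
Qed.

(** With G the derivative of order p + 1, one takes x = I^c G, so that I^al0 x = I^(p+1) G is the
    remainder in Taylor's formula. Uniqueness needs this to bring an arbitrary solution into the
    form [frac_taylor]. *)
Lemma Cn_gamma_frac_taylor p c T v : 0 < T -> 0 <= c < 1 -> Cn_gamma p.+1 c T v ->
  let al0 := p.+1%:R - c in
  exists2 x, sing (2 * T) 0 x & forall t, 0 <= t <= T ->
    v t = frac_taylor p.+1 (fun k => derivn_on `[0, T] k v 0) al0 x 0 0 t.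
Proof.
move=> T0 /[dup] c01 /andP[c0 c1] [tdv cv dv cg] al0.
have TU : T < 2 * T by lra.
set U := 2 * T in TU *.
set G := extend_right T (derivn_on `[0, T] p.+1 v).
have sG : sing U c G by exact: C_gamma_sing.
pose x := RL_int c G.
have sx : sing U 0 x by have := sing_RL c0 c1 sG; rewrite subrr.
set cc := fun k => derivn_on `[0, T] k v 0.
have al0p : p.+1%:R - 1 < al0 by rewrite /al0; lra.
exists x => //.
have tU t : 0 <= t <= T -> 0 <= t < U by move=> /andP[-> /le_lt_trans ->].
suff H k : (k <= p)%N -> forall t, 0 <= t <= T ->
    derivn_on `[0, T] k v t = frac_taylor p.+1 cc al0 x k k%:R t.
  by move=> t tT; have := H 0%N isT t tT.
(* Descending induction, from the derivative of order p down to v: each derivative is recovered from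
   the next one by Newton's formula. *)
move=> kp; rewrite -(subKn kp); elim: (p - k)%N (leq_subr k p) => {k kp}[_|i IH ip] t tT.
  rewrite subn0 (Newton_RL T0 TU c1 sG _ _ tT).
  - rewrite frac_taylorS// subrr RL_int0E mulr1; congr (_ + _).
    rewrite /frac_taylor big_geq// add0r /x.
    have -> : al0 - p%:R = 1 - c by rewrite /al0 -natr1; ring.
    have c1' : 0 <= 1 - c by rewrite subr_ge0 ltW.
    by rewrite (RL_int_semigroup c1' c0 c1 sG (tU _ tT)) subrK.
  - exact: cv.
  - move=> s /andP[s0 sT]; rewrite /G extend_rightE ?(ltW sT)//.
    apply: (@has_deriv_on_is_derive T); first by rewrite s0.
    by have := dv s; rewrite s0 ltW//= => /(_ isT); exact: derivable_on_has_deriv.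
have {}IH := IH (ltnW ip).
set k := (p - i.+1)%N in IH *.
have kE : (p - i)%N = k.+1 by rewrite /k subnSK.
rewrite kE in IH.
have kp : (k < p)%N by rewrite -kE leq_subr.
have kal : k.+1%:R <= al0.
  rewrite (le_trans _ (ltW al0p))// lerBrDr natr1 ler_nat//.
have sW : sing U 0 (frac_taylor p.+1 cc al0 x k.+1 k.+1%:R).
  apply: singD; first exact: sing_frac_taylor_sum.
  have h : 0 <= al0 - k.+1%:R by rewrite subr_ge0.
  by apply: sing_le (sing_RL h ltr01 sx); rewrite sub0r oppr_le0.
rewrite (Newton_RL T0 TU ltr01 sW _ _ tT).
- rewrite frac_taylorS ?(ltnW kp)//; last by rewrite ltnS ltnW.
  rewrite subrr RL_int0E mulr1; congr (_ + _).
  rewrite (RL_int_frac_taylor _ _ sx (lexx _) kal ler01 (tU t tT)).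
  by rewrite -natr1 addrK.
- by apply: cv; exact: ltnW.
- move=> s /andP[s0 sT]; rewrite -IH; last by rewrite !ltW.
  apply: (@has_deriv_on_is_derive T); first by rewrite s0.
  apply: (derivable_on_has_deriv (tdv k kp s _)).
  by rewrite /= in_itv/= !ltW.
Qed.

(* Otherwise [RL_int (1 - c) f] would behave like [t `^ (1 - c)] at 0, whereas its derivative
   is bounded. *)
Lemma RL_deriv_continuous_at0 c T f : 0 < T -> 0 < c < 1 -> Cn_gamma 1 c T f ->
  RL_derivable T c f -> C_gamma 0 T (RL_deriv T c f) -> f 0 = 0.
Proof.
move=> T0 /andP[c0 c1] cf; have TU : T < 2 * T by lra.
have fo : frac_order c = 1%N by apply: frac_orderE; rewrite subrr c0 ltW.
have c01 : 0 <= c < 1 by rewrite ltW.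
have [F sF fF] := C1_gamma_primitive T0 c01 cf.
rewrite /RL_derivable /RL_deriv fo => dI [g [cg gE]].
have [M M0 gM] := within_bounded (ltW T0) cg.
set I := RL_int (1%:R - c) f in dI gE.
have c1' : 0 <= 1 - c by lra.
have c2 : c < 1 by [].
pose U := 2 * T.
have sIc : sing U 0 (fun=> f 0) by exact: sing_cst.
have s1F := sing_RL ler01 c1 sF.
(* The first term is a multiple of t^(1-c), the second one is O(t^(2-2c)). *)
have IE t : 0 <= t <= T -> I t = f 0 * RL_int (1 - c) (fun=> 1) t + RL_int (2 - c) F t.
  move=> /[dup] tT /andP[t0 tT']; have tU : 0 <= t < U by rewrite t0 (le_lt_trans tT').
  rewrite /I (@eq_RL_int _ _ _ (fun s => f 0 * 1 + RL_int 1 F s))//; last first.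
    by move=> s /andP[s0 st]; rewrite mulr1 fF// s0 (le_trans st).
  have s1F' : sing U 0 (RL_int 1 F) by apply: sing_le s1F; rewrite subr_le0 ltW.
  rewrite (RL_intD c1' ltr01 tU (singZ _ (sing_cst U 1)) s1F').
  rewrite (RL_intZ _ c1' ltr01 tU (sing_cst U 1)); congr (_ + _).
  rewrite (RL_int_semigroup c1' ler01 c1 sF tU); congr (RL_int _ _ _); ring.
have c2' : 0 <= 2 - c by lra.
have s2F := sing_RL c2' c1 sF.
have s1 := sing_RL c1' ltr01 (sing_cst U 1).
have cI : {within `[0, T], continuous I}.
  have cI' : {within `[0, T], continuous (fun t => f 0 * RL_int (1 - c) (fun=> 1) t + RL_int (2 - c) F t)}.
    have h1 : {within `[0, T], continuous (RL_int (1 - c) (fun=> 1))}.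
      by apply: sing_lt0_within s1 _ => //; [lra|apply: RL_int_at0; lra].
    have h2 : {within `[0, T], continuous (RL_int (2 - c) F)}.
      by apply: sing_lt0_within s2F _ => //; [lra|apply: RL_int_at0; lra].
    by move=> t; apply: cvgD; [apply: cvgM; [exact: cvg_cst|exact: h1]|exact: h2].
  apply/within_continuousP => t Dt; have /within_continuousP/(_ t Dt) := cI'.
  have tT : 0 <= t <= T by move: Dt; rewrite /= in_itv/=.
  rewrite -(IE t tT); apply: cvg_within_eq => z; rewrite /= in_itv/= => zT.
  by rewrite (IE z zT).
have IM t : 0 < t <= T -> `|I t| <= M * t.
  move=> /andP[t0 tT].
  have dIt s : s \in `]0, t[ -> is_derive s 1 I (g s).
    rewrite in_itv/= => /andP[s0 st].
    have sT : 0 < s < T by rewrite s0 (lt_le_trans st).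
    have sT' : 0 < s <= T by rewrite s0 ltW//; case/andP: sT.
    rewrite -gE// powRr0 mul1r; apply: (has_deriv_on_is_derive sT).
    have := dI 0%N isT s; rewrite /= in_itv/= => /(_ sT')/derivable_on_has_deriv.
    (* A derivative relative to ]0, T] is one relative to [0, T], because points at distance less
       than s from s are positive. *)
    move=> /has_deriv_onP H; apply/has_deriv_onP => e /H[d d0 hd].
    exists (Num.min d s); first by rewrite lt_min d0.
    move=> z; rewrite /= in_itv/= => /andP[z0 zT] zs; rewrite lt_min => /andP[zd zs'].
    apply: hd => //=; rewrite in_itv/= zT andbT.
    by move: zs'; rewrite ltr_norml => /andP[]; lra.
  have cIt : {within `[0, t], continuous I}.
    apply: (@continuous_subspaceW _ _ _ `[0, T]%classic) => //.
    by apply: subset_itvl; rewrite bnd_simp.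
  have [s] := MVT t0 dIt cIt; rewrite in_itv/= => /andP[s0 st].
  have I0 : I 0 = 0 by apply: RL_int_at0; lra.
  rewrite I0 !subr0 => ->; rewrite normrM (gtr0_norm t0) ler_wpM2r ?(ltW t0)// gM//.
  by rewrite (ltW s0) ltW// (lt_le_trans st).
have [_ [K K0 hK]] := s2F.
have G0 : 0 < Gamma (1 - c + 1) by apply: Gamma_gt0; lra.
apply/eqP; rewrite -normr_eq0 eq_le normr_ge0 andbT.
suff : `|f 0| / Gamma (1 - c + 1) <= 0.
  by rewrite pmulr_lle0// invr_gt0.
(* After division by t^(1-c), the bound M t for [I] and the bound K t^(2-2c) for the second term of
   [IE] both tend to 0. *)
have H : M * t `^ c + K * t `^ (1 - c) @[t --> 0^'+] --> M * 0 + K * 0.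
  apply: cvgD; apply: cvgM; try exact: cvg_cst; apply: powR_cvg0 => //.
  by rewrite subr_gt0.
rewrite !mulr0 addr0 in H.
apply: (cvgr_to_ge H); near=> t.
have t0 : 0 < t by near: t; exact: nbhs_right_gt.
have tT : t < T by near: t; exact: nbhs_right_lt.
have tT' : 0 <= t <= T by rewrite !ltW.
have tU : 0 <= t < U by rewrite ltW//= (lt_trans tT).
have p0 : 0 < t `^ (1 - c) by exact: powR_gt0.
rewrite -(ler_pM2r p0) mulrDl -!mulrA -!powR_gt0D//.
rewrite (_ : c + (1 - c) = 1); last by ring.
rewrite powRr1 ?(ltW t0)//.
have -> : (Gamma (1 - c + 1))^-1 * t `^ (1 - c) = RL_int (1 - c) (fun=> 1) t.
  by rewrite (RL_int_cst1 c1' tU) /Phi addrK mulrC.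
have -> : `|f 0| * RL_int (1 - c) (fun=> 1) t = `|I t - RL_int (2 - c) F t|.
  rewrite IE// addrK normrM; congr (_ * _); rewrite ger0_norm//.
  by rewrite (RL_int_cst1 c1' tU) /Phi divr_ge0 ?powR_ge0// ltW.
rewrite (le_trans (ler_normB _ _))// lerD//; first by apply: IM; rewrite t0 ltW.
  have /hK : 0 < t < U by rewrite t0; case/andP: tU.
  by move/le_trans; apply; rewrite le_eqVlt; apply/orP; left; apply/eqP; congr (_ * _ `^ _); ring.
Unshelve. all: by end_near. Qed.

End Newton.

(** * Weighted bounds and contractions *)

Section Contractions.
Context {R : realType} (U : R) (U0 : 0 < U).
Local Notation sing := (sing U).
Implicit Types (f g h : R -> R) (L : (R -> R) -> R -> R) (a b c d t s l : R).

(** The exponential factor is Bielecki's device: it yields a contraction on the whole interval at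
    once, without cutting it into short pieces. *)
Definition weight c l s : R := s `^ (- c) * expR (l * s).

Lemma weight_ge0 c l s : 0 <= weight c l s.
Proof. by rewrite mulr_ge0 ?powR_ge0 ?expR_ge0. Qed.

Definition weight_bounded c l N g := forall s, 0 < s < U -> `|g s| <= N * weight c l s.

(* Replaces a norm estimate in the space weighted by [weight c l]: the norm of [L] tends to 0
   as [l] tends to infinity. *)
Definition weight_small c L := forall e, 0 < e -> exists2 l0, 0 < l0 &
  forall l, l0 <= l -> forall g N, sing c g -> 0 <= N -> weight_bounded c l N g ->
    weight_bounded c l (e * N) (L g).

Lemma powR_small (k K e : R) : 0 < k -> 0 <= K -> 0 < e -> exists2 l0, 0 < l0 &
  forall l, l0 <= l -> K * l `^ (- k) <= e.
Proof.
(* K + 1 instead of K keeps [y] positive when K = 0; then l >= y^(1/k) gives l^(-k) <= 1 / y = e /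
   (K + 1). *)
move=> k0 K0 e0; pose y := (K + 1) / e.
have y0 : 0 < y by rewrite divr_gt0//; lra.
exists (y `^ (k^-1)); first exact: powR_gt0.
move=> l yl; have h : l `^ (- k) <= (y `^ (k^-1)) `^ (- k).
  by apply: le_powR_neg => //; [exact: ltW|exact: powR_gt0].
apply: (le_trans (ler_wpM2l K0 h)).
rewrite -powRrM mulrN mulVf ?gt_eqF// powR_inv1 ?(ltW y0)// /y invf_div.
rewrite mulrA ler_pdivrMr; last by lra.
by rewrite mulrC ler_wpM2l//; lra.
Qed.

Lemma sing_coefM c a d p g : c < 1 -> 0 <= d -> a <= d -> sing a p -> sing c g ->
  sing c (fun t => p t * RL_int d g t).
Proof.
move=> c1 d0 ad sp sg; have := singM sp (sing_RL d0 c1 sg).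
by apply: sing_le; rewrite -lerBrDr; lra.
Qed.

Lemma weight_small_coefM c a d p : c < 1 -> 0 <= a < d -> sing a p ->
  weight_small c (fun g t => p t * RL_int d g t).
Proof.
move=> c1 /andP[a0 ad] [_ [M M0 pM]] e e0.
(* k <= 1 is what [RL_int_exp_bound] requires; k <= (d - a) / 2 keeps d - k - a positive, so that
   after the loss of order k the kernel still compensates the singularity of [p]. *)
pose k := Num.min 1 ((d - a) / 2).
have k0 : 0 < k by rewrite lt_min ltr01 divr_gt0// subr_gt0.
have k1 : k <= 1 by rewrite ge_min lexx.
have k2 : k <= (d - a) / 2 by rewrite ge_min lexx orbT.
have kd : 0 < k < d by rewrite k0/=; lra.
set C := Gamma (d - k) / Gamma d * (Gamma (1 - c) / Gamma (d - k + (1 - c))).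
have C0 : 0 <= C.
  have d1 : 0 < d - k by lra.
  have d2 : 0 < d by lra.
  have d3 : 0 < 1 - c by lra.
  have d4 : 0 < d - k + (1 - c) by lra.
  by apply: mulr_ge0; apply: divr_ge0; apply: ltW; exact: Gamma_gt0.
pose E := U `^ (d - k - a).
have [l0 l00 hl] := powR_small k0 (K := M * C * E) (e := e)
  (mulr_ge0 (mulr_ge0 M0 C0) (powR_ge0 _ _)) e0.
exists l0 => // l ll g N sg N0 gN t /[dup] tU /andP[t0 tU'].
have lp : 0 < l by exact: lt_le_trans ll.
have b : `|RL_int d g t| <= N * l `^ (- k) * C * (t `^ (d - k - c) * expR (l * t)).
  apply: (RL_int_exp_bound kd k1 c1 lp sg N0 tU) => s /andP[s0 st].
  by apply: gN; rewrite s0 (lt_trans st).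
rewrite normrM (le_trans (ler_pM _ _ (pM _ tU) b))//.
have tE : t `^ (d - k - a) <= E.
  by apply: ge0_ler_powR; rewrite ?nnegrE ?(ltW t0) ?(ltW tU') ?(ltW U0)//; lra.
have -> : M * t `^ (- a) * (N * l `^ (- k) * C * (t `^ (d - k - c) * expR (l * t))) =
    M * C * t `^ (d - k - a) * l `^ (- k) * (N * weight c l t).
  rewrite /weight.
  rewrite (powR_gt0D (d - k) (- c) t0) (powR_gt0D (d - k) (- a) t0).
  set X1 := t `^ (- a); set X2 := l `^ _; set X3 := t `^ _; set X4 := t `^ _; set X5 := expR _.
  by clear; ring.
rewrite -(mulrA e) ler_wpM2r//.
  by rewrite mulr_ge0// weight_ge0.
apply: le_trans (hl l ll); rewrite ler_wpM2r ?powR_ge0//.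
by rewrite ler_wpM2l// mulr_ge0.
Qed.

Lemma weight_smallD c L L' : weight_small c L -> weight_small c L' ->
  weight_small c (fun g t => L g t + L' g t).
Proof.
move=> hL hL' e e0; have e2 : 0 < e / 2 by rewrite divr_gt0.
have [l0 l00 hl0] := hL _ e2; have [l1 l10 hl1] := hL' _ e2.
exists (Num.max l0 l1); first by rewrite lt_max l00.
move=> l; rewrite ge_max => /andP[ll0 ll1] g N sg N0 gN s sU.
rewrite (le_trans (ler_normD _ _))//.
rewrite (le_trans (lerD (hl0 l ll0 g N sg N0 gN s sU) (hl1 l ll1 g N sg N0 gN s sU)))//.
by rewrite -mulrDl -mulrDl -splitr.
Qed.

Lemma weight_small_sum c (I : eqType) (r : seq I) (F : I -> (R -> R) -> R -> R) :
  (forall i, i \in r -> weight_small c (F i)) ->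
  weight_small c (fun g t => \sum_(i <- r) F i g t).
Proof.
elim: r => [_|i r IH H].
  move=> e e0; exists 1 => // l _ g N _ N0 _ s _.
  by rewrite big_nil normr0 mulr_ge0 ?weight_ge0// mulr_ge0// ltW.
rewrite (_ : (fun g t => _) = (fun g t => F i g t + \sum_(j <- r) F j g t)); last first.
  by apply/funext => g; apply/funext => t; rewrite big_cons.
apply: weight_smallD; first by apply: H; rewrite inE eqxx.
by apply: IH => j jr; apply: H; rewrite inE jr orbT.
Qed.

Lemma sing_iter c L f k : (forall g, sing c g -> sing c (L g)) -> sing c f ->
  sing c (iter k L f).
Proof. by move=> hL sf; elim: k => //= k; exact: hL. Qed.

Lemma sing_weight_bounded c l g : 0 <= l -> sing c g -> exists2 N, 0 <= N & weight_bounded c l N g.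
Proof.
move=> l0 [_ [N N0 gN]]; exists N => // s /[dup] sU /andP[s0 _].
rewrite (le_trans (gN s sU))// ler_wpM2l// /weight ler_peMr ?powR_ge0//.
by rewrite -expR0 ler_expR mulr_ge0// ltW.
Qed.

(** A single l that halves the weighted bound serves for all k. On the bounded interval the factor
    e^(l s) then goes into the constant, and a bound free of l remains. *)
Lemma iter_geometric c L f : 0 <= c < 1 -> (forall g, sing c g -> sing c (L g)) ->
  weight_small c L -> sing c f ->
  exists2 N, 0 <= N & forall k s, 0 < s < U ->
    `|iter k L f s| <= N * 2^-1 ^+ k * s `^ (- c).
Proof.
move=> c01 hL wL sf; have h2 : 0 < 2^-1 :> R by rewrite invr_gt0.
have [l l0 hl] := wL _ h2.
have [N N0 fN] := sing_weight_bounded (ltW l0) sf.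
have H k : weight_bounded c l (2^-1 ^+ k * N) (iter k L f).
  elim: k => [|k IH]; first by rewrite expr0 mul1r.
  rewrite exprS -mulrA /=; apply: (hl l (lexx l)) IH; first exact: sing_iter.
  by rewrite mulr_ge0// exprn_ge0// ltW.
exists (N * expR (l * U)); first by rewrite mulr_ge0 ?expR_ge0.
move=> k s /[dup] sU /andP[s0 sU']; rewrite (le_trans (H k s sU))//.
rewrite /weight (mulrC (2^-1 ^+ k)) -!mulrA ler_wpM2l//.
rewrite [leRHS]mulrCA ler_wpM2l ?exprn_ge0 ?(ltW h2)//.
  rewrite [leRHS]mulrC ler_wpM2l ?powR_ge0// ler_expR.
  by apply: ler_wpM2l; exact: ltW.
Qed.

(** [g] has some finite weighted bound N, and each use of the inequality halves it, so that 2^(-k) N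
    is a bound for every k. *)
Lemma eq0_of_contraction c L g : 0 <= c < 1 -> weight_small c L -> sing c g ->
  (forall s, 0 < s < U -> `|g s| <= `|L g s|) -> forall s, 0 < s < U -> g s = 0.
Proof.
move=> c01 wL sg gL; have h2 : 0 < 2^-1 :> R by rewrite invr_gt0.
have [l l0 hl] := wL _ h2.
have [N N0 gN] := sing_weight_bounded (ltW l0) sg.
have H k : weight_bounded c l (2^-1 ^+ k * N) g.
  elim: k => [|k IH]; first by rewrite expr0 mul1r.
  move=> s sU; rewrite (le_trans (gL s sU))// exprS -mulrA.
  by apply: (hl l (lexx l)) IH s sU => //; rewrite mulr_ge0// exprn_ge0// ltW.
move=> s sU; apply/eqP; rewrite -normr_eq0 eq_le normr_ge0 andbT.
have C : (2^-1 ^+ k * (N * weight c l s)) @[k --> \oo] --> 0 * (N * weight c l s).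
  apply: cvgM; last exact: cvg_cst.
  by apply: cvg_expr; rewrite ger0_norm ?(ltW h2)// invf_lt1// ltr1n.
rewrite mul0r in C; apply: (cvgr_to_ge C); near=> k.
by have := H k s sU; rewrite -mulrA.
Unshelve. all: by end_near. Qed.

End Contractions.

(** * Geometrically dominated alternating series and their fractional integrals *)

Section AlternatingSeries.
Context {R : realType} (U : R) (U0 : 0 < U).
Local Notation sing := (sing U).
Implicit Types (f g h : R -> R) (a b c d t s l : R).
Variables (c : R) (c01 : 0 <= c < 1) (g : nat -> R -> R) (N : R).
Hypotheses (N0 : 0 <= N) (sg : forall k, sing c (g k))
  (gN : forall k s, 0 < s < U -> `|g k s| <= N * 2^-1 ^+ k * s `^ (- c)).

(** The signs begin with -1 because the equation to be solved is x = -(f + L x), whose series begins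
    with -f. *)
Definition alt_term (k : nat) (t : R) : R := (-1) ^+ k.+1 * g k t.
Definition alt_sum t : R := limn (series (alt_term ^~ t)).

Let c1 : c < 1. Proof. by case/andP : c01. Qed.
Let c0 : 0 <= c. Proof. by case/andP : c01. Qed.
Let h2 : 0 < 2^-1 :> R. Proof. by rewrite invr_gt0. Qed.

Lemma norm_alt_term k s : 0 < s < U -> `|alt_term k s| <= N * 2^-1 ^+ k * s `^ (- c).
Proof. by move=> sU; rewrite /alt_term normrM normrX normrN1 expr1n mul1r gN. Qed.

Lemma cvg_alt_series s : 0 < s < U -> cvgn (series (alt_term ^~ s)).
Proof.
move=> sU; apply: normed_cvg.
apply: (@series_le_cvg _ _ (fun k => N * s `^ (- c) * 2^-1 ^+ k)) => //.
- by move=> k /=.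
- by move=> k; rewrite mulr_ge0 ?mulr_ge0 ?powR_ge0 ?exprn_ge0// ltW.
- by move=> k /=; rewrite (le_trans (norm_alt_term k sU))// mulrAC.
- apply: is_cvg_geometric_series; rewrite ger0_norm ?(ltW h2)//.
  by rewrite invf_lt1// ltr1n.
Qed.

Lemma alt_series_tail n s : 0 < s < U ->
  `|alt_sum s - series (alt_term ^~ s) n| <= 2 * N * 2^-1 ^+ n * s `^ (- c).
Proof.
move=> sU; have C := cvg_alt_series sU.
(* The bracket is the geometric sum of 2^(-k) over n <= k < n + m, in the closed form that suits
   induction on m. *)
have K (m : nat) : `|series (alt_term ^~ s) (n + m)%N - series (alt_term ^~ s) n| <=
    N * s `^ (- c) * (2 * 2^-1 ^+ n - 2 * 2^-1 ^+ (n + m)).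
  elim: m => [|m IH]; first by rewrite !addn0 !subrr normr0 mulr0.
  rewrite addnS /series/= big_nat_recr//= -/(series (alt_term ^~ s) (n + m)%N).
  rewrite -/(series (alt_term ^~ s) n) addrAC (le_trans (ler_normD _ _))//.
  rewrite (le_trans (lerD IH (norm_alt_term _ sU)))// exprS mulrA divff// mul1r.
  rewrite le_eqVlt; apply/orP; left; apply/eqP.
  by set P := s `^ _; set X := _ ^+ n; set Y := _ ^+ _; clear; ring.
have H : series (alt_term ^~ s) m @[m --> \oo] --> alt_sum s by exact: C.
have H' : `|series (alt_term ^~ s) m - series (alt_term ^~ s) n| @[m --> \oo] -->
    `|alt_sum s - series (alt_term ^~ s) n|.
  by apply: cvg_norm; apply: cvgB => //; exact: cvg_cst.
apply: (cvgr_to_le H'); near=> m.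
have nm : (n <= m)%N by near: m; exact: nbhs_infty_ge.
rewrite -(subnKC nm) (le_trans (K _))//.
have : 0 <= 2^-1 ^+ (n + (m - n))%N :> R by rewrite exprn_ge0// ltW.
have : 0 <= s `^ (- c) by exact: powR_ge0.
set P := s `^ _; set X := _ ^+ n; set Y := _ ^+ _ => P0 Y0.
rewrite -subr_ge0 (_ : _ - _ = N * P * (2 * Y)); last by ring.
by rewrite !mulr_ge0.
Unshelve. all: by end_near. Qed.

Lemma sing_alt_series n : sing c (fun t => series (alt_term ^~ t) n).
Proof.
by rewrite /series/=; apply: sing_sum => k _; apply: singZ; exact: sg.
Qed.

(** The tail bound is uniform on [x/2, U[, which is enough for continuity at x by the usual estimate
    in three parts. *)
Lemma sing_alt_sum : sing c alt_sum.
Proof.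
split; last first.
  exists (2 * N); first by rewrite mulr_ge0.
  move=> s sU; have := alt_series_tail 0 sU.
  by rewrite /series/= big_geq// subr0 expr0 mulr1.
move=> x /andP[x0 xU]; apply/cvgrPdist_lt => e e0.
set K := 2 * N * (x / 2) `^ (- c).
have C : (K * 2^-1 ^+ n) @[n --> \oo] --> K * 0.
  apply: cvgM; first exact: cvg_cst.
  by apply: cvg_expr; rewrite ger0_norm ?(ltW h2)// invf_lt1// ltr1n.
rewrite mulr0 in C.
have e3 : 0 < e / 3 by rewrite divr_gt0.
have /cvgrPdist_lt/(_ _ e3)[n _ /(_ n (leqnn n))/=] := C.
rewrite sub0r normrN => Kn.
have K0 : 0 <= K by rewrite mulr_ge0 ?powR_ge0// mulr_ge0.
have {}Kn : K * 2^-1 ^+ n < e / 3 by apply: le_lt_trans Kn; exact: ler_norm.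
have tail z : x / 2 <= z -> z < U -> `|alt_sum z - series (alt_term ^~ z) n| < e / 3.
  move=> xz zU; have z0 : 0 < z by lra.
  have zU' : 0 < z < U by rewrite z0.
  apply: le_lt_trans Kn; rewrite (le_trans (alt_series_tail n zU'))//.
  rewrite /K [leRHS]mulrAC ler_wpM2l ?mulr_ge0 ?exprn_ge0 ?(ltW h2)//.
  by apply: le_powR_neg => //; lra.
have xU' : 0 < x < U by rewrite x0.
have /cvgrPdist_lt/(_ _ e3) := proj1 (sing_alt_series n) x xU'.
move=> near_x; near=> z.
have xz : x / 2 <= z by apply/ltW; near: z; apply: lt_nbhsr; lra.
have zU : z < U by near: z; exact: lt_nbhsl.
have h1 := tail _ xz zU.
have h3 : `|alt_sum x - series (alt_term ^~ x) n| < e / 3 by apply: tail => //; lra.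
have h4 : `|series (alt_term ^~ x) n - series (alt_term ^~ z) n| < e / 3 by near: z.
rewrite (_ : alt_sum x - alt_sum z = (alt_sum x - series (alt_term ^~ x) n) +
  (series (alt_term ^~ x) n - series (alt_term ^~ z) n) -
  (alt_sum z - series (alt_term ^~ z) n)); last by ring.
rewrite (le_lt_trans (ler_normB _ _))//.
have := ler_normD (alt_sum x - series (alt_term ^~ x) n)
  (series (alt_term ^~ x) n - series (alt_term ^~ z) n).
lra.
Unshelve. all: by end_near. Qed.

(** [RL_int_bound] carries the tail bound through the integral. The case d = 0 is included; it is
    the pointwise convergence of the series itself. *)
Lemma RL_int_alt_sum d t : 0 <= d -> 0 < t < U ->
  series (fun k => (-1) ^+ k.+1 * RL_int d (g k) t) n @[n --> \oo] --> RL_int d alt_sum t.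
Proof.
move=> d0 /[dup] tU /andP[t0 tU']; have tU2 : 0 <= t < U by rewrite ltW.
have E n : series (fun k => (-1) ^+ k.+1 * RL_int d (g k) t) n =
    RL_int d (fun s => series (alt_term ^~ s) n) t.
  rewrite /series/= (RL_int_sum _ d0 c1 tU2); last by move=> k _; exact: singZ.
  by apply: eq_bigr => k _; rewrite (RL_intZ _ d0 c1 tU2).
under eq_fun do rewrite E.
move: d0; rewrite le_eqVlt => /predU1P[<-|d0].
  by under eq_fun do rewrite RL_int0E; rewrite RL_int0E; exact: cvg_alt_series.
pose C := Gamma (1 - c) / Gamma (d + (1 - c)) * t `^ (d - c).
have H : (2 * N * C * 2^-1 ^+ n) @[n --> \oo] --> 2 * N * C * 0.
  apply: cvgM; first exact: cvg_cst.
  by apply: cvg_expr; rewrite ger0_norm ?(ltW h2)// invf_lt1// ltr1n.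
rewrite mulr0 in H.
have B n : `|RL_int d alt_sum t - RL_int d (fun s => series (alt_term ^~ s) n) t| <=
    2 * N * C * 2^-1 ^+ n.
  rewrite -(RL_intB (ltW d0) c1 tU2 sing_alt_sum (sing_alt_series n)).
  have M0 : 0 <= 2 * N * 2^-1 ^+ n by rewrite mulr_ge0 ?exprn_ge0 ?(ltW h2)// mulr_ge0.
  have := RL_int_bound d0 c1 (singB sing_alt_sum (sing_alt_series n)) M0 tU.
  move=> /(_ _)/le_trans; apply.
    move=> s /andP[s0 st]; apply: alt_series_tail; first by rewrite s0 (lt_trans st).
  rewrite /C le_eqVlt; apply/orP; left; apply/eqP.
  by set G := _ / _; set P := t `^ _; set H2 := _ ^+ n; clear; ring.
apply/cvgrPdist_lt => e e0; have /cvgrPdist_lt/(_ _ e0) := H.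
apply: filterS => n; rewrite sub0r normrN => h.
by rewrite (le_lt_trans (B n))// (le_lt_trans _ h)// ler_norm.
Qed.

End AlternatingSeries.

(** * Neumann series for Volterra type operators, and antiderivatives *)

Section Neumann.
Context {R : realType} (U : R) (U0 : 0 < U).
Local Notation sing := (sing U).
Implicit Types (f g h : R -> R) (L : (R -> R) -> R -> R) (b c d t s l : R).

Definition neumann L f : R -> R := alt_sum (fun k => iter k L f).

Section Solution.
Variables (c : R) (L : (R -> R) -> R -> R) (f : R -> R).
Hypotheses (c01 : 0 <= c < 1) (sL : forall g, sing c g -> sing c (L g))
  (wL : weight_small U c L) (sf : sing c f).

Lemma sing_neumann : sing c (neumann L f).
Proof.
have [N N0 gN] := iter_geometric c01 sL wL sf.
by apply: (sing_alt_sum c01 N0 _ gN) => k; exact: sing_iter.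
Qed.

Lemma RL_int_neumann d t : 0 <= d -> 0 < t < U ->
  series (fun k => (-1) ^+ k.+1 * RL_int d (iter k L f) t) n @[n --> \oo] -->
    RL_int d (neumann L f) t.
Proof.
have [N N0 gN] := iter_geometric c01 sL wL sf.
by apply: (RL_int_alt_sum c01 N0 _ gN) => k; exact: sing_iter.
Qed.

(** The partial sum with n + 1 terms is -(f + L s), where s is the partial sum with n terms. The
    explicit form of [L] serves the passage to the limit, which is made in each [RL_int (d i)]
    separately. *)
Lemma neumannE (I : eqType) (r : seq I) (p : I -> R -> R) (d : I -> R) t :
  (forall i, i \in r -> 0 <= d i) ->
  (L = fun g t => \sum_(i <- r) p i t * RL_int (d i) g t) -> 0 < t < U ->
  neumann L f t = - (f t + L (neumann L f) t).
Proof.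
move=> d0 LE tU.
have H0 := RL_int_neumann (lexx 0) tU; rewrite RL_int0E in H0.
have H1 : series (fun k => (-1) ^+ k.+1 * RL_int 0 (iter k L f) t) n.+1 @[n --> \oo] -->
    neumann L f t.
  by have := H0; rewrite -cvg_shiftS.
suff H2 : series (fun k => (-1) ^+ k.+1 * RL_int 0 (iter k L f) t) n.+1 @[n --> \oo] -->
    - (f t + L (neumann L f) t).
  exact: cvg_unique H1 H2.
have E n : series (fun k => (-1) ^+ k.+1 * RL_int 0 (iter k L f) t) n.+1 =
    - (f t + \sum_(i <- r) p i t * series (fun k => (-1) ^+ k.+1 * RL_int (d i) (iter k L f) t) n).
  rewrite /series/= big_nat_recl// expr1 RL_int0E mulN1r opprD; congr (_ + _).
  under [in RHS]eq_bigr do rewrite big_distrr/=.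
  rewrite exchange_big/= -sumrN; apply: eq_bigr => k _.
  rewrite RL_int0E exprS mulN1r mulNr /= {1}LE big_distrr/=; congr (- _).
  by apply: eq_bigr => i _; rewrite mulrCA.
under eq_fun do rewrite E.
apply: cvgN; apply: cvgD; first exact: cvg_cst.
rewrite {2}LE; elim: r d0 {E LE} => [_|i r IH d0].
  by under eq_fun do rewrite big_nil; rewrite big_nil; exact: cvg_cst.
under eq_fun do rewrite big_cons; rewrite big_cons; apply: cvgD.
  by apply: cvgM; [exact: cvg_cst|apply: RL_int_neumann => //; apply: d0; rewrite inE eqxx].
by apply: IH => j jr; apply: d0; rewrite inE jr orbT.
Qed.

End Solution.

(** The point t = 0 is included, which forces u to vanish there. *)
Definition RL_primitive c (u : R -> R) :=
  exists2 F, sing c F & forall t, 0 <= t < U -> u t = RL_int 1 F t.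

Lemma RL_primitive_sum c (I : Type) (r : seq I) (P : pred I) (u : I -> R -> R) : c < 1 ->
  (forall i, P i -> RL_primitive c (u i)) ->
  RL_primitive c (fun t => \sum_(i <- r | P i) u i t).
Proof.
move=> c1 pu; elim: r => [|i r [F sF FE]].
  exists (fun=> 0); first exact: sing0.
  move=> t tU; rewrite big_nil -[LHS](mul0r (RL_int 1 (fun=> 0) t)).
  rewrite -(RL_intZ 0 ler01 c1 tU (sing0 U c)).
  by congr (RL_int 1 _ t); apply/funext => s; rewrite mul0r.
case: (boolP (P i)) => Pi; last first.
  by exists F => // t tU; rewrite big_cons (negbTE Pi) FE.
have [G sG GE] := pu i Pi; exists (fun s => G s + F s); first exact: singD.
by move=> t tU; rewrite big_cons Pi (RL_intD ler01 c1 tU sG sF) -GE// FE.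
Qed.

Lemma RL_int1M_itv c c' p q : c < 1 -> c' < 1 ->
  c + c' < 2 -> sing c p -> sing c' q ->
  forall t, 0 <= t < U -> RL_int 1 p t * RL_int 1 q t =
    RL_int 1 (fun s => p s * RL_int 1 q s + RL_int 1 p s * q s) t.
Proof.
move=> c1 c'1 cc2 sp sq t /andP[t0 tU].
(* [RL_int1M] wants a closed interval that ends before [U]; it may end at the midpoint of t and
   [U]. *)
apply: (@RL_int1M _ ((t + U) / 2) U) sp sq _ _ => //; last (apply/andP; split); lra.
Qed.

Lemma RL_primitive_coef c rho p : 0 <= c < 1 -> 0 <= rho -> sing c p ->
  RL_primitive c (fun t => RL_int 1 p t * RL_int rho (fun=> 1) t).
Proof.
move=> /andP[c0 c1]; rewrite le_eqVlt => /predU1P[<-|r0] sp.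
  by exists p => // t tU; rewrite RL_int0E mulr1.
(* The derivative of t^rho / Gamma(rho + 1). It may be more singular than s^(-c), but the product
   rule multiplies it by I^1 p = O(s^(1-c)), which leaves the exponent c - rho <= c. *)
pose q s := (Gamma rho)^-1 * s `^ (- (1 - rho)).
have sq : sing (1 - rho) q by apply: singZ; exact: sing_pow.
have r1 : 1 - rho < 1 by lra.
have qE t : 0 <= t < U -> RL_int rho (fun=> 1) t = RL_int 1 q t.
  move=> /[dup] tU /andP[]; rewrite le_eqVlt => /predU1P[<- _|t0 tU'].
    by rewrite !RL_int_at0.
  have tp : 0 < t < U by rewrite t0.
  have Gr := Gamma_gt0 r0.
  rewrite (RL_intZ _ ler01 r1 tU (sing_pow U _)) (RL_int_pow ltr01 r1 tp).
  rewrite (RL_int_cst1 (ltW r0) tU) /Phi.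
  have -> : 1 - (1 - rho) = rho by ring.
  by rewrite addrK (addrC rho) mulrA mulrA mulVf ?gt_eqF// mul1r mulrC.
exists (fun s => p s * RL_int 1 q s + RL_int 1 p s * q s).
  apply: singD.
    apply: (@sing_le _ _ (c + (1 - rho - 1))); first by lra.
    by apply: singM => //; exact: sing_RL ler01 r1 sq.
  apply: (@sing_le _ _ (c - 1 + (1 - rho))); first by lra.
  by apply: singM => //; exact: sing_RL ler01 c1 sp.
move=> t tU; rewrite qE//.
by apply: RL_int1M_itv sp sq t tU => //; lra.
Qed.

End Neumann.

(** * The operator and the source term of the Volterra equation *)

Section VolterraOperator.
Context {R : realType} (m p : nat) (alpha : nat -> R) (n : nat -> nat) (abar : nat -> R -> R).
Hypotheses (alpha_lt0 : forall i, (1 <= i < m.+1)%N -> alpha i < alpha 0%N)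
  (alpha_le_n : forall i, (1 <= i < m.+1)%N -> alpha i <= (n i)%:R).
Implicit Types (V t : R) (cc : nat -> R) (g : R -> R).

(** Meant for coefficients extended beyond T; with the original ones it is [series_op]. *)
Definition volterra g t : R :=
  \sum_(1 <= i < m.+1) abar i t * RL_int (alpha 0%N - alpha i) g t.

(** The inner sum begins at [n i] because the Caputo derivative of order [alpha i] annihilates the
    powers t^j with j < [n i]. *)
Definition volterra_source cc t : R :=
  \sum_(1 <= i < m.+1) abar i t *
    \sum_(n i <= j < p.+1) cc j * RL_int (j%:R - alpha i) (fun=> 1) t.

Section OnInterval.
Variables (V : R) (V0 : 0 < V).
Hypothesis sa : forall i, (1 <= i < m.+1)%N -> sing V 0 (abar i).

Lemma sing_volterra c g : c < 1 -> sing V c g -> sing V c (volterra g).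
Proof.
move=> c1 sg; rewrite /volterra; under eq_fun do rewrite big_nat.
apply: sing_sum => i im; have ai := alpha_lt0 im.
by apply: (sing_coefM c1 _ _ (sa im) sg); rewrite subr_ge0 ltW.
Qed.

Lemma weight_small_volterra c : c < 1 -> weight_small V c volterra.
Proof.
move=> c1; apply: weight_small_sum => i; rewrite mem_index_iota => im.
by apply: (weight_small_coefM V0 c1 _ (sa im)); rewrite lexx subr_gt0 alpha_lt0.
Qed.

Lemma sing_volterra_source cc : sing V 0 (volterra_source cc).
Proof.
rewrite /volterra_source; under eq_fun do rewrite big_nat.
apply: sing_sum => i im; apply: (@sing_le _ _ (0 + 0)); first by rewrite addr0.
apply: singM; first exact: sa.
by apply: sing_frac_taylor_sum; exact: alpha_le_n.
Qed.

Lemma volterraB g g' t : 0 < t < V -> sing V 0 g -> sing V 0 g' ->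
  volterra (fun s => g s - g' s) t = volterra g t - volterra g' t.
Proof.
move=> /andP[t0 tV] sg sg'; rewrite /volterra -sumrB big_nat [RHS]big_nat.
apply: eq_bigr => i im; rewrite -mulrBr; congr (_ * _).
have ai := alpha_lt0 im.
by apply: (RL_intB _ ltr01 _ sg sg'); rewrite ?subr_ge0 ltW.
Qed.

Lemma volterra_sum (q : nat) (b : nat -> R) (x : nat -> R -> R) t : 0 < t < V ->
  (forall j, sing V 0 (x j)) ->
  volterra (fun s => \sum_(0 <= j < q) b j * x j s) t = \sum_(0 <= j < q) b j * volterra (x j) t.
Proof.
move=> /andP[t0 tV] sx; rewrite /volterra.
under [RHS]eq_bigr do rewrite big_distrr/=.
rewrite exchange_big/= big_nat [RHS]big_nat; apply: eq_bigr => i im.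
have ai : 0 <= alpha 0%N - alpha i by rewrite subr_ge0 ltW// alpha_lt0.
have tV' : 0 <= t < V by rewrite ltW.
rewrite (RL_int_sum _ ai ltr01 tV'); last by move=> j _; exact: singZ.
rewrite big_distrr/=; apply: eq_bigr => j _.
by rewrite (RL_intZ _ ai ltr01 tV')// mulrCA.
Qed.

End OnInterval.

Lemma volterra_source_sum (b : nat -> R) t :
  volterra_source b t =
  \sum_(0 <= j < p.+1) b j * volterra_source (fun k => (k == j)%:R) t.
Proof.
rewrite /volterra_source.
under [RHS]eq_bigr do rewrite big_distrr/=.
rewrite exchange_big/=; apply: eq_bigr => i _.
under [RHS]eq_bigr do rewrite mulrCA big_distrr/=.
rewrite -big_distrr/= exchange_big/=; congr (_ * _).
rewrite [LHS]big_nat [RHS]big_nat; apply: eq_bigr => k /andP[_ kp].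
rewrite (bigD1_seq k) ?mem_index_iota ?iota_uniq//=.
rewrite eqxx mul1r big1 ?addr0// => j /negbTE jk.
by rewrite eq_sym jk mul0r mulr0.
Qed.

(** The indices that survive are those of H_j, since [n i] <= j means [alpha i] <= j; this is where
    the lower summation bound h_j of the statement comes from. *)
Lemma volterra_source_delta j t : (j < p.+1)%N ->
  volterra_source (fun k => (k == j)%:R) t =
  \sum_(1 <= i < m.+1 | (n i <= j)%N) abar i t * RL_int (j%:R - alpha i) (fun=> 1) t.
Proof.
move=> jp; rewrite /volterra_source [RHS]big_mkcond/=; apply: eq_bigr => i _.
case: ifPn => nij.
  rewrite (bigD1_seq j) ?mem_index_iota ?iota_uniq ?nij//= eqxx mul1r.
  by rewrite big1 ?addr0// => k /negbTE ->; rewrite mul0r.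
rewrite big_nat big1 ?mulr0// => k /andP[nk _].
rewrite (_ : (k == j) = false) ?mul0r//; apply/negbTE.
by apply: contra nij => /eqP <-.
Qed.

End VolterraOperator.

(** * Equivalence of the initial value problem with the Volterra equation *)

Section Representation.
Context {R : realType} (T : R) (T0 : 0 < T) (m p : nat) (alpha : nat -> R) (n : nat -> nat)
  (a abar : nat -> R -> R).
Let U := 2 * T.
Hypotheses (hn : forall i, (i <= m)%N -> (n i)%:R - 1 < alpha i <= (n i)%:R)
  (alpha_lt0 : forall i, (1 <= i < m.+1)%N -> alpha i < alpha 0%N)
  (n0p : n 0%N = p.+1) (n_le : forall i, (i <= m)%N -> (n i <= p.+1)%N)
  (aE : forall i t, (1 <= i < m.+1)%N -> 0 <= t <= T -> abar i t = a i t).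
Variables (cc : nat -> R) (x v : R -> R).
Hypothesis sx : sing U 0 x.
Local Notation W := (frac_taylor p.+1 cc (alpha 0%N) x).
Hypothesis vW : forall t, 0 <= t <= T -> v t = W 0 0 t.

Let TU : T < U. Proof. by rewrite /U; have := T0; lra. Qed.
Let U0 : 0 < U. Proof. exact: lt_trans TU. Qed.
Let al0p : p.+1%:R - 1 < alpha 0%N.
Proof. by have := hn (leq0n m); rewrite n0p => /andP[]. Qed.

Let kal k : (k < p.+1)%N -> k%:R < alpha 0%N.
Proof.
by move=> kp; apply: le_lt_trans al0p; rewrite lerBrDr natr1 ler_nat.
Qed.

Lemma frac_taylor_vanish k : (k < p.+1)%N -> exists2 c, c < 0 & sing U c (W k.+1 k%:R).
Proof.
move=> kp; have h : 0 < alpha 0%N - k%:R by rewrite subr_gt0 kal.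
(* The terms that vanish most slowly at 0 are the power t, for j = k + 1, and the fractional
   integral of [x], which is O(t^(alpha_0 - k)). *)
pose c := Num.min 1 (alpha 0%N - k%:R).
have c0 : 0 < c by rewrite lt_min ltr01.
exists (- c); first by rewrite oppr_lt0.
apply: singD.
  under eq_fun do rewrite big_nat.
  apply: sing_sum => j /andP[kj _]; apply: singZ.
  have jk : 1 <= j%:R - k%:R :> R by rewrite lerBrDr addrC natr1 ler_nat.
  apply: sing_le (sing_RL (le_trans ler01 jk) ltr01 (sing_cst U 1)).
  by rewrite sub0r lerN2 (le_trans _ jk)// ge_min lexx.
apply: sing_le (sing_RL (ltW h) ltr01 sx).
by rewrite sub0r lerN2 ge_min lexx orbT.
Qed.

Lemma frac_taylor_vanish_at0 k : (k < p.+1)%N -> W k.+1 k%:R 0 = 0.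
Proof.
move=> kp; have := frac_taylor_at0 cc x al0p kp.
rewrite frac_taylorS// subrr RL_int0E mulr1 => /eqP.
by rewrite -subr_eq0 addrC addrA addNr add0r => /eqP.
Qed.

Lemma frac_taylor_split k : (k < p.+1)%N -> W k k%:R = (fun t => cc k + W k.+1 k%:R t).
Proof.
by move=> kp; apply/funext => t; rewrite frac_taylorS// subrr RL_int0E mulr1.
Qed.

Lemma represented_derivn k : (k < p.+1)%N -> forall t, 0 <= t <= T ->
  derivn_on `[0, T] k v t = cc k + W k.+1 k%:R t.
Proof.
move=> kp t tT; have [_ ->//] := derivn_frac_taylor T0 TU al0p sx vW kp.
by rewrite frac_taylor_split.
Qed.

Lemma represented_initial : has_initial_values T p.+1 cc v.
Proof.
move=> k kp; have [c c0 sW] := frac_taylor_vanish kp.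
have H : cc k + W k.+1 k%:R t @[t --> 0^'+] --> cc k + 0.
  by apply: cvgD; [exact: cvg_cst|exact: sing_cvg0 sW].
rewrite addr0 in H; apply: cvg_trans H; apply: near_eq_cvg; near=> t.
rewrite represented_derivn//; apply/andP; split; apply/ltW; near: t.
  exact: nbhs_right_gt.
exact: nbhs_right_lt.
Unshelve. all: by end_near. Qed.

Lemma represented_Caputo i : (i <= m)%N -> Caputo_derivable T (alpha i) v /\
  forall t, 0 < t <= T -> Caputo_deriv T (alpha i) v t = W (n i) (alpha i) t.
Proof.
move=> im; apply: (Caputo_frac_taylor T0 TU al0p sx vW (hn im)) => //.
  exact: n_le.
by case: i im => // i im; rewrite ltW// alpha_lt0//= ltnS.
Qed.

(** For i = 0 the polynomial part is empty and [W] reduces to [x]. For i >= 1 the polynomial part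
    goes into the source, and the part with [x] into the operator. *)
Lemma represented_equation t : 0 < t <= T ->
  (Caputo_deriv T (alpha 0%N) v t =
    - \sum_(1 <= i < m.+1) a i t * Caputo_deriv T (alpha i) v t) <->
  (x t = - (volterra_source m p alpha n abar cc t + volterra m alpha abar x t)).
Proof.
move=> /[dup] tT /andP[t0 tT'].
have [_ ->//] := represented_Caputo (leq0n m).
rewrite n0p {1}/frac_taylor big_geq// add0r subrr RL_int0E.
suff -> : \sum_(1 <= i < m.+1) a i t * Caputo_deriv T (alpha i) v t =
  volterra_source m p alpha n abar cc t + volterra m alpha abar x t by [].
rewrite /volterra_source /volterra -big_split/= big_nat [RHS]big_nat.
apply: eq_bigr => i im; rewrite -mulrDr aE//; last by rewrite ltW.
congr (_ * _); have im' : (i <= m)%N by case/andP: im.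
by have [_ ->//] := represented_Caputo im'.
Qed.

Lemma represented_solves :
  (forall t, 0 < t < T ->
    x t = - (volterra_source m p alpha n abar cc t + volterra m alpha abar x t)) ->
  solves_equation T m alpha a v.
Proof.
move=> hx; split=> [i im|t /andP[t0 tT]]; first exact: (represented_Caputo im).1.
by apply/represented_equation; [rewrite t0 ltW|apply: hx; rewrite t0].
Qed.

Lemma represented_solves_inv : solves_equation T m alpha a v ->
  forall t, 0 < t < T ->
    x t = - (volterra_source m p alpha n abar cc t + volterra m alpha abar x t).
Proof.
move=> [_ h] t /andP[t0 tT].
by apply/represented_equation; [rewrite t0 ltW|apply: h; rewrite t0].
Qed.

Variable gamma : R.
Hypotheses (gammaE : gamma = p.+1%:R - alpha 0%N).

(* [phi], the derivative of order [gamma] of [z], is the n0-th derivative of the function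
   represented by [z]. *)
Definition has_gamma_derivative (z : R -> R) := exists phi : R -> R,
  [/\ sing U gamma phi, forall t, 0 <= t <= T -> RL_int (1 - gamma) z t = RL_int 1 phi t
    & cvg (t `^ gamma * phi t @[t --> 0^'+])].

(** Since alpha_0 - p = 1 - gamma, the derivative of order p is cc_p + I^(1-gamma) x = cc_p + I^1
    phi, so the next one is phi on ]0, T]. *)
Lemma represented_Cn_gamma : 0 <= gamma < 1 -> has_gamma_derivative x ->
  Cn_gamma p.+1 gamma T v.
Proof.
move=> /andP[g0 g1] [phi [sphi phiE /cvg_ex[/= l phil]]].
have pp : (p < p.+1)%N by [].
have [tdv dv] := derivn_frac_taylor T0 TU al0p sx vW pp.
have dphi t : 0 < t <= T -> has_deriv_on `[0, T] (derivn_on `[0, T] p v) t (phi t).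
  move=> /andP[t0 tT].
  have DT : `[0, T]%classic t by rewrite /= in_itv/= ltW.
  apply: (@eq_has_deriv_on _ _ (fun s => cc p + RL_int 1 phi s) _ _ _ DT).
    move=> z; rewrite /= in_itv/= => zT; rewrite represented_derivn//; congr (_ + _).
    rewrite /frac_taylor big_geq// add0r -(phiE z zT); congr (RL_int _ x z).
    by rewrite gammaE -(natr1 p); ring.
  rewrite -[phi t]add0r; apply: has_deriv_onD; first exact: has_deriv_on_cst.
  apply: is_derive_has_deriv_on; apply: is_derive_RL_int1 g1 sphi.
  by rewrite t0 (le_lt_trans tT).
have dphi' t : 0 < t <= T -> derivable_on `[0, T] (derivn_on `[0, T] p v) t /\
    deriv_on `[0, T] (derivn_on `[0, T] p v) t = phi t.
  move=> /[dup] tT /andP[t0 tT']; apply: has_deriv_on_deriv; last exact: dphi.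
    exact: perfect_itvcc.
  by rewrite /= in_itv/= ltW.
split => //.
- move=> k kp; apply/within_continuousP => t Dt.
  have tT : 0 <= t <= T by move: Dt; rewrite /= in_itv/=.
  have kp' : (k < p.+1)%N by rewrite ltnS.
  have [c c0 sW] := frac_taylor_vanish kp'.
  have /within_continuousP/(_ t Dt) cW :=
    sing_lt0_within T0 TU c0 sW (frac_taylor_vanish_at0 kp').
  rewrite represented_derivn//.
  apply: (@cvg_within_eq _ _ _ _ (fun s => cc k + W k.+1 k%:R s)).
    by move=> z; rewrite /= in_itv/= => zT; rewrite represented_derivn.
  by apply: cvgD => //; exact: cvg_cst.
- by move=> t /dphi'[].
(* The limit [l] as the value at 0 makes the function continuous there. *)
exists (fun t => if t <= 0 then l else t `^ gamma * phi t); split; last first.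
  by move=> t /[dup] tT /andP[t0 _]; rewrite leNgt t0/= (dphi' t tT).2.
have E (z : R) : 0 < z -> {near z, (fun t : R => t `^ gamma * phi t) =1
    (fun t : R => if t <= 0 then l else t `^ gamma * phi t)}.
  move=> z0; near=> s; rewrite ifF//; apply/negbTE; rewrite -ltNge.
  by near: s; exact: lt_nbhsr.
apply: within_continuous_itvcc => //.
  move=> t /andP[t0 tT]; rewrite /prop_for /continuous_at leNgt t0/=.
  apply: cvg_trans (near_eq_cvg (E t t0)) _.
  apply: cvgM; first exact: continuous_powR_gt0.
  by apply: (proj1 sphi); rewrite t0 (le_lt_trans tT).
rewrite lexx; apply: cvg_trans phil; apply: near_eq_cvg; near=> s.
rewrite ifF//; apply/negbTE; rewrite -ltNge; near: s; exact: nbhs_right_gt.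
Unshelve. all: by end_near. Qed.

End Representation.

(** * Existence of a derivative of order gamma *)

Section GammaDerivative.
Context {R : realType} (T : R) (T0 : 0 < T) (gamma : R) (g01 : 0 <= gamma < 1).
Let U := 2 * T.
Implicit Types (x y z : R -> R) (k : R).
Local Notation hgd := (has_gamma_derivative T gamma).

Let TU : T < U. Proof. by rewrite /U; have := T0; lra. Qed.
Let U0 : 0 < U. Proof. exact: lt_trans TU. Qed.
Let g1 : gamma < 1. Proof. by case/andP : g01. Qed.
Let g1' : 0 <= 1 - gamma. Proof. by rewrite subr_ge0 ltW. Qed.
Let tU t : 0 <= t <= T -> 0 <= t < U.
Proof. by move=> /andP[-> /le_lt_trans ->]. Qed.

Lemma has_gamma_derivative0 : hgd (fun=> 0).
Proof.
exists (fun=> 0); split; first exact: sing0.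
  by move=> t _; rewrite !RL_int_zero.
by under eq_fun do rewrite mulr0; exact: is_cvg_cst.
Qed.

Lemma has_gamma_derivativeD x y : sing U 0 x -> sing U 0 y ->
  hgd x -> hgd y -> hgd (fun t => x t + y t).
Proof.
move=> sx sy [p [sp xp cp]] [q [sq yq cq]].
exists (fun t => p t + q t); split; first exact: singD.
  move=> t tT; rewrite (RL_intD g1' ltr01 (tU tT) sx sy) xp// yq//.
  by rewrite (RL_intD ler01 g1 (tU tT) sp sq).
by under eq_fun do rewrite mulrDr; exact: is_cvgD.
Qed.

Lemma has_gamma_derivativeZ k x : sing U 0 x -> hgd x -> hgd (fun t => k * x t).
Proof.
move=> sx [p [sp xp cp]].
exists (fun t => k * p t); split; first exact: singZ.
  move=> t tT; rewrite (RL_intZ _ g1' ltr01 (tU tT) sx) xp//.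
  by rewrite (RL_intZ _ ler01 g1 (tU tT) sp).
by under eq_fun do rewrite mulrCA; apply: is_cvgM => //; exact: is_cvg_cst.
Qed.

Lemma has_gamma_derivative_sum q (b : nat -> R) (z : nat -> R -> R) :
  (forall j, sing U 0 (z j)) -> (forall j, (j < q)%N -> hgd (z j)) ->
  hgd (fun t => \sum_(0 <= j < q) b j * z j t).
Proof.
move=> sz; elim: q => [_|q IH hz].
  by under eq_fun do rewrite big_nil; exact: has_gamma_derivative0.
under eq_fun do rewrite big_nat_recr//=.
apply: has_gamma_derivativeD.
- by apply: sing_sum => j _; exact: singZ.
- exact: singZ.
- by apply: IH => j jq; apply: hz; exact: ltnW.
- by apply: has_gamma_derivativeZ => //; exact: hz.
Qed.

Lemma has_gamma_derivative_cvg x : gamma = 0 -> sing U 0 x ->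
  cvg (x t @[t --> 0^'+]) -> hgd x.
Proof.
move=> ge0 sx cx; exists x; rewrite ge0; split; first exact: sx.
  by move=> t _; rewrite subr0.
by under eq_fun do rewrite powRr0 mul1r.
Qed.

(** Here phi = I^(1-gamma) z, because I^(1-gamma) commutes with I^1. Its exponent is 2 gamma - 1, so
    t^gamma phi is O(t^(1-gamma)) and tends to 0. *)
Lemma has_gamma_derivative_primitive x z : 0 < gamma -> sing U 0 x -> sing U gamma z ->
  (forall t, 0 < t < U -> x t = RL_int 1 z t) -> hgd x.
Proof.
move=> g0 sx sz xz; have sphi := sing_RL g1' g1 sz.
exists (RL_int (1 - gamma) z); split.
- by apply: sing_le sphi; have := g1; lra.
- move=> t tT.
  have s1 := sing_RL ler01 g1 sz.
  have g11 : gamma - 1 < 1 by have := g1; lra.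
  rewrite (eq_RL_int_sing (h := RL_int 1 z) _ ltr01 g11 (tU tT) sx s1); last 2 first.
  + by rewrite subr_gt0.
  + move=> s /andP[s0 st]; apply: xz; rewrite s0 (lt_trans st)//.
    by case/andP : (tU tT).
  rewrite (RL_int_semigroup g1' ler01 g1 sz (tU tT)).
  by rewrite (RL_int_semigroup ler01 g1' g1 sz (tU tT)) addrC.
have sp := singM (sing_pow U (- gamma)) sphi; rewrite opprK in sp.
by apply/cvg_ex; exists 0; apply: sing_cvg0 sp => //; have := g1; lra.
Qed.

End GammaDerivative.

(** * Regularity of the solution of the Volterra equation *)

Section Regularity.
Context {R : realType} (T : R) (T0 : 0 < T) (m p : nat) (alpha : nat -> R) (n : nat -> nat)
  (abar : nat -> R -> R) (gamma : R) (g01 : 0 <= gamma < 1).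
Let U := 2 * T.
Hypotheses (alpha_lt0 : forall i, (1 <= i < m.+1)%N -> alpha i < alpha 0%N)
  (alpha_le_n : forall i, (1 <= i < m.+1)%N -> alpha i <= (n i)%:R)
  (sa : forall i, (1 <= i < m.+1)%N -> sing U 0 (abar i)).
Variable cc : nat -> R.
Let source := volterra_source m p alpha n abar cc.
Let volt := volterra m alpha abar.
Let x := neumann volt source.
Let U0 : 0 < U. Proof. by rewrite /U mulr_gt0. Qed.
Let i01 : (0 : R) <= (0 : R) < (1 : R). Proof. by rewrite lexx ltr01. Qed.
Let svolt g : sing U 0 g -> sing U 0 (volt g).
Proof. exact: sing_volterra. Qed.
Let wvolt : weight_small U 0 volt. Proof. exact: weight_small_volterra. Qed.
Let ssource : sing U 0 source. Proof. exact: sing_volterra_source. Qed.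

Lemma sing_solution : sing U 0 x.
Proof. exact: sing_neumann. Qed.

Lemma solutionE t : 0 < t < U -> x t = - (source t + volt x t).
Proof.
move=> tU; apply: (neumannE i01 svolt wvolt ssource (r := index_iota 1 m.+1)
  (p := abar) (d := fun i => alpha 0%N - alpha i)) tU => //.
by move=> i; rewrite mem_index_iota => im; rewrite subr_ge0 ltW// alpha_lt0.
Qed.

Lemma is_cvg_sum_seq (I : eqType) (r : seq I) (F : I -> R -> R) :
  (forall i, i \in r -> cvg (F i t @[t --> 0^'+])) ->
  cvg (\sum_(i <- r) F i t @[t --> (0:R)^'+]).
Proof.
elim: r => [_|i r IH H]; first by under eq_fun do rewrite big_nil; exact: is_cvg_cst.
under eq_fun do rewrite big_cons; apply: is_cvgD; first by apply: H; rewrite inE eqxx.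
by apply: IH => j jr; apply: H; rewrite inE jr orbT.
Qed.

(** Serves the case gamma = 0. Integrals of positive order tend to 0 at 0+ and those of order 0 of
    the constant 1 are constant, so the right-hand side of the equation has a limit as soon as the
    coefficients do. *)
Lemma is_cvg_solution : (forall i, (1 <= i < m.+1)%N -> cvg (abar i t @[t --> 0^'+])) ->
  cvg (x t @[t --> 0^'+]).
Proof.
move=> ca.
have c1 d g : 0 < d -> sing U 0 g -> cvg (RL_int d g t @[t --> 0^'+]).
  move=> d0 sg; have sd := sing_RL (ltW d0) ltr01 sg.
  by apply/cvg_ex; exists 0; apply: sing_cvg0 sd => //; rewrite sub0r oppr_lt0.
have cs : cvg (source t @[t --> 0^'+]).
  apply: is_cvg_sum_seq => i; rewrite mem_index_iota => im.
  apply: is_cvgM; first exact: ca.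
  apply: is_cvg_sum_seq => j; rewrite mem_index_iota => /andP[ij _].
  apply: is_cvgM; first exact: is_cvg_cst.
  have : 0 <= j%:R - alpha i.
    by rewrite subr_ge0 (le_trans (alpha_le_n im))// ler_nat.
  rewrite le_eqVlt => /predU1P[<-|ji].
    rewrite (_ : RL_int 0 (fun=> 1) = (fun=> 1 : R)); first exact: is_cvg_cst.
    by apply/funext => s; rewrite RL_int0E.
  by apply: c1 ji _; exact: sing_cst.
have cv : cvg (volt x t @[t --> 0^'+]).
  apply: is_cvg_sum_seq => i; rewrite mem_index_iota => im.
  apply: is_cvgM; first exact: ca.
  by apply: c1 sing_solution; rewrite subr_gt0 alpha_lt0.
have c2 : cvg (- (source t + volt x t) @[t --> 0^'+]).
  by apply: is_cvgN; exact: is_cvgD.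
apply/cvg_ex; have /cvg_ex[/= l hl] := c2; exists l.
apply: cvg_trans hl; apply: near_eq_cvg; near=> t.
rewrite solutionE//; apply/andP; split; near: t; [exact: nbhs_right_gt|exact: nbhs_right_lt].
Unshelve. all: by end_near. Qed.

Section Primitive.
Variable a' : nat -> R -> R.
Hypotheses (sa' : forall i, (1 <= i < m.+1)%N -> sing U gamma (a' i))
  (aE : forall i, (1 <= i < m.+1)%N -> abar i = RL_int 1 (a' i)).
Let g1 : gamma < 1. Proof. by case/andP : g01. Qed.

(* By the product rule, [volterra] maps an antiderivative of [h] to one of
   [volterra_deriv h]. *)
Definition volterra_deriv (h : R -> R) t : R := \sum_(1 <= i < m.+1)
  (a' i t * RL_int 1 (RL_int (alpha 0%N - alpha i) h) t +
   abar i t * RL_int (alpha 0%N - alpha i) h t).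

Let bi i : (1 <= i < m.+1)%N -> 0 <= alpha 0%N - alpha i.
Proof. by move=> im; rewrite subr_ge0 ltW// alpha_lt0. Qed.

Let singI i h : (1 <= i < m.+1)%N -> sing U gamma h ->
  sing U gamma (RL_int (alpha 0%N - alpha i) h).
Proof.
by move=> im sh; apply: sing_le (sing_RL (bi im) g1 sh); rewrite gerBl bi.
Qed.

Let singterm i h : (1 <= i < m.+1)%N -> sing U gamma h ->
  sing U gamma (fun t => a' i t * RL_int 1 (RL_int (alpha 0%N - alpha i) h) t +
   abar i t * RL_int (alpha 0%N - alpha i) h t).
Proof.
move=> im sh; have sI := singI im sh; apply: singD.
  apply: (@sing_le _ _ (gamma + (gamma - 1))); first by have := g1; lra.
  by apply: singM; [exact: sa'|exact: sing_RL ler01 g1 sI].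
apply: (@sing_le _ _ (0 + gamma)); first by rewrite add0r.
by apply: singM => //; exact: sa.
Qed.

Lemma sing_volterra_deriv h : sing U gamma h -> sing U gamma (volterra_deriv h).
Proof.
move=> sh; rewrite /volterra_deriv; under eq_fun do rewrite big_nat.
by apply: sing_sum => i im; exact: singterm.
Qed.

(** In the first summand the two integrations merge into order 1 + alpha_0 - alpha_i > gamma, which
    outweighs the singularity of [a' i]; in the second, [abar i] is bounded and any positive order
    is enough. *)
Lemma weight_small_volterra_deriv : weight_small U gamma volterra_deriv.
Proof.
apply: weight_small_sum => i; rewrite mem_index_iota => im; apply: weight_smallD.
  have := @weight_small_coefM _ U U0 gamma gamma (1 + (alpha 0%N - alpha i)) (a' i) g1.
  move=> /(_ _ (sa' im))H e /H{H}[].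
    by case/andP : g01 => -> /=; have := bi im; have := g1; lra.
  move=> l0 l00 hl; exists l0 => // l ll g N sg N0 gN t tU.
  have := hl l ll g N sg N0 gN t tU; rewrite (RL_int_semigroup ler01 (bi im) g1 sg)//.
  by case/andP : tU => /ltW -> ->.
by apply: (weight_small_coefM U0 g1 _ (sa im)); rewrite lexx subr_gt0 alpha_lt0.
Qed.

Lemma source_primitive : RL_primitive U gamma source.
Proof.
rewrite /source /volterra_source.
rewrite (_ : (fun t => _) = (fun t => \sum_(1 <= i < m.+1 | (1 <= i < m.+1)%N)
   \sum_(n i <= j < p.+1 | (n i <= j < p.+1)%N)
     cc j * (abar i t * RL_int (j%:R - alpha i) (fun=> 1) t))); last first.
  apply/funext => t; rewrite big_nat; apply: eq_bigr => i _.
  by rewrite big_distrr/= big_nat; apply: eq_bigr => j _; rewrite mulrCA.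
apply: (RL_primitive_sum _ g1) => i im; apply: (RL_primitive_sum _ g1) => j /andP[ij _].
have ji : 0 <= j%:R - alpha i.
  by rewrite subr_ge0 (le_trans (alpha_le_n im))// ler_nat.
have [F sF FE] := RL_primitive_coef g01 ji (sa' im).
exists (fun t => cc j * F t); first exact: singZ.
by move=> t tU; rewrite aE// FE// (RL_intZ _ ler01 g1 tU sF).
Qed.

(** I^(alpha_0 - alpha_i) commutes with I^1, so each summand is a product of two antiderivatives, to
    which the integrated product rule applies. *)
Lemma volterra_RL_int1 h g t : sing U gamma h -> 0 <= t < U ->
  (forall s, 0 <= s < U -> g s = RL_int 1 h s) ->
  volt g t = RL_int 1 (volterra_deriv h) t.
Proof.
move=> sh /[dup] tU /andP[t0 tU'] gh.
rewrite /volterra_deriv; under [X in RL_int 1 X]eq_fun do rewrite big_nat.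
rewrite (RL_int_sum _ ler01 g1 tU); last by move=> i im; exact: singterm.
rewrite /volt /volterra big_nat; apply: eq_bigr => i im.
have sI := singI im sh.
rewrite (@eq_RL_int _ _ _ (RL_int 1 h) t t0); last first.
  by move=> s /andP[s0 st]; rewrite gh// s0 (le_lt_trans st).
rewrite (RL_int_semigroup (bi im) ler01 g1 sh tU) addrC.
rewrite -(RL_int_semigroup ler01 (bi im) g1 sh tU).
have g2 : gamma + gamma < 2 by have := g1; lra.
by rewrite (aE im) (RL_int1M_itv g1 g1 g2 (sa' im) sI tU).
Qed.

(** Each iterate of [volt] on the source is the antiderivative of the same iterate of
    [volterra_deriv] on [F]. Integrating the second Neumann series termwise reproduces the partial
    sums of the first, so the limits agree. *)
Lemma solution_primitive : exists2 z, sing U gamma z &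
  forall t, 0 < t < U -> x t = RL_int 1 z t.
Proof.
have [F sF FE] := source_primitive.
exists (neumann volterra_deriv F).
  apply: (sing_neumann g01) => //; first exact: sing_volterra_deriv.
  exact: weight_small_volterra_deriv.
move=> t tU.
have E k s : 0 <= s < U -> iter k volt source s = RL_int 1 (iter k volterra_deriv F) s.
  elim: k s => [s /FE//|k IH s sU /=]; apply: volterra_RL_int1 => //.
  by apply: sing_iter => //; exact: sing_volterra_deriv.
have H1 := RL_int_neumann g01 sing_volterra_deriv weight_small_volterra_deriv sF ler01 tU.
have H2 := RL_int_neumann i01 svolt wvolt ssource (lexx 0) tU.
rewrite RL_int0E -/x in H2.
apply: (cvg_unique _ H2) => //.
apply: cvg_trans H1; apply: near_eq_cvg; apply: nearW => N /=.
rewrite /series/=; apply: eq_bigr => k _; rewrite RL_int0E E//.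
by case/andP : tU => /ltW -> ->.
Qed.

End Primitive.
End Regularity.

(** * The series of the statement as fractional integrals of the Neumann series *)

Section Series.
Context {R : realType} (T : R) (T0 : 0 < T) (m p : nat) (alpha : nat -> R) (n : nat -> nat)
  (a abar : nat -> R -> R).
Let U := 2 * T.
Hypotheses (alpha0_gt0 : 0 < alpha 0%N)
  (alpha_lt0 : forall i, (1 <= i < m.+1)%N -> alpha i < alpha 0%N)
  (alpha_le_n : forall i, (1 <= i < m.+1)%N -> alpha i <= (n i)%:R)
  (sa : forall i, (1 <= i < m.+1)%N -> sing U 0 (abar i))
  (aE : forall i t, (1 <= i < m.+1)%N -> 0 <= t <= T -> abar i t = a i t).
Variables (j hj : nat).
Hypotheses (jp : (j < p.+1)%N) (hj1 : (1 <= hj)%N)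
  (hjE : forall i, (1 <= i < m.+1)%N -> (hj <= i)%N = (n i <= j)%N).
Let source := volterra_source m p alpha n abar (fun k => (k == j)%:R).
Let volt := volterra m alpha abar.
Let x := neumann volt source.

Let TU : T < U. Proof. by rewrite /U; have := T0; lra. Qed.
Let U0 : 0 < U. Proof. exact: lt_trans TU. Qed.
Let tU t : 0 <= t <= T -> 0 <= t < U.
Proof. by move=> /andP[-> /le_lt_trans ->]. Qed.
Let i01 : (0 : R) <= (0 : R) < (1 : R). Proof. by rewrite lexx ltr01. Qed.

(** Original and extended coefficients agree on [0, T] only. This is enough, because [RL_int] at t
    looks at nothing outside [0, t]. *)
Lemma iter_series_opE k t : 0 <= t <= T ->
  iter k (series_op m alpha a)
    (fun s => \sum_(hj <= i < m.+1) a i s * Phi (j%:R + 1 - alpha i) s) t =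
  iter k volt source t.
Proof.
elim: k t => [|k IH] t /[dup] tT /andP[t0 tT'] /=.
  (* The range i >= h_j is rewritten as i >= 1 under the condition h_j <= i, which amounts to [n i]
     <= j. *)
  rewrite /source volterra_source_delta// (big_nat_widenl _ _ _ _ _ hj1).
  rewrite [LHS]big_nat_cond [RHS]big_nat_cond; apply: eq_big => [i|i /andP[im nij]].
    by case: (boolP (1 <= i < m.+1)%N) => //= im; rewrite hjE.
  rewrite (hjE im) in nij.
  have ji : 0 <= j%:R - alpha i by rewrite subr_ge0 (le_trans (alpha_le_n im))// ler_nat.
  by rewrite (aE im tT) (RL_int_cst1 ji (tU tT)); congr (_ * Phi _ _); ring.
rewrite /series_op /volt /volterra big_nat [RHS]big_nat; apply: eq_bigr => i im.
rewrite aE//; congr (_ * _); apply: eq_RL_int => // s /andP[s0 st].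
by rewrite IH// s0 (le_trans st).
Qed.

Lemma series_termE k t : 0 <= t <= T ->
  series_term m alpha a j hj k t = (-1) ^+ k.+1 * RL_int (alpha 0%N) (iter k volt source) t.
Proof.
move=> /andP[t0 tT]; rewrite /series_term; congr (_ * _).
apply: eq_RL_int => // s /andP[s0 st].
by rewrite iter_series_opE// s0 (le_trans st).
Qed.

Lemma cvg_series_term t : 0 <= t <= T ->
  series (fun k => series_term m alpha a j hj k t) N @[N --> \oo] --> RL_int (alpha 0%N) x t.
Proof.
move=> tT.
rewrite (_ : (fun k => series_term m alpha a j hj k t) =
  (fun k => (-1) ^+ k.+1 * RL_int (alpha 0%N) (iter k volt source) t)); last first.
  by apply/funext => k; rewrite series_termE.
have /andP[t0 tU'] := tU tT.
(* The Neumann series is known to converge for t > 0; at 0 every term vanishes because alpha_0 >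
   0. *)
move: t0; rewrite le_eqVlt => /predU1P[<-|t0].
  rewrite RL_int_at0//.
  rewrite (_ : (fun N => _) = (fun=> 0)); first exact: cvg_cst.
  by apply/funext => N; rewrite /series/= big1// => k _; rewrite RL_int_at0// mulr0.
apply: (RL_int_neumann (U := U) i01) => //.
- by move=> g; exact: sing_volterra.
- exact: weight_small_volterra.
- exact: sing_volterra_source.
- exact: ltW.
- by rewrite t0.
Qed.

Lemma series_solutionE t : 0 <= t <= T ->
  series_solution m alpha a j hj t =
  frac_taylor p.+1 (fun k => (k == j)%:R) (alpha 0%N) x 0 0 t.
Proof.
move=> tT; rewrite /series_solution (cvg_lim (@norm_hausdorff _ R) (cvg_series_term tT)).
rewrite /frac_taylor subr0; congr (_ + _).
rewrite (bigD1_seq j) ?mem_index_iota ?iota_uniq//= eqxx mul1r subr0.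
rewrite (RL_int_cst1 (ler0n _ j) (tU tT)) big1 ?addr0// => k /negbTE ->.
by rewrite mul0r.
Qed.

End Series.

(** * Extension of the coefficients, and the theorem *)

Lemma coef_extension (R : realType) (T gamma : R) (f : R -> R) : 0 < T -> 0 <= gamma < 1 ->
  Cn_gamma 1 gamma T f -> RL_derivable T gamma f -> C_gamma 0 T (RL_deriv T gamma f) ->
  exists g : R -> R, [/\ sing (2 * T) 0 g, forall t, 0 <= t <= T -> g t = f t,
    cvg (g t @[t --> 0^'+]) &
    0 < gamma -> exists2 f', sing (2 * T) gamma f' & g = RL_int 1 f'].
Proof.
move=> T0 /[dup] g01 /andP[]; rewrite le_eqVlt => /predU1P[<-|g0] g1 Cf Df cDf.
  have [_ cf _ _] := Cf; have {}cf : {within `[0, T], continuous f} by exact: (cf 0%N).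
  exists (extend_right T f); split; first exact: continuous_sing_extend.
  - by move=> t /andP[_ tT]; rewrite extend_rightE.
  - apply/cvg_ex; exists (f 0).
    have /within_continuousP/(_ 0) := cf; rewrite /= in_itv/= lexx ltW// => /(_ isT) H.
    apply/cvgrPdist_lt => e e0; have /cvgrPdist_lt/(_ e e0) := H.
    rewrite /within/= => -[r /= r0 hr]; near=> t.
    have t0 : 0 < t by near: t; exact: nbhs_right_gt.
    have tT : t < T by near: t; exact: nbhs_right_lt.
    have tr : t < r by near: t; exact: nbhs_right_lt.
    rewrite extend_rightE ?ltW//.
    by apply: hr; rewrite /= ?sub0r ?normrN ?gtr0_norm// in_itv/= !ltW.
  - by rewrite ltxx.
have f0 : f 0 = 0 by apply: (RL_deriv_continuous_at0 T0 _ Cf Df cDf); rewrite g0.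
have [F sF fF] := C1_gamma_primitive T0 g01 Cf.
(* As f 0 = 0, the antiderivative of [F] is f on [0, T]. It also serves as the extension, so that
   the product rule holds on ]0, 2 T[. *)
exists (RL_int 1 F); have sI := sing_RL ler01 g1 sF; split.
- by apply: sing_le sI; rewrite subr_le0 ltW.
- by move=> t tT; rewrite fF// f0 add0r.
- apply/cvg_ex; exists 0; apply: sing_cvg0 sI; first by rewrite subr_lt0.
  by rewrite mulr_gt0.
- by move=> _; exists F.
Unshelve. all: by end_near. Qed.

Theorem corollary1 (R : realType) (T : R) (hT : 0 < T)
  (m : nat) (hm : (1 <= m)%N)
  (alpha : nat -> R)
  (alpha_decr : forall i, (i < m)%N -> alpha i.+1 < alpha i)
  (alpha_ge0 : 0 <= alpha m)
  (n : nat -> nat)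
  (hn : forall i, (i <= m)%N -> (n i)%:R - 1 < alpha i <= (n i)%:R)
  (gamma : R) (hgamma : gamma = (n 0%N)%:R - alpha 0%N)
  (hn01 : n 0%N = n 1%N)
  (a : nat -> R -> R)
  (ha : forall i, (1 <= i <= m)%N ->
     [/\ Cn_gamma 1 gamma T (a i),
         RL_derivable T ((n 0%N)%:R - alpha 0%N) (a i)
       & C_gamma 0 T (RL_deriv T ((n 0%N)%:R - alpha 0%N) (a i))])
  (hH0 : H m alpha 0 !=set0)
  (h : nat -> nat)
  (hh : forall j, (j < n 0%N)%N -> is_min (H m alpha j) (h j))
  (b : nat -> R) :
  let y := fun j => series_solution m alpha a j (h j) in
  [/\ (* the series defining the y_j converge on [0, T] *)
      forall j, (j < n 0%N)%N -> forall t, 0 <= t <= T ->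
        cvgn (series (fun k => series_term m alpha a j (h j) k t)),
      (* the y_j form the canonical fundamental system in C^n0_gamma[0, T] *)
      forall j, (j < n 0%N)%N -> Cn_gamma (n 0%N) gamma T (y j),
      canonical_fundamental_system T m alpha a (n 0%N) y
    & (* the initial value problem has a unique solution, with the stated form *)
      exists u : R -> R,
        [/\ Cn_gamma (n 0%N) gamma T u,
            solves_equation T m alpha a u,
            has_initial_values T (n 0%N) b u,
            forall v : R -> R,
              Cn_gamma (n 0%N) gamma T v ->
              solves_equation T m alpha a v ->
              has_initial_values T (n 0%N) b v ->
              forall t, 0 <= t <= T -> v t = u t
          & forall t, 0 <= t <= T ->
              u t = \sum_(0 <= j < n 0%N) b j * y j t]].
Proof.
move=> y.
have alpha_le k i : (i <= k)%N -> (k <= m)%N -> alpha k <= alpha i.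
  elim: k => [|k IH]; first by rewrite leqn0 => /eqP ->.
  rewrite leq_eqVlt => /predU1P[-> //|]; rewrite ltnS => ik km.
  by rewrite (le_trans (ltW (alpha_decr k km)))// IH// ltnW.
have alpha_pos i : (i <= m)%N -> 0 <= alpha i.
  by move=> im; rewrite (le_trans alpha_ge0)// alpha_le.
have alpha_lt0 i : (1 <= i < m.+1)%N -> alpha i < alpha 0%N.
  move=> /andP[i1 im]; apply: (@le_lt_trans _ _ (alpha 1%N)); first exact: alpha_le.
  exact: alpha_decr.
have alpha0_gt0 : 0 < alpha 0%N.
  by apply: (le_lt_trans (alpha_pos 1%N hm)); exact: alpha_decr.
have n00 : (0 < n 0%N)%N.
  have /andP[_ h0] := hn 0%N isT; rewrite -(ltr_nat R).
  exact: lt_le_trans h0.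
have [p n0p] : exists p, n 0%N = p.+1 by exists (n 0%N).-1; rewrite prednK.
rewrite n0p in hgamma hh ha *.
have g01 : 0 <= gamma < 1.
  have /andP[h1 h2] := hn 0%N isT; rewrite n0p in h1 h2.
  by rewrite hgamma; apply/andP; split; lra.
rewrite -hgamma in ha.
have alpha_le_n i : (1 <= i < m.+1)%N -> alpha i <= (n i)%:R.
  by move=> /andP[_ im]; have /andP[] := hn i im.
have n_le i : (i <= m)%N -> (n i <= p.+1)%N.
  move=> im; have /andP[h1 _] := hn i im; have /andP[_ h2] := hn 0%N isT.
  have h3 := alpha_le i 0%N isT im; rewrite n0p in h2.
  by rewrite -ltnS -(ltr_nat R) -(natr1 p.+1); lra.
have [abar habar] : exists abar : nat -> R -> R, forall i, (1 <= i < m.+1)%N ->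
    [/\ sing (2 * T) 0 (abar i), forall t, 0 <= t <= T -> abar i t = a i t,
    cvg (abar i t @[t --> 0^'+]) &
    0 < gamma -> exists2 f', sing (2 * T) gamma f' & abar i = RL_int 1 f'].
  have /choice[f Hf] : forall i, exists g : R -> R, (1 <= i < m.+1)%N ->
      [/\ sing (2 * T) 0 g, forall t, 0 <= t <= T -> g t = a i t,
      cvg (g t @[t --> 0^'+]) &
      0 < gamma -> exists2 f', sing (2 * T) gamma f' & g = RL_int 1 f'].
    move=> i; case: (boolP (1 <= i < m.+1)%N) => im; last by exists (fun=> 0).
    have [c1 c2 c3] := ha i im.
    by have [g Hg] := coef_extension hT g01 c1 c2 c3; exists g.
  by exists f.
have sa i (im : (1 <= i < m.+1)%N) : sing (2 * T) 0 (abar i) by case: (habar i im).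
have aE i t (im : (1 <= i < m.+1)%N) : 0 <= t <= T -> abar i t = a i t.
  by case: (habar i im) => _ + _ _; apply.
have T2 : 0 < 2 * T by rewrite mulr_gt0.
have TU : T < 2 * T by lra.
pose x (cc : nat -> R) := neumann (volterra m alpha abar) (volterra_source m p alpha n abar cc).
have sx cc : sing (2 * T) 0 (x cc) by exact: sing_solution.
have xE cc t : 0 < t < 2 * T -> x cc t =
    - (volterra_source m p alpha n abar cc t + volterra m alpha abar (x cc) t).
  exact: solutionE.
have hx cc : has_gamma_derivative T gamma (x cc).
  have /andP[] := g01; rewrite le_eqVlt => /predU1P[/esym g0|g0] _.
    apply: has_gamma_derivative_cvg => //; apply: (is_cvg_solution (T := T)) => // i im.
    by case: (habar i im).
  have /choice[a' Ha'] : forall i, exists f' : R -> R, (1 <= i < m.+1)%N ->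
      sing (2 * T) gamma f' /\ abar i = RL_int 1 f'.
    move=> i; case: (boolP (1 <= i < m.+1)%N) => im; last by exists (fun=> 0).
    by have [_ _ _ /(_ g0)[f' sf' fE]] := habar i im; exists f'.
  have sa' i (im : (1 <= i < m.+1)%N) : sing (2 * T) gamma (a' i) by have [] := Ha' i im.
  have aE' i (im : (1 <= i < m.+1)%N) : abar i = RL_int 1 (a' i) by have [] := Ha' i im.
  have [z sz xz] := @solution_primitive _ T hT m p alpha n abar gamma g01 alpha_lt0 alpha_le_n sa cc a' sa' aE'.
  exact: (has_gamma_derivative_primitive hT g01 g0 (sx cc) sz xz).
pose d (j k : nat) : R := (k == j)%:R.
(* As alpha decreases, H_j is a final segment of {1, ..., m}; membership of i reads [n i] <= j
   because [n i] is the ceiling of [alpha i]. *)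
have hj j : (j < p.+1)%N -> (1 <= h j)%N /\
    (forall i, (1 <= i < m.+1)%N -> (h j <= i)%N = (n i <= j)%N).
  move=> jp; have [[/andP[h1 hm'] /andP[_ hjj]] hmin] := hh j jp.
  split=> // i /[dup] im /andP[i1 im'].
  have nij : (n i <= j)%N = (alpha i <= j%:R).
    have /andP[h2 h3] := hn i im'.
    apply/idP/idP => [nj|aj]; first by rewrite (le_trans h3)// ler_nat.
    by rewrite -ltnS -(ltr_nat R) -natr1; lra.
  rewrite nij; apply/idP/idP => [hi|aj].
    by rewrite (le_trans _ hjj)// alpha_le.
  by apply: hmin; split; [apply/andP|rewrite alpha_pos].
have yE j t : (j < p.+1)%N -> 0 <= t <= T ->
    y j t = frac_taylor p.+1 (d j) (alpha 0%N) (x (d j)) 0 0 t.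
  move=> jp tT; have [h1 h2] := hj j jp.
  exact: (series_solutionE hT alpha0_gt0 alpha_lt0 alpha_le_n sa aE jp h1 h2 tT).
(* By linearity this solves the Volterra equation whose source comes from [b], so the sum of the b_j
   y_j falls under [sol] just as the y_j do. *)
pose xu t := \sum_(0 <= j < p.+1) b j * x (d j) t.
have sxu : sing (2 * T) 0 xu by apply: sing_sum => j _; exact: singZ.
have xuE t : 0 < t < 2 * T -> xu t =
    - (volterra_source m p alpha n abar b t + volterra m alpha abar xu t).
  move=> tU; rewrite (volterra_sum abar alpha_lt0 _ b tU) ?volterra_source_sum; last by move=> j; exact: sx.
  rewrite -big_split/= -sumrN; apply: eq_bigr => j _.
  by rewrite -mulrDr -mulrN -xE.
pose u t := \sum_(0 <= j < p.+1) b j * y j t.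
have uE t : 0 <= t <= T -> u t = frac_taylor p.+1 b (alpha 0%N) xu 0 0 t.
  move=> tT; rewrite /u big_nat; under eq_bigr => j /andP[_ jp] do rewrite yE//.
  rewrite -big_nat /frac_taylor; under eq_bigr do rewrite mulrDr.
  rewrite big_split/=; congr (_ + _); last first.
    have tU : 0 <= t < 2 * T by case/andP: tT => -> /le_lt_trans ->.
    rewrite subr0 /xu (RL_int_sum _ (ltW alpha0_gt0) ltr01 tU); last by move=> j _; exact: singZ.
    by apply: eq_bigr => j _; rewrite (RL_intZ _ (ltW alpha0_gt0) ltr01 tU).
  under eq_bigr do rewrite big_distrr/=.
  rewrite exchange_big/= [LHS]big_nat [RHS]big_nat; apply: eq_bigr => k /andP[_ kp].
  rewrite (bigD1_seq k) ?mem_index_iota ?iota_uniq//= /d eqxx mul1r big1 ?addr0// => j jk.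
  by rewrite eq_sym (negbTE jk) mul0r mulr0.
have sol cc z v : sing (2 * T) 0 z -> has_gamma_derivative T gamma z ->
    (forall t, 0 < t < 2 * T -> z t =
      - (volterra_source m p alpha n abar cc t + volterra m alpha abar z t)) ->
    (forall t, 0 <= t <= T -> v t = frac_taylor p.+1 cc (alpha 0%N) z 0 0 t) ->
    [/\ Cn_gamma p.+1 gamma T v, solves_equation T m alpha a v &
        has_initial_values T p.+1 cc v].
  move=> sz hz zE vE; split.
  - exact: (represented_Cn_gamma hT hn n0p sz vE).
  - apply: (represented_solves hT hn alpha_lt0 n0p n_le aE sz vE) => t /andP[t0 tT].
    by apply: zE; rewrite t0 (lt_trans tT).
  - exact: (represented_initial hT hn n0p sz vE).
have soly j : (j < p.+1)%N -> [/\ Cn_gamma p.+1 gamma T (y j),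
    solves_equation T m alpha a (y j) & has_initial_values T p.+1 (d j) (y j)].
  by move=> jp; apply: (sol (d j) (x (d j))) => // t; [exact: xE|exact: yE].
have hxu : has_gamma_derivative T gamma xu.
  exact: (has_gamma_derivative_sum hT g01 b (fun j => sx (d j)) (fun j _ => hx (d j))).
have [uC uS uI] := sol b xu u sxu hxu xuE uE.
split.
- move=> j jp t tT; have [h1 h2] := hj j jp.
  apply/cvg_ex; eexists.
  exact: (cvg_series_term hT alpha0_gt0 alpha_lt0 alpha_le_n sa aE jp h1 h2 tT).
- by move=> j /soly[].
- by move=> j /soly[].
exists u; split=> // v vC vS vI t tT.
(* A competing solution is given a function [z] of its own. Its coefficients [cc] are derivatives at
   0, whereas the initial conditions are right limits; [represented_initial] identifies the two. *)
have [z sz] := Cn_gamma_frac_taylor hT g01 vC.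
rewrite (_ : p.+1%:R - gamma = alpha 0%N); last by rewrite hgamma; ring.
set cc := fun k => _ => vE.
have ccb k : (k < p.+1)%N -> cc k = b k.
  move=> kp; have := represented_initial hT hn n0p sz vE kp => H.
  exact: (cvg_unique _ H (vI k kp)).
have {}vE s : 0 <= s <= T -> v s = frac_taylor p.+1 b (alpha 0%N) z 0 0 s.
  move=> /vE ->; rewrite /frac_taylor; congr (_ + _).
  by rewrite big_nat [RHS]big_nat; apply: eq_bigr => k /andP[_ kp]; rewrite ccb.
have zE := represented_solves_inv hT hn alpha_lt0 n0p n_le aE sz vE vS.
(* The equation for [z] is available on ]0, T[ only, so the contraction argument is run there
   instead of on ]0, 2 T[. *)
have sT f c : sing (2 * T) c f -> sing T c f.
  move=> [cf [N N0 fN]]; split.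
    by move=> s /andP[s0 sT]; apply: cf; rewrite s0 (lt_trans sT).
  by exists N => // s /andP[s0 sT]; apply: fN; rewrite s0 (lt_trans sT).
have saT i (im : (1 <= i < m.+1)%N) : sing T 0 (abar i) by apply: sT; exact: sa.
(* In the difference the sources cancel, and it satisfies the homogeneous equation g = - A g. *)
have D0 s : 0 < s < T -> z s - xu s = 0.
  apply: (@eq0_of_contraction _ T 0 (volterra m alpha abar) (fun s => z s - xu s)).
  - by rewrite lexx ltr01.
  - exact: weight_small_volterra.
  - by apply: singB; exact: sT.
  - move=> r rT; rewrite (volterraB abar alpha_lt0 rT (sT _ _ sz) (sT _ _ sxu)).
    have rU : 0 < r < 2 * T by case/andP : rT => -> /lt_trans ->.
    have -> : z r - xu r = - (volterra m alpha abar z r - volterra m alpha abar xu r).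
      by rewrite zE// xuE//; ring.
    by rewrite normrN.
rewrite vE// uE// /frac_taylor !subr0; congr (_ + _).
have tU : 0 <= t < 2 * T by case/andP: tT => -> /le_lt_trans ->.
apply: (eq_RL_int_sing alpha0_gt0 ltr01 ltr01 tU sz sxu) => s /andP[s0 st].
apply/eqP; rewrite -subr_eq0 D0// s0 (lt_le_trans st)//.
by case/andP : tT.
Qed.
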